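(* Let $m\in(1,2]$ and let $U\in C^3(\mathbb{R}^d)$ with $\int e^{-U}<\infty$ satisfy: (A) there exists $A_1\ge0$ with $\|D^kU(q)\|\le A_1(\|q\|+1)^{m-k}$ for all $q$ and $k=2,3$; (B) there exist $A_2>0$, $R\ge0$ with $D^2U(q)\{\nabla U(q)\otimes\nabla U(q)\}\ge A_2\|q\|^{3m-4}$ for all $\|q\|\ge R$; (C) there exist $A_3>0$, $A_4\in\mathbb{R}$ with $\langle\nabla U(q),q\rangle\ge A_3\|q\|^m-A_4$ for all $q$. (a) If $m\in(1,2)$, then for all $T\in\mathbb{N}^*$ and $h>0$, the HMC kernel $P_{h,T}$ is geometrically ergodic. (b) If $m=2$, then for all $T\in\mathbb{N}^*$ there exists $h_H>0$ such that for all $h\in(0,h_H]$, $P_{h,T}$ is geometrically ergodic.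
   Context: $\pi$ is the probability density proportional to $e^{-U}$, $H(q,p)=U(q)+\|p\|^2/2$; $D^kU$ is the $k$-th differential with operator norm, $D^2U(q)\{a\otimes b\}=\langle a,\nabla^2U(q)b\rangle$. For $h>0$ the leapfrog map is $\Phi_h=\Psi^{(1)}_h\circ\Psi^{(2)}_h\circ\Psi^{(1)}_h$ with $\Psi^{(1)}_h(q,p)=(q,p-(h/2)\nabla U(q))$, $\Psi^{(2)}_h(q,p)=(q+hp,p)$; $\Phi_h^{\circ T}$ is the $T$-fold composition and $\Phi^{q,T}_h$ its position component. With $\alpha_H((q,p),(\tilde q,\tilde p))=\min[1,\exp(H(q,p)-H(\tilde q,\tilde p))]$ and $\varphi$ the standard Gaussian density on $\mathbb{R}^d$, the HMC kernel is $P_{h,T}(q,A)=\int 1_A(\Phi^{q,T}_h(q,p))\alpha_H((q,p),\Phi_h^{\circ T}(q,p))\varphi(p)dp+\delta_q(A)\int[1-\alpha_H((q,p),\Phi_h^{\circ T}(q,p))]\varphi(p)dp$; it has $\pi$ as invariant distribution. Geometric ergodicity: there exist a measurable $V:\mathbb{R}^d\to[1,\infty)$, $\rho\in[0,1)$ and $\varsigma\ge0$ such that $\|P^k_{h,T}(q,\cdot)-\pi\|_V\le\varsigma\rho^kV(q)$ for all $q$ and $k$, where $\|\mu-\nu\|_V=\sup_{|f|\le V}|\mu(f)-\nu(f)|$. *)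

(* Defs.v *)
From HB Require Import structures.
From mathcomp Require Import all_boot all_order all_algebra.
From mathcomp Require Import all_classical all_reals all_analysis.
Set Implicit Arguments. Unset Strict Implicit. Unset Printing Implicit Defensive.
Import Order.TTheory GRing.Theory Num.Theory.
Import numFieldNormedType.Exports.
Local Open Scope classical_set_scope.
Local Open Scope ring_scope.

Definition dotv {R : realType} {d : nat} (a b : 'rV[R]_d) : R :=
  \sum_(i < d) a 0 i * b 0 i.
(* Euclidean norm (the library norm on 'rV is the max-norm, hence this one) *)
Definition enorm {R : realType} {d : nat} (a : 'rV[R]_d) : R := Num.sqrt (dotv a a).
Definition ebasis {R : realType} {d : nat} (i : 'I_d) : 'rV[R]_d := delta_mx 0 i.

Definition partial {R : realType} {d : nat} (i : 'I_d) (f : 'rV[R]_d -> R)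
  : 'rV[R]_d -> R := fun x => derive f x (ebasis i).

Definition isC3 {R : realType} {d : nat} (U : 'rV[R]_d -> R) : Prop :=
  continuous U /\
  (forall i x, derivable U x (ebasis i)) /\
  (forall i, continuous (partial i U)) /\
  (forall i j x, derivable (partial j U) x (ebasis i)) /\
  (forall i j, continuous (partial i (partial j U))) /\
  (forall i j k x, derivable (partial j (partial k U)) x (ebasis i)) /\
  (forall i j k, continuous (partial i (partial j (partial k U)))).

Definition grad {R : realType} {d : nat} (U : 'rV[R]_d -> R) (q : 'rV[R]_d) : 'rV[R]_d :=
  \row_i partial i U q.

Definition D2 {R : realType} {d : nat} (U : 'rV[R]_d -> R) (q a b : 'rV[R]_d) : R :=
  \sum_(i < d) \sum_(j < d) a 0 i * partial i (partial j U) q * b 0 j.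
Definition D3 {R : realType} {d : nat} (U : 'rV[R]_d -> R) (q a b c : 'rV[R]_d) : R :=
  \sum_(i < d) \sum_(j < d) \sum_(k < d)
     a 0 i * b 0 j * c 0 k * partial i (partial j (partial k U)) q.

Definition opnorm2 {R : realType} {d : nat} (U : 'rV[R]_d -> R) (q : 'rV[R]_d) : \bar R :=
  ereal_sup [set x | exists a b : 'rV[R]_d,
     enorm a <= 1 /\ enorm b <= 1 /\ x = (`|D2 U q a b|)%:E].
Definition opnorm3 {R : realType} {d : nat} (U : 'rV[R]_d -> R) (q : 'rV[R]_d) : \bar R :=
  ereal_sup [set x | exists a b c : 'rV[R]_d,
     enorm a <= 1 /\ enorm b <= 1 /\ enorm c <= 1 /\ x = (`|D3 U q a b c|)%:E].

(* ---------- Lebesgue integral on R^d (iterated, Tonelli) ---------- *)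
Definition upd {R : realType} {d : nat} (x : 'rV[R]_d) (k : nat) (t : R) : 'rV[R]_d :=
  \row_j (if (j : nat) == k then t else x 0 j).

Fixpoint iint_aux {R : realType} {d : nat} (n : nat) (g : 'rV[R]_d -> \bar R)
    (x : 'rV[R]_d) : \bar R :=
  match n with
  | 0 => g x
  | n'.+1 => (\int[@lebesgue_measure R]_t iint_aux n' g (upd x n' t))%E
  end.

(* integral over R^d w.r.t. Lebesgue measure of a nonnegative function *)
Definition iint {R : realType} {d : nat} (g : 'rV[R]_d -> \bar R) : \bar R :=
  iint_aux d g 0.

Definition borel_rV {R : realType} {d : nat} (A : set 'rV[R]_d) : Prop :=
  <<s open >> A.
Definition rV_measurable {R : realType} {d : nat} (f : 'rV[R]_d -> R) : Prop :=
  forall B : set R, measurable B -> borel_rV (f @^-1` B).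

Definition posp {R : realType} {d : nat} (f : 'rV[R]_d -> R) : 'rV[R]_d -> \bar R :=
  fun x => (Num.max (f x) 0)%:E.
Definition negp {R : realType} {d : nat} (f : 'rV[R]_d -> R) : 'rV[R]_d -> \bar R :=
  fun x => (Num.max (- f x) 0)%:E.

Definition Zconst {R : realType} {d : nat} (U : 'rV[R]_d -> R) : R :=
  fine (iint (fun q => (expR (- U q))%:E)).
Definition pi_int {R : realType} {d : nat} (U : 'rV[R]_d -> R) (f : 'rV[R]_d -> R) : \bar R :=
  (iint (fun q => posp f q * (expR (- U q) / Zconst U)%:E)
   - iint (fun q => negp f q * (expR (- U q) / Zconst U)%:E))%E.

Definition Ham {R : realType} {d : nat} (U : 'rV[R]_d -> R) (z : 'rV[R]_d * 'rV[R]_d) : R :=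
  U z.1 + dotv z.2 z.2 / 2.
Definition Psi1 {R : realType} {d : nat} (U : 'rV[R]_d -> R) (h : R)
  (z : 'rV[R]_d * 'rV[R]_d) : 'rV[R]_d * 'rV[R]_d := (z.1, z.2 - (h / 2) *: grad U z.1).
Definition Psi2 {R : realType} {d : nat} (h : R)
  (z : 'rV[R]_d * 'rV[R]_d) : 'rV[R]_d * 'rV[R]_d := (z.1 + h *: z.2, z.2).
Definition leapfrog {R : realType} {d : nat} (U : 'rV[R]_d -> R) (h : R) z :=
  Psi1 U h (Psi2 h (Psi1 U h z)).
Definition leapfrogT {R : realType} {d : nat} (U : 'rV[R]_d -> R) (h : R) (T : nat) z :=
  iter T (leapfrog U h) z.
Definition accept {R : realType} {d : nat} (U : 'rV[R]_d -> R)
  (z z' : 'rV[R]_d * 'rV[R]_d) : R := Num.min 1 (expR (Ham U z - Ham U z')).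
Definition gauss {R : realType} {d : nat} (p : 'rV[R]_d) : R :=
  (Num.sqrt (2 * pi)) ^- d * expR (- (dotv p p / 2)).

(* P_{h,T} acting on nonnegative (extended) functions: (P g)(q) = \int g(y) P(q,dy) *)
Definition hmcP {R : realType} {d : nat} (U : 'rV[R]_d -> R) (h : R) (T : nat)
  (g : 'rV[R]_d -> \bar R) (q : 'rV[R]_d) : \bar R :=
  (iint (fun p => g (leapfrogT U h T (q, p)).1
                   * (accept U (q, p) (leapfrogT U h T (q, p)) * gauss p)%:E)
   + g q * iint (fun p => ((1 - accept U (q, p) (leapfrogT U h T (q, p))) * gauss p)%:E))%E.

Definition hmcPk {R : realType} {d : nat} (U : 'rV[R]_d -> R) (h : R) (T k : nat)
  (g : 'rV[R]_d -> \bar R) : 'rV[R]_d -> \bar R := iter k (hmcP U h T) g.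

Definition hmc_int {R : realType} {d : nat} (U : 'rV[R]_d -> R) (h : R) (T k : nat)
  (f : 'rV[R]_d -> R) (q : 'rV[R]_d) : \bar R :=
  (hmcPk U h T k (posp f) q - hmcPk U h T k (negp f) q)%E.

Definition Vnorm_dist {R : realType} {d : nat} (U : 'rV[R]_d -> R) (h : R) (T k : nat)
  (V : 'rV[R]_d -> R) (q : 'rV[R]_d) : \bar R :=
  ereal_sup [set x | exists f : 'rV[R]_d -> R,
     rV_measurable f /\ (forall y, `|f y| <= V y) /\
     x = `|(hmc_int U h T k f q - pi_int U f)%E|%E].

Definition geometrically_ergodic {R : realType} {d : nat} (U : 'rV[R]_d -> R)
  (h : R) (T : nat) : Prop :=
  exists V : 'rV[R]_d -> R,
    rV_measurable V /\ (forall q, 1 <= V q) /\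
    exists rho vs : R, 0 <= rho < 1 /\ 0 <= vs /\
      forall q k, (Vnorm_dist U h T k V q <= (vs * rho ^+ k * V q)%:E)%E.

(* Main.v *)
(** Proof idea.  Take V(q) = exp |q| and apply the Harris theorem of Hairer and
    Mattingly.

    Drift.  With r = |q|, put X = r^(m-1) and eta = r^(m-2), the orders of the
    gradient and of the Hessian of U near q, and s = T h.  If |p| <= c0 s X, one
    trajectory moves q by O(s^2 X), and everything is controlled by the size of
    s^2 eta, which tends to 0 when m < 2 and is small for small h when m = 2.
    The gradient terms in the energy error telescope to
    h^2/8 (|grad U(q_T)|^2 - |grad U(q_0)|^2), which (B) makes negative at leading
    order, so the proposal is accepted; by (C) it lies closer to the origin by a
    multiple of X.  Momenta with |p| > c0 s X move q by O(|p|) and have Gaussian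
    weight exponentially small in X.

    Minorization.  From any q in a ball, a large fixed momentum p0 throws the
    trajectory into the region where s^2 eta is small; there p |-> q_T is a small
    perturbation of p |-> q + s p, hence is onto a fixed cube and Lipschitz.

    Invariance of pi follows from reversibility of the leapfrog map under the
    momentum flip and from the invariance of the volume under shears; pi(V) is
    finite by drift and truncation. *)
Require Import Defs.
From HB Require Import structures.
From mathcomp Require Import all_boot all_order all_algebra.
From mathcomp Require Import all_classical all_reals all_analysis.
From mathcomp Require Import measurable_realfun.
From mathcomp Require Import ring lra.
Set Implicit Arguments. Unset Strict Implicit. Unset Printing Implicit Defensive.
Import Order.TTheory GRing.Theory Num.Theory.
Import numFieldNormedType.Exports.
Local Open Scope classical_set_scope.
Local Open Scope ring_scope.

(** * The Euclidean norm *)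

(** One dimensionless number carries the estimates. By (A), near a point of norm r the third
    differential has order eta / r, and X = eta r; hence the trapezoidal error of T steps is s^2 eta
    times the gain h^2 s^2 eta X^2 of the telescoped gradients, up to a power of T. The same ratio
    governs the error in the position. So both cases of the theorem ask only that h^2 r^(m-2) be
    eventually below a threshold not depending on h; this independence is what produces h_H when m =
    2.

    The exponential of |q| suits every m in (1,2]: X tends to infinity with r, so a gain of order X
    in |q| beats any constant factor, while the gradient grows at most linearly, so the loss is the
    exponential of a multiple of |p|, which the Gaussian integrates.

    For the minorization, s^2 eta need not be small near the origin, and p |-> q_T may fold there.
    Two trajectories from the same q differ only after the first step, when both are already far
    away, so the Hessian near the origin never enters their comparison. The law of q_T is then
    bounded below by comparing volumes of dyadic cubes, with no Jacobian. *)

Section euclid.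
Context {R : realType} {d : nat}.
Implicit Types (a b c : 'rV[R]_d) (k : R).

Lemma dotvC a b : dotv a b = dotv b a.
Proof. by apply: eq_bigr => i _; rewrite mulrC. Qed.
Lemma dotvDl a b c : dotv (a + b) c = dotv a c + dotv b c.
Proof. by rewrite -big_split; apply: eq_bigr => i _; rewrite mxE mulrDl. Qed.
Lemma dotvDr a b c : dotv c (a + b) = dotv c a + dotv c b.
Proof. by rewrite !(dotvC c) dotvDl. Qed.
Lemma dotvZl k a b : dotv (k *: a) b = k * dotv a b.
Proof. by rewrite mulr_sumr; apply: eq_bigr => i _; rewrite mxE mulrA. Qed.
Lemma dotvZr k a b : dotv a (k *: b) = k * dotv a b.
Proof. by rewrite dotvC dotvZl dotvC. Qed.
Lemma dotvNl a b : dotv (- a) b = - dotv a b.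
Proof. by rewrite -scaleN1r dotvZl mulN1r. Qed.
Lemma dotvNr a b : dotv a (- b) = - dotv a b.
Proof. by rewrite dotvC dotvNl dotvC. Qed.
Definition dotvE := (dotvDl, dotvDr, dotvZl, dotvZr, dotvNl, dotvNr).

Lemma dotv_ge0 a : 0 <= dotv a a.
Proof. by apply: sumr_ge0 => i _; rewrite -expr2 sqr_ge0. Qed.
Lemma enorm_ge0 a : 0 <= enorm a.
Proof. exact: sqrtr_ge0. Qed.
Hint Resolve enorm_ge0 : core.
Lemma enorm_sqr a : enorm a ^+ 2 = dotv a a.
Proof. by rewrite sqr_sqrtr ?dotv_ge0. Qed.
Lemma coord_enorm a i : `|a 0 i| <= enorm a.
Proof.
rewrite -sqrtr_sqr ler_sqrt ?dotv_ge0 //.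
by rewrite /dotv (bigD1 i) //= expr2 lerDl sumr_ge0 // => j _; rewrite -expr2 sqr_ge0.
Qed.

Lemma cauchy_schwarz a b : `|dotv a b| <= enorm a * enorm b.
Proof.
rewrite -(@ler_pXn2r _ 2) ?nnegrE ?mulr_ge0 //.
rewrite exprMn !enorm_sqr real_normK ?num_real //.
have [b0|bN0] := eqVneq (dotv b b) 0.
  have e i : b 0 i = 0.
    apply/eqP; rewrite -normr_eq0 eq_le normr_ge0 andbT.
    by rewrite (le_trans (coord_enorm b i))// /enorm b0 sqrtr0.
  rewrite [dotv a b]big1 ?expr0n /= ?mulr_ge0 ?dotv_ge0 //.
  by move=> i _; rewrite e mulr0.
have bp : 0 < dotv b b by rewrite lt_neqAle eq_sym bN0 dotv_ge0.
have := dotv_ge0 (dotv b b *: a - dotv a b *: b).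
rewrite !dotvE (dotvC b a) => H.
have : 0 <= dotv b b * (dotv b b * dotv a a - dotv a b ^+ 2) by nra.
by rewrite pmulr_rge0 // subr_ge0 mulrC.
Qed.
Lemma dotv_le a b : dotv a b <= enorm a * enorm b.
Proof. exact: le_trans (ler_norm _) (cauchy_schwarz _ _). Qed.
Lemma dotv_ge a b : - (enorm a * enorm b) <= dotv a b.
Proof. by have := cauchy_schwarz a b; rewrite ler_norml => /andP[]. Qed.

Lemma enormD a b : enorm (a + b) <= enorm a + enorm b.
Proof.
rewrite -(@ler_pXn2r _ 2) ?nnegrE ?addr_ge0 //.
rewrite enorm_sqr !dotvE (dotvC b a) sqrrD !enorm_sqr.
have := dotv_le a b; lra.
Qed.
Lemma enormZ k a : enorm (k *: a) = `|k| * enorm a.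
Proof.
apply/eqP; rewrite -(@eqrXn2 _ 2) ?mulr_ge0 //.
by rewrite exprMn !enorm_sqr !dotvE real_normK ?num_real // mulrA expr2.
Qed.
Lemma enormN a : enorm (- a) = enorm a.
Proof. by rewrite -scaleN1r enormZ normrN normr1 mul1r. Qed.
Lemma enormB a b : enorm (a - b) <= enorm a + enorm b.
Proof. by rewrite -(enormN b) enormD. Qed.
Lemma enorm0 : enorm (0 : 'rV[R]_d) = 0.
Proof. by rewrite -(scale0r 0) enormZ normr0 mul0r. Qed.
Lemma enorm_dist a b : enorm (a - b) = enorm (b - a).
Proof. by rewrite -enormN opprB. Qed.
Lemma enorm_tri c a b : enorm (a - b) <= enorm (a - c) + enorm (c - b).
Proof. by rewrite -[a - b](subrK (c - b)) (le_trans (enormD _ _))// !opprB addrA subrK. Qed.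
Lemma enorm_le_add a b : enorm a <= enorm b + enorm (a - b).
Proof. by rewrite -{1}(subrK b a) addrC enormD. Qed.

(** Topology and completeness of row vectors come from the max norm, the estimates from the
    Euclidean one. This bound and [enorm_le_mxnorm] are the passage between them, and the source of
    the factors [d%:R] further on. *)
Lemma mxnorm_le_enorm a : `|a| <= enorm a.
Proof.
have [->|a0] := eqVneq `|a| 0; first exact: enorm_ge0.
rewrite /Num.norm /= in a0 *.
have [[i j] /= ->] := mx_norm_neq0 a0.
by rewrite (ord1 i) coord_enorm.
Qed.
Lemma coord_mxnorm a i : `|a 0 i| <= `|a|.
Proof.
rewrite /Num.norm /= mx_normrE.
by apply: le_trans (le_bigmax _ _ (0, i)).
Qed.
Lemma enorm_le_mxnorm a : enorm a <= d%:R * `|a|.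
Proof.
have s : enorm a <= \sum_(i < d) `|a 0 i|.
  rewrite -(@ler_pXn2r _ 2) ?nnegrE ?sumr_ge0 // enorm_sqr expr2 mulr_suml.
  apply: ler_sum => i _; rewrite (le_trans (ler_norm _))// normrM.
  by rewrite ler_wpM2l // (bigD1 i) //= lerDl sumr_ge0.
apply: le_trans s _.
rewrite -[X in _ <= X%:R * _](card_ord d) mulr_natl -sumr_const.
by apply: ler_sum => i _; exact: coord_mxnorm.
Qed.

Lemma coord_le_mxnorm a (e : R) : 0 <= e -> (forall i, `|a 0 i| <= e) -> `|a| <= e.
Proof.
move=> e0 H; rewrite /Num.norm /= mx_normrE.
by apply/bigmax_leP; split => // -[i j] _ /=; rewrite (ord1 i).
Qed.
End euclid.
#[export] Hint Extern 0 (is_true (0 <= enorm _)) => solve [apply: enorm_ge0] : core.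

(** * Differential calculus of U *)

Section one_variable.
Context {R : realType}.
Implicit Types (f df : R -> R).

Lemma is_derive1P f x l :
  (h^-1 *: (f (h + x) - f x) @[h --> (0 : R)^']) --> l -> is_derive x (1 : R) f l.
Proof.
move=> H.
have E : (fun h : R => h^-1 *: ((f \o shift x) (h *: (1 : R)) - f x)) =
         (fun h => h^-1 *: (f (h + x) - f x)).
  by apply/funext => h /=; rewrite /shift /= -[h *: 1]/(h * 1) mulr1.
split; first by rewrite /derivable E; apply/cvg_ex; exists l.
by rewrite /derive E; apply/cvg_lim.
Qed.

Lemma MVT_unit f df : (forall x : R, 0 <= x <= 1 -> is_derive x (1 : R) f (df x)) ->
  exists2 c : R, 0 <= c <= 1 & f 1 - f 0 = df c.
Proof.
move=> H.
have cf : {within `[0, 1], continuous f}.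
  apply: continuous_in_subspaceT => x; rewrite inE /= in_itv /= => x01.
  apply: differentiable_continuous.
  by apply/derivable1_diffP; case: (H x x01).
have H' (x : R) : x \in `]0, 1[%R -> is_derive x 1 f (df x).
  by rewrite in_itv /= => /andP[x0 x1]; apply: H; rewrite !ltW.
have [c] := @MVT_segment R f df 0 1 ler01 H' cf.
by rewrite in_itv /= subr0 mulr1 => c01 ->; exists c.
Qed.

Lemma is_deriveZcomp f (c t l : R) : is_derive (t * c) (1 : R) f l ->
  is_derive t (1 : R) (fun u => f (u * c)) (c * l).
Proof.
move=> H.
have H1 : is_derive t (1 : R) (fun u : R => u * c) c.
  have -> : (fun u : R => u * c) = c \*: id by apply/funext => u /=; rewrite mulrC.
  by apply: is_derive_eq; rewrite -[c *: 1]/(c * 1) mulr1.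
by have := is_derive1_comp (f := f) (g := fun u => u * c) H H1; rewrite mulrC.
Qed.
End one_variable.

Section several_variables.
Context {R : realType} {d : nat}.
Implicit Types (f : 'rV[R]_d -> R) (x v w : 'rV[R]_d).

(** Smoothness of [U] is given through partial derivatives only. This one-order condition holds for
    [U], its partials and its second partials, and derivatives along arbitrary lines are deduced
    from it. *)
Definition C1 f := (forall i x, derivable f x (ebasis i)) /\
  (forall i, continuous (partial i f)).

Let trunc (k : nat) v : 'rV[R]_d := \row_j (if (j < k)%N then v 0 j else 0).

Let truncS (k : 'I_d) v : trunc k.+1 v = trunc k v + v 0 k *: ebasis k.
Proof.
apply/rowP => j; rewrite !mxE eqxx /= ltnS leq_eqVlt.
have [->|jk] := eqVneq j k; first by rewrite eqxx ltnn /= add0r mulr1.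
by rewrite val_eqE (negbTE jk) /= mulr0 addr0.
Qed.
Let trunc0 v : trunc 0 v = 0.
Proof. by apply/rowP => j; rewrite !mxE. Qed.
Let truncd v : trunc d v = v.
Proof. by apply/rowP => j; rewrite !mxE ltn_ord. Qed.

Let partial_line f i y s : C1 f ->
  is_derive s (1 : R) (fun t : R => f (y + t *: ebasis i)) (partial i f (y + s *: ebasis i)).
Proof.
move=> [df _]; apply: is_derive1P.
have := df i (y + s *: ebasis i); rewrite /derivable => /cvgP.
rewrite /partial /derive.
set F := (fun h : R => _) => cF.
have -> // : (fun h : R => h^-1 *: (f (y + (h + s) *: ebasis i) - f (y + s *: ebasis i))) = F.
by apply/funext => h; rewrite /F /= /shift /= scalerDl addrCA.
Qed.

(** The segment from [x] to [x + h *: v] is replaced by a staircase that changes one coordinate at a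
    time, [trunc k] keeping the first [k] coordinates. The mean value theorem on each stair gives a
    partial derivative at a point [xi h k]; these points tend to [x], and continuity of the partials
    concludes. *)
Lemma line_quotient f x v : C1 f ->
  (h^-1 *: (f (x + h *: v) - f x) @[h --> (0 : R)^']) --> \sum_(i < d) v 0 i * partial i f x.
Proof.
move=> C1f; have [_ cf] := C1f.
have step (h : R) (k : 'I_d) : exists u : R, 0 <= u <= 1 /\
    f (x + h *: trunc k.+1 v) - f (x + h *: trunc k v) =
    h * v 0 k * partial k f (x + h *: trunc k v + (u * (h * v 0 k)) *: ebasis k).
  have H u := @is_deriveZcomp R _ (h * v 0 k) u _
    (partial_line k (x + h *: trunc k v) (u * (h * v 0 k)) C1f).
  have [c c01 E] := MVT_unit (fun u _ => H u); exists c; split => //.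
  by rewrite -E mul1r mul0r scale0r addr0 truncS scalerDr scalerA addrA.
have {step} /choice[u Hu] : forall h : R, exists u : 'I_d -> R, forall k : 'I_d, 0 <= u k <= 1 /\
    f (x + h *: trunc k.+1 v) - f (x + h *: trunc k v) =
    h * v 0 k * partial k f (x + h *: trunc k v + (u k * (h * v 0 k)) *: ebasis k).
  by move=> h; have /choice[w Hw] := step h; exists w.
pose xi (h : R) (k : 'I_d) := x + h *: trunc k v + (u h k * (h * v 0 k)) *: ebasis k.
have tel h : f (x + h *: v) - f x = \sum_(k < d) h * v 0 k * partial k f (xi h k).
  transitivity (\sum_(0 <= k < d) (f (x + h *: trunc k.+1 v) - f (x + h *: trunc k v))).
    by rewrite telescope_sumr // trunc0 truncd scaler0 addr0.
  by rewrite big_mkord; apply: eq_bigr => k _; rewrite (Hu h k).2.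
have cxi k : xi h k @[h --> (0 : R)^'] --> x.
  apply/cvgrPdist_le => e e0.
  near=> h.
  have -> : x - xi h k = - (h *: trunc k v + (u h k * (h * v 0 k)) *: ebasis k).
    by rewrite /xi -addrA opprD addrA subrr sub0r.
  rewrite normrN.
  apply: coord_le_mxnorm; first exact: ltW.
  move=> j; rewrite !mxE eqxx /=.
  have hv : `|h| * (2 * `|v| + 1) <= e.
    by rewrite -ler_pdivlMr ?ltr_wpDl ?mulr_ge0 //; near: h; apply: dnbhs0_le;
      rewrite divr_gt0 ?ltr_wpDl ?mulr_ge0.
  have [/andP[u0 u1] _] := Hu h k.
  apply: (le_trans (ler_normD _ _)); rewrite !normrM (ger0_norm u0).
  have a1 : `|if (j < k)%N then v 0 j else 0| <= `|v|.
    by case: ifP => _; rewrite ?normr0 // coord_mxnorm.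
  have a2 := coord_mxnorm v k.
  have a3 : `|(j == k)%:R : R| <= 1 by case: (j == k); rewrite ?normr1 ?normr0.
  have a4 : u h k * (`|h| * `|v 0 k|) * `|(j == k)%:R| <= `|h| * `|v|.
    rewrite -[leRHS]mulr1 ler_pM // ?mulr_ge0 //.
    by rewrite -[leRHS]mul1r ler_pM // ?mulr_ge0 // ler_wpM2l.
  have a5 : `|h| * `|if (j < k)%N then v 0 j else 0| <= `|h| * `|v| by rewrite ler_wpM2l.
  have := normr_ge0 h; lra.
apply: (@cvg_trans _ (\sum_(k < d) v 0 k * partial k f (xi h k) @[h --> (0:R)^'])).
  apply: near_eq_cvg; near=> h.
  rewrite tel -[h^-1 *: _]/(h^-1 * _) mulr_sumr; apply: eq_bigr => k _.
  rewrite -mulrA mulKf //; near: h; exact: nbhs_dnbhs_neq.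
elim: (index_enum _) => [|k r IH].
  under eq_cvg do rewrite big_nil; rewrite big_nil; exact: cvg_cst.
under eq_cvg do rewrite big_cons; rewrite big_cons.
apply: cvgD IH; apply: cvgM; first exact: cvg_cst.
apply: (cvg_comp _ _ (cxi k)); exact: cf.
Unshelve. all: by end_near. Qed.

Lemma line_derive f x v t : C1 f ->
  is_derive t (1 : R) (fun s : R => f (x + s *: v)) (\sum_(i < d) v 0 i * partial i f (x + t *: v)).
Proof.
move=> C1f; apply: is_derive1P.
have := line_quotient (x := x + t *: v) (v := v) C1f.
have -> // : (fun h : R => h^-1 *: (f (x + t *: v + h *: v) - f (x + t *: v))) =
  (fun h => h^-1 *: (f (x + (h + t) *: v) - f (x + t *: v))).
by apply/funext => h; rewrite scalerDl [h *: v + _]addrC addrA.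
Qed.

Lemma is_derive_sumf n (h : 'I_n -> R -> R) (dh : 'I_n -> R) t :
  (forall i, is_derive t (1 : R) (h i) (dh i)) ->
  is_derive t (1 : R) (fun s => \sum_(i < n) h i s) (\sum_(i < n) dh i).
Proof.
move=> H; have -> : (fun s => \sum_(i < n) h i s) = \sum_(i < n) h i.
  by apply/funext => s; rewrite fct_sumE.
exact: is_derive_sum.
Qed.

Lemma is_derive_cM (c : R) (h : R -> R) (dh t : R) :
  is_derive t (1 : R) h dh -> is_derive t (1 : R) (fun s => c * h s) (c * dh).
Proof. by move=> H; exact: (@is_deriveZ _ _ _ h c t 1 dh H). Qed.

Variable U : 'rV[R]_d -> R.
Hypothesis U3 : isC3 U.

Lemma C1_U : C1 U.
Proof. by case: U3 => ? [? [? _]]. Qed.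
Lemma C1_partial j : C1 (partial j U).
Proof. by case: U3 => _ [_ [_ [dv [c2 _]]]]; split=> i; [exact: dv|exact: c2]. Qed.
Lemma C1_partial2 j k : C1 (partial j (partial k U)).
Proof. by case: U3 => _ [_ [_ [_ [_ [dv c3]]]]]; split=> i; [exact: dv|exact: c3]. Qed.

Lemma D2Zl x k a b : D2 U x (k *: a) b = k * D2 U x a b.
Proof.
rewrite /D2 mulr_sumr; apply: eq_bigr => i _.
by rewrite mulr_sumr; apply: eq_bigr => j _; rewrite mxE; ring.
Qed.
Lemma D2Zr x k a b : D2 U x a (k *: b) = k * D2 U x a b.
Proof.
rewrite /D2 mulr_sumr; apply: eq_bigr => i _.
by rewrite mulr_sumr; apply: eq_bigr => j _; rewrite mxE; ring.
Qed.
Lemma D2Dl x a a' b : D2 U x (a + a') b = D2 U x a b + D2 U x a' b.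
Proof.
rewrite /D2 -big_split; apply: eq_bigr => i _.
by rewrite -big_split; apply: eq_bigr => j _; rewrite mxE /=; ring.
Qed.
Lemma D3Z1 x k a b c : D3 U x (k *: a) b c = k * D3 U x a b c.
Proof.
rewrite /D3 mulr_sumr; apply: eq_bigr => i _.
rewrite mulr_sumr; apply: eq_bigr => j _.
by rewrite mulr_sumr; apply: eq_bigr => l _; rewrite mxE; ring.
Qed.
Lemma D3Z2 x k a b c : D3 U x a (k *: b) c = k * D3 U x a b c.
Proof.
rewrite /D3 mulr_sumr; apply: eq_bigr => i _.
rewrite mulr_sumr; apply: eq_bigr => j _.
by rewrite mulr_sumr; apply: eq_bigr => l _; rewrite mxE; ring.
Qed.
Lemma D3Z3 x k a b c : D3 U x a b (k *: c) = k * D3 U x a b c.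
Proof.
rewrite /D3 mulr_sumr; apply: eq_bigr => i _.
rewrite mulr_sumr; apply: eq_bigr => j _.
by rewrite mulr_sumr; apply: eq_bigr => l _; rewrite mxE; ring.
Qed.

Lemma U_line x v t : is_derive t (1 : R) (fun s : R => U (x + s *: v)) (dotv (grad U (x + t *: v)) v).
Proof.
have := line_derive x v t C1_U; congr is_derive.
by apply: eq_bigr => i _; rewrite mxE mulrC.
Qed.

Lemma grad_line x v w t :
  is_derive t (1 : R) (fun s : R => dotv (grad U (x + s *: v)) w) (D2 U (x + t *: v) v w).
Proof.
have -> : (fun s : R => dotv (grad U (x + s *: v)) w) =
          (fun s => \sum_(j < d) w 0 j * partial j U (x + s *: v)).
  by apply/funext => s; apply: eq_bigr => j _; rewrite mxE mulrC.
have -> : D2 U (x + t *: v) v w =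
  \sum_(j < d) w 0 j * \sum_(i < d) v 0 i * partial i (partial j U) (x + t *: v).
  rewrite /D2 exchange_big; apply: eq_bigr => j _.
  by rewrite mulr_sumr; apply: eq_bigr => i _; rewrite mulrC.
apply: is_derive_sumf => j; apply: is_derive_cM; exact: line_derive (C1_partial j).
Qed.

Lemma D2_line x v a b t :
  is_derive t (1 : R) (fun s : R => D2 U (x + s *: v) a b) (D3 U (x + t *: v) v a b).
Proof.
have -> : D3 U (x + t *: v) v a b = \sum_(j < d) \sum_(k < d) (a 0 j * b 0 k) *
   \sum_(i < d) v 0 i * partial i (partial j (partial k U)) (x + t *: v).
  rewrite /D3 exchange_big; apply: eq_bigr => j _.
  rewrite exchange_big; apply: eq_bigr => k _.
  by rewrite mulr_sumr; apply: eq_bigr => i _; ring.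
have -> : (fun s : R => D2 U (x + s *: v) a b) =
   (fun s => \sum_(j < d) \sum_(k < d) (a 0 j * b 0 k) * partial j (partial k U) (x + s *: v)).
  by apply/funext => s; apply: eq_bigr => j _; apply: eq_bigr => k _; ring.
apply: is_derive_sumf => j; apply: is_derive_sumf => k.
apply: is_derive_cM; exact: line_derive (C1_partial2 j k).
Qed.

Lemma grad_MVT x v w : exists2 c : R, 0 <= c <= 1 &
  dotv (grad U (x + v)) w - dotv (grad U x) w = D2 U (x + c *: v) v w.
Proof.
have [c c01] := MVT_unit (fun t _ => grad_line x v w t).
by rewrite scale1r scale0r addr0 => ->; exists c.
Qed.

Lemma U_MVT x v : exists2 c : R, 0 <= c <= 1 & U (x + v) - U x = dotv (grad U (x + c *: v)) v.
Proof.
have [c c01] := MVT_unit (fun t _ => U_line x v t).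
by rewrite scale1r scale0r addr0 => ->; exists c.
Qed.

Lemma D2_MVT x v a b : exists2 c : R, 0 <= c <= 1 &
  D2 U (x + v) a b - D2 U x a b = D3 U (x + c *: v) v a b.
Proof.
have [c c01] := MVT_unit (fun t _ => D2_line x v a b t).
by rewrite scale1r scale0r addr0 => ->; exists c.
Qed.

Let unit_comb (c k e : R) : 0 <= c -> c <= 1 -> 0 <= k -> k <= 1 -> 0 <= e -> e <= 1 ->
  0 <= c + k * (e * c - c) <= 1.
Proof.
move=> c0 c1 k0 k1 e0 e1.
have -> : c + k * (e * c - c) = c * (1 - k * (1 - e)) by ring.
have a0 : 0 <= k * (1 - e) by rewrite mulr_ge0 // subr_ge0.
have a1 : k * (1 - e) <= 1 by rewrite mulr_ile1 // ?subr_ge0 // lerBlDr lerDl.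
apply/andP; split; first by rewrite mulr_ge0 // subr_ge0.
by rewrite mulr_ile1 // ?subr_ge0 // lerBlDr lerDl.
Qed.

Let unit_bound (c e p M : R) : 0 <= c -> c <= 1 -> 0 <= e -> e <= 1 -> `|p| <= M ->
  `|2^-1 * (c * ((e * c - c) * p))| <= M.
Proof.
move=> c0 c1 e0 e1 pM; rewrite !normrM.
have M0 : 0 <= M by apply: le_trans pM.
have n1 : `|2^-1 : R| <= 1 by rewrite ger0_norm; lra.
have n2 : `|c| <= 1 by rewrite ger0_norm.
have n3 : `|e * c - c| <= 1.
  have -> : e * c - c = - (c * (1 - e)) by ring.
  rewrite normrN ger0_norm; first by rewrite mulr_ile1 // ?subr_ge0 // lerBlDr lerDl.
  by rewrite mulr_ge0 // subr_ge0.
rewrite -[leRHS]mul1r ler_pM // ?mulr_ge0 // -[leRHS]mul1r ler_pM // ?mulr_ge0 //.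
by rewrite -[leRHS]mul1r ler_pM.
Qed.

(** [E t] is the error of the trapezoidal rule on the segment from 0 to t. Its derivative at the
    point given by the mean value theorem is turned into a third derivative by two further
    applications, to [phi1] and to [phi2]. The sharp factor 1/12 is given up: only the cubic order
    in [v] matters. *)
Lemma trapezoid x v M :
  (forall t : R, 0 <= t <= 1 -> `|D3 U (x + t *: v) v v v| <= M) ->
  `|U (x + v) - U x - dotv (grad U x + grad U (x + v)) v / 2| <= M.
Proof.
move=> H.
pose phi (t : R) := U (x + t *: v); pose phi1 (t : R) := dotv (grad U (x + t *: v)) v.
pose phi2 (t : R) := D2 U (x + t *: v) v v; pose phi3 (t : R) := D3 U (x + t *: v) v v v.
pose E t := phi t - 2^-1 * (t * phi1 t) - 2^-1 * phi1 0 * t.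
pose E1 t := 2^-1 * (phi1 t - phi1 0 - t * phi2 t).
have dE t : is_derive t (1 : R) E (E1 t).
  have h1 := U_line x v t; have h2 := grad_line x v v t.
  have h3 : is_derive t (1 : R) (fun s : R => s * phi1 s) (t * phi2 t + phi1 t).
    have := @is_deriveM _ _ id phi1 t 1 1 (phi2 t) _ h2.
    by move=> /(_ (is_derive_id _ _)); rewrite -[_ *: 1]/(_ * 1) mulr1.
  have h4 := is_deriveB (is_deriveB h1 (is_derive_cM 2^-1 h3))
                      (is_derive_cM (2^-1 * phi1 0) (is_derive_id t (1 : R))).
  have -> : E1 t = phi1 t - 2^-1 * (t * phi2 t + phi1 t) - 2^-1 * phi1 0 * 1.
    by rewrite /E1; field.
  exact: h4.
have [c /andP[c0 c1] Ec] := MVT_unit (fun t _ => dE t).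
have UE : U (x + v) - U x - dotv (grad U x + grad U (x + v)) v / 2 = E1 c.
  by rewrite -Ec /E /phi /phi1 !scale1r !scale0r !addr0 dotvDl; lra.
have [e [/andP[e0 e1] e_eq]] : exists e : R, 0 <= e <= 1 /\ phi1 c - phi1 0 = c * phi2 (e * c).
  have [e e01 E2] := grad_MVT x (c *: v) v; exists e; split => //.
  by rewrite /phi1 /phi2 scale0r addr0 E2 scalerA D2Zl.
have [k [/andP[k0 k1] k_eq]] : exists k : R, 0 <= k <= 1 /\
    phi2 (e * c) - phi2 c = (e * c - c) * phi3 (c + k * (e * c - c)).
  have [k k01 E2] := D2_MVT (x + c *: v) ((e * c - c) *: v) v v; exists k; split => //.
  move: E2; rewrite scalerA D3Z1 -!addrA -!scalerDl.
  by rewrite (_ : c + (e * c - c) = e * c); last by ring.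
rewrite UE.
have -> : E1 c = 2^-1 * (c * ((e * c - c) * phi3 (c + k * (e * c - c)))).
  have alg (p1 p0 p2 q2 p3 : R) : p1 - p0 = c * q2 -> q2 - p2 = (e * c - c) * p3 ->
      2^-1 * (p1 - p0 - c * p2) = 2^-1 * (c * ((e * c - c) * p3)).
    by move=> -> <-; ring.
  exact: alg e_eq k_eq.
have ce01 : 0 <= c + k * (e * c - c) <= 1 by exact: unit_comb.
have b3 : `|phi3 (c + k * (e * c - c))| <= M by exact: H.
exact: unit_bound c0 c1 e0 e1 b3.
Qed.
End several_variables.

(** * Growth of the gradient *)

Section powR_facts.
Context {R : realType}.
Implicit Types x y a : R.

Lemma le_powR x y a : 0 <= a -> 0 <= x -> x <= y -> powR x a <= powR y a.
Proof. by move=> a0 x0 xy; apply: ge0_ler_powR; rewrite ?nnegrE //; lra. Qed.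

Lemma ge_powR x y a : a <= 0 -> 0 < x -> x <= y -> powR y a <= powR x a.
Proof.
move=> a0 x0 xy; rewrite -[a]opprK !(powRN _ (- a)).
rewrite lef_pV2 ?posrE ?powR_gt0 //; first by apply: le_powR => //; lra.
lra.
Qed.

Lemma powR_ge1 x a : 0 <= a -> 1 <= x -> 1 <= powR x a.
Proof. by move=> a0 x1; have := le_powR a0 ler01 x1; rewrite powR1. Qed.

Lemma mulr_powR1 x a b : 0 < x -> b = a + 1 -> powR x b = x * powR x a.
Proof.
move=> x0 ->; rewrite powRD; first by rewrite powRr1 ?(ltW x0) // mulrC.
by rewrite (gt_eqF x0) implybT.
Qed.
End powR_facts.

Section opnorm.
Context {R : realType} {d : nat}.
Variable U : 'rV[R]_d -> R.
Implicit Types (a b c q x v w : 'rV[R]_d).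

Lemma enorm_eq0 a : enorm a = 0 -> a = 0.
Proof.
move=> a0; apply/rowP => i; rewrite mxE; apply/eqP; rewrite -normr_eq0.
by rewrite eq_le normr_ge0 andbT (le_trans (coord_enorm a i))// a0.
Qed.

Lemma enorm_unit a : exists2 u, enorm u <= 1 & a = enorm a *: u.
Proof.
have [a0|a0] := eqVneq (enorm a) 0.
  by exists 0; rewrite ?enorm0 // (enorm_eq0 a0) scaler0.
exists ((enorm a)^-1 *: a); last by rewrite scalerA divff // scale1r.
by rewrite enormZ ger0_norm ?mulVf // invr_ge0 enorm_ge0.
Qed.

Lemma opnorm2_bound q k a b : (opnorm2 U q <= k%:E)%E -> `|D2 U q a b| <= k * enorm a * enorm b.
Proof.
move=> H.
have [u u1 ae] := enorm_unit a; have [v v1 be] := enorm_unit b.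
have H1 : `|D2 U q u v| <= k.
  by rewrite -lee_fin; apply: le_trans H; apply: ereal_sup_ubound; exists u, v.
rewrite {1}ae {1}be D2Zl D2Zr !normrM !(ger0_norm (enorm_ge0 _)) mulrA mulrC.
by rewrite -mulrA ler_wpM2r // mulr_ge0 // enorm_ge0.
Qed.

Lemma opnorm3_bound q k a b c : (opnorm3 U q <= k%:E)%E ->
  `|D3 U q a b c| <= k * enorm a * enorm b * enorm c.
Proof.
move=> H.
have [u u1 ae] := enorm_unit a; have [v v1 be] := enorm_unit b.
have [w w1 ce] := enorm_unit c.
have H1 : `|D3 U q u v w| <= k.
  by rewrite -lee_fin; apply: le_trans H; apply: ereal_sup_ubound; exists u, v, w.
rewrite {1}ae {1}be {1}ce D3Z1 D3Z2 D3Z3 !normrM !(ger0_norm (enorm_ge0 _)) !mulrA mulrC.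
by rewrite -!mulrA ler_wpM2r // !mulr_ge0 // enorm_ge0.
Qed.

End opnorm.

Section growth.
Context {R : realType} {d : nat}.
Variables (U : 'rV[R]_d -> R) (m A1 : R).
Hypothesis U3 : isC3 U.
Hypothesis m12 : 1 < m <= 2.
Hypothesis A1_ge0 : 0 <= A1.
Hypothesis hA : forall q : 'rV[R]_d,
      (opnorm2 U q <= (A1 * powR (enorm q + 1) (m - 2))%:E)%E /\
      (opnorm3 U q <= (A1 * powR (enorm q + 1) (m - 3))%:E)%E.
Local Notation g := (grad U).
Implicit Types (a b c q x v w : 'rV[R]_d).

(** The mean value theorem is scalar, so the difference of gradients [w] is paired with itself and
    one factor [enorm w] is cancelled. *)
Lemma grad_lipschitz x v L :
  (forall t : R, 0 <= t <= 1 -> A1 * powR (enorm (x + t *: v) + 1) (m - 2) <= L) ->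
  enorm (g (x + v) - g x) <= L * enorm v.
Proof.
move=> H; set w := g (x + v) - g x.
have [->|w0] := eqVneq (enorm w) 0.
  have : A1 * powR (enorm (x + 0 *: v) + 1) (m - 2) <= L by apply: H; rewrite lexx ler01.
  move=> h; apply: mulr_ge0; last exact: enorm_ge0.
  by apply: le_trans h; apply: mulr_ge0 => //; exact: powR_ge0.
have wp : 0 < enorm w by rewrite lt_neqAle eq_sym w0 enorm_ge0.
rewrite -(ler_pM2r wp) -expr2 enorm_sqr {1}/w dotvDl dotvNl.
have [c c01 ->] := grad_MVT U3 x v w.
apply: le_trans (ler_norm _) _.
apply: le_trans (opnorm2_bound v w (hA _).1) _.
apply: ler_wpM2r; first exact: enorm_ge0.
by apply: ler_wpM2r; [exact: enorm_ge0|exact: H].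
Qed.

(** Integrating (A) along the ray through [x] turns the exponent m - 2 into m - 1 with the factor 1
    / (m - 1), whence m > 1. The integral is avoided: [F] subtracts the explicit primitive from the
    gradient paired with [w], and (A) makes its derivative nonpositive. *)
Lemma grad_growth : exists2 C0 : R, 0 <= C0 & forall x, enorm (g x) <= C0 * powR (enorm x + 1) (m - 1).
Proof.
case/andP: m12 => m1 m2.
have m10 : 0 < m - 1 by lra.
pose C0 := enorm (g 0) + A1 / (m - 1).
have AM0 : 0 <= A1 / (m - 1) by rewrite divr_ge0 // ltW.
have C00 : 0 <= C0 by rewrite addr_ge0.
exists C0 => // x; set w := g x.
have [->|w0] := eqVneq (enorm w) 0; first by rewrite mulr_ge0 // powR_ge0.
have wp : 0 < enorm w by rewrite lt_neqAle eq_sym w0 enorm_ge0.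
rewrite -(ler_pM2r wp) -expr2 enorm_sqr.
pose F (t : R) := dotv (g (0 + t *: x)) w - (A1 / (m - 1) * enorm w) * powR (t * enorm x + 1) (m - 1).
pose F1 (t : R) := D2 U (0 + t *: x) x w -
   (A1 / (m - 1) * enorm w) * (enorm x * ((m - 1) * powR (t * enorm x + 1) (m - 2))).
have dF (t : R) : 0 <= t <= 1 -> is_derive t (1 : R) F (F1 t).
  move=> /andP[t0 t1].
  have b0 : 0 < t * enorm x + 1 by rewrite ltr_wpDl // mulr_ge0.
  have h1 := grad_line U3 0 x w t.
  have h2 : is_derive (t * enorm x) (1 : R) (fun s : R => powR (s + 1) (m - 1))
       ((m - 1) * powR (t * enorm x + 1) (m - 2)).
    have q1 := is_derive1_powR (m - 1) b0.
    have q2 : is_derive (t * enorm x) (1 : R) (fun s : R => s + 1) 1.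
      have := is_deriveD (is_derive_id (t * enorm x) (1 : R)) (is_derive_cst (1 : R) (t * enorm x) (1 : R)).
      by rewrite addr0.
    have := @is_derive1_comp R (fun y : R => powR y (m - 1)) (fun s : R => s + 1) _ _ _ q1 q2.
    by rewrite mulr1 (_ : m - 1 - 1 = m - 2); last by ring.
  have h3 := is_derive_cM (A1 / (m - 1) * enorm w) (is_deriveZcomp h2).
  exact: is_deriveB h1 h3.
have [c /andP[c0 c1] Fc] := MVT_unit dF.
have Fle : F 1 - F 0 <= 0.
  rewrite Fc /F1 subr_le0 add0r.
  apply: le_trans (ler_norm _) _.
  apply: le_trans (opnorm2_bound x w (hA _).1) _.
  rewrite enormZ ger0_norm // le_eqVlt; apply/orP; left; apply/eqP.
  by field; rewrite subr_eq0 gt_eqF.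
have -> : dotv w w = F 1 - F 0 + dotv (g 0) w + A1 / (m - 1) * enorm w * powR (enorm x + 1) (m - 1)
     - A1 / (m - 1) * enorm w.
  rewrite /F add0r scale1r mul1r scale0r mul0r !add0r powR1 mulr1 /w; ring.
have X1 : 1 <= powR (enorm x + 1) (m - 1) by apply: powR_ge1; [lra|rewrite lerDr].
set X := powR _ _ in X1 *.
have := dotv_le (g 0) w.
have : 0 <= A1 / (m - 1) * enorm w by rewrite mulr_ge0.
have : enorm (g 0) * enorm w <= enorm (g 0) * enorm w * X.
  by rewrite ler_peMr // mulr_ge0.
rewrite /C0; lra.
Qed.

(** On this annulus [enorm x + 1] lies between r / 2 and 4 r, so powers of it are comparable with
    powers of r. The nonpositive exponents m - 2 and m - 3 use the lower end and cost factors 2 and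
    4 ([half]); the exponent m - 1, which is at most 1, costs 4. *)
Lemma annulus_bounds : exists2 C : R, 1 <= C & forall (r : R) x, 1 <= r -> r / 2 <= enorm x -> enorm x <= 3 / 2 * r ->
  [/\ enorm (g x) <= C * powR r (m - 1),
      forall a b, `|D2 U x a b| <= C * powR r (m - 2) * enorm a * enorm b,
      forall a b c, `|D3 U x a b c| <= C * (powR r (m - 2) / r) * enorm a * enorm b * enorm c &
      A1 * powR (enorm x + 1) (m - 2) <= C * powR r (m - 2)].
Proof.
case/andP: m12 => m1 m2.
have [C0 C00 H0] := grad_growth.
have A10 : 0 <= A1 := A1_ge0.
have C1 : 1 <= 4 * C0 + 4 * A1 + 1 by rewrite lerDr addr_ge0 // mulr_ge0.
exists (4 * C0 + 4 * A1 + 1) => //.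
move=> r x r1 rx xr.
have r0 : 0 < r by lra.
have X0 := powR_ge0 r (m - 1); have E0 := powR_ge0 r (m - 2).
have half (e : R) (k : nat) : e <= 0 -> - e <= k%:R -> powR (enorm x + 1) e <= 2 ^+ k * powR r e.
  move=> e0 ek.
  apply: (@le_trans _ _ (powR (r / 2) e)).
    by apply: ge_powR => //; [rewrite divr_gt0|lra].
  rewrite mulrC powRM ?invr_ge0 ?(ltW r0) //; apply: ler_wpM2r; first exact: powR_ge0.
  rewrite -{1}(powR_inv1 (ltW (ltr0Sn R 1))) -powRrM mulN1r -powR_mulrn //.
  by apply: ler_powR => //; lra.
have p2 : powR (enorm x + 1) (m - 2) <= 2 * powR r (m - 2).
  by have := half (m - 2) 1%N; rewrite expr1; apply; lra.
have p3 : powR (enorm x + 1) (m - 3) <= 4 * (powR r (m - 2) / r).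
  have := half (m - 3) 2%N; have -> : 2 ^+ 2 = 4 :> R by ring.
  have -> : powR r (m - 2) = r * powR r (m - 3) by apply: mulr_powR1 => //; ring.
  by rewrite mulrAC divff ?gt_eqF // mul1r; apply; lra.
have e3 : 0 <= powR r (m - 2) / r by rewrite divr_ge0 // ltW.
split.
- apply: (le_trans (H0 x)).
  have : powR (enorm x + 1) (m - 1) <= 4 * powR r (m - 1).
    apply: (@le_trans _ _ (powR (4 * r) (m - 1))).
      by apply: le_powR; [lra|rewrite addr_ge0|lra].
    rewrite powRM ?(ltW r0) // ler_wpM2r //.
    by rewrite -[leRHS]powRr1 //; apply: ler_powR => //; lra.
  move=> h; apply: (@le_trans _ _ (C0 * (4 * powR r (m - 1)))); first by rewrite ler_wpM2l.
  rewrite mulrA; apply: ler_wpM2r => //; lra.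
- move=> a b; apply: (le_trans (opnorm2_bound a b (hA x).1)).
  rewrite ler_wpM2r // ler_wpM2r //.
  apply: (@le_trans _ _ (A1 * (2 * powR r (m - 2)))); first by rewrite ler_wpM2l.
  by rewrite mulrA; apply: ler_wpM2r => //; lra.
- move=> a b c; apply: (le_trans (opnorm3_bound a b c (hA x).2)).
  rewrite ler_wpM2r // ler_wpM2r // ler_wpM2r //.
  apply: (@le_trans _ _ (A1 * (4 * (powR r (m - 2) / r)))); first by rewrite ler_wpM2l.
  by rewrite mulrA; apply: ler_wpM2r => //; lra.
apply: (@le_trans _ _ (A1 * (2 * powR r (m - 2)))); first by rewrite ler_wpM2l.
by rewrite mulrA; apply: ler_wpM2r => //; lra.
Qed.
End growth.

(** * Trajectories of the leapfrog integrator *)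

Section verlet.
Context {R : realType} {d : nat}.
Implicit Types (a b y : nat -> 'rV[R]_d).

(* The leapfrog positions [a] and momenta [b] satisfy these recurrences with
   [y] the gradients along the trajectory. *)
Lemma verlet_dev a b y (h e : R) (n : nat) : 0 <= h ->
  (forall i, a i.+1 = a i + h *: b i - (h ^+ 2 / 2) *: y i) ->
  (forall i, b i.+1 = b i - (h / 2) *: (y i + y i.+1)) ->
  (forall j, (j <= n)%N -> enorm (y j) <= e) ->
  enorm (b n - b 0%N) <= n%:R * h * e /\
  enorm (a n.+1 - a 0%N - (n.+1%:R * h) *: b 0%N) <= n.+1%:R ^+ 2 * h ^+ 2 * e.
Proof.
move=> h0 Ha Hb.
have h22 : 0 <= h ^+ 2 / 2 by rewrite divr_ge0 // exprn_ge0.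
elim: n => [|n IH] He.
  have e0 : enorm (y 0%N) <= e by exact: He.
  rewrite subrr enorm0 !mul0r lexx; split => //.
  rewrite Ha (_ : _ - _ = - ((h ^+ 2 / 2) *: y 0%N)); last first.
    by apply/rowP => j; rewrite !mxE; ring.
  rewrite enormN enormZ ger0_norm // expr1n mul1r.
  have : h ^+ 2 / 2 * enorm (y 0%N) <= h ^+ 2 / 2 * e by rewrite ler_wpM2l.
  have := enorm_ge0 (y 0%N); have : 0 <= h ^+ 2 by rewrite exprn_ge0.
  nra.
have [] := IH (fun j jn => He j (leqW jn)).
set k := n.+1%:R => b1 a1.
have en : enorm (y n) <= e by exact/He/leqW.
have en1 : enorm (y n.+1) <= e by exact: He.
have e0 : 0 <= e by exact: le_trans en.
have k1 : n%:R = k - 1 :> R by rewrite /k -natr1 addrK.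
have k0 : 0 <= k by rewrite ler0n.
have kS : n.+2%:R = k + 1 :> R by rewrite -natr1.
rewrite k1 in b1.
have b2 : enorm (b n.+1 - b 0%N) <= k * h * e.
  rewrite Hb (_ : _ - _ = (b n - b 0%N) + (- (h / 2) *: (y n + y n.+1))); last first.
    by apply/rowP => j; rewrite !mxE; ring.
  apply: le_trans (enormD _ _) _; rewrite enormZ normrN ger0_norm ?divr_ge0 //.
  have : h / 2 * enorm (y n + y n.+1) <= h / 2 * (e + e).
    by rewrite ler_wpM2l ?divr_ge0 // (le_trans (enormD _ _)) // lerD.
  lra.
split => //; rewrite kS Ha.
rewrite (_ : _ - _ = (a n.+1 - a 0%N - (k * h) *: b 0%N) + h *: (b n.+1 - b 0%N)
   + (- (h ^+ 2 / 2)) *: y n.+1); last by apply/rowP => j; rewrite !mxE; ring.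
apply: le_trans (enormD _ _) _; apply: le_trans (lerD (enormD _ _) (lexx _)) _.
rewrite !enormZ normrN !ger0_norm //.
have q1 : h * enorm (b n.+1 - b 0%N) <= h * (k * h * e) by rewrite ler_wpM2l.
have q2 : h ^+ 2 / 2 * enorm (y n.+1) <= h ^+ 2 / 2 * e by rewrite ler_wpM2l.
apply: le_trans (lerD (lerD a1 q1) q2) _.
have he : 0 <= h ^+ 2 * e by rewrite mulr_ge0 // exprn_ge0.
(* The increments amount to k + 1/2 in units of h^2 e, whereas (k + 1)^2 - k^2 = 2 k + 1: the last
   term is the slack that makes the plain square an induction invariant. *)
have -> : (k + 1) ^+ 2 * h ^+ 2 * e = k ^+ 2 * h ^+ 2 * e + h * (k * h * e) + h ^+ 2 / 2 * e
   + (k + 2^-1) * (h ^+ 2 * e) by field.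
by rewrite lerDl mulr_ge0 // addr_ge0.
Qed.
End verlet.

Lemma dotv_sqrD (R : realType) (d : nat) (a b : 'rV[R]_d) :
  dotv (a + b) (a + b) = dotv a a + 2 * dotv a b + dotv b b.
Proof. by rewrite !dotvE (dotvC b a); ring. Qed.

Section leapfrog.
Context {R : realType} {d : nat}.
Variables (U : 'rV[R]_d -> R) (h : R).
Hypothesis U3 : isC3 U.
Hypothesis h0 : 0 < h.
Local Notation z := (leapfrogT U h).
Local Notation g := (grad U).
Implicit Types (q p x v : 'rV[R]_d).

Lemma leapfrog_pos i w : (z i.+1 w).1 = (z i w).1 + h *: (z i w).2 - (h ^+ 2 / 2) *: g (z i w).1.
Proof.
rewrite /leapfrogT iterS; set u := iter i _ w; case: u => q p /=.
by apply/rowP => j; rewrite !mxE; field.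
Qed.

Lemma leapfrog_mom i w : (z i.+1 w).2 = (z i w).2 - (h / 2) *: (g (z i w).1 + g (z i.+1 w).1).
Proof.
rewrite /leapfrogT !iterS; set u := iter i _ w; case: u => q p /=.
by apply/rowP => j; rewrite !mxE; ring.
Qed.

(* Eliminating the momenta leaves squared gradients, which telescope, and the
   error of the trapezoidal rule, which is of third order. *)
Lemma energy_step i w : Ham U (z i.+1 w) - Ham U (z i w) =
  h ^+ 2 / 8 * (dotv (g (z i.+1 w).1) (g (z i.+1 w).1) - dotv (g (z i w).1) (g (z i w).1)) +
  (U (z i.+1 w).1 - U (z i w).1 -
   dotv (g (z i w).1 + g (z i.+1 w).1) ((z i.+1 w).1 - (z i w).1) / 2).
Proof.
have := leapfrog_mom i w; have := leapfrog_pos i w; rewrite /Ham.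
move: (z i.+1 w) (z i w) => [q1 p1] [q p] /= qE ->.
have -> : q1 - q = h *: p - (h ^+ 2 / 2) *: g q.
  by rewrite qE; apply/rowP => j; rewrite !mxE; ring.
move: (U q1) (U q) (g q1) (g q) => u1 u g1 g0.
by rewrite !dotvE (dotvC g1 g0) (dotvC p g0) (dotvC p g1); field.
Qed.

Lemma energy_bound n w tau :
  (forall i, (i < n)%N -> U (z i.+1 w).1 - U (z i w).1 -
   dotv (g (z i w).1 + g (z i.+1 w).1) ((z i.+1 w).1 - (z i w).1) / 2 <= tau) ->
  Ham U (z n w) - Ham U w <=
  h ^+ 2 / 8 * (dotv (g (z n w).1) (g (z n w).1) - dotv (g w.1) (g w.1)) + n%:R * tau.
Proof.
elim: n => [|n IH] H; first by rewrite /leapfrogT /= !subrr mulr0 mul0r addr0.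
have := IH (fun i ilt => H i (leqW ilt)); have := H n (ltnSn n); have := energy_step n w.
rewrite -natr1; lra.
Qed.

(* [X] and [eta] stand for r^(m-1) and r^(m-2) with r = |q|; [rho] bounds the
   displacement along the trajectory, and [kap] is the smallness threshold for
   s^2 eta. *)
Variables (q p : 'rV[R]_d) (T : nat) (r X eta C A2 A3 A4 c0 kap : R).
Variables (s D1 E1 rho : R).
Hypothesis sE : s = T%:R * h.
Hypothesis D1E : D1 = c0 + C.
Hypothesis E1E : E1 = 2 * C ^+ 3 * D1 + 3 * C ^+ 2 * D1 ^+ 2 + 64 * T%:R ^+ 3 * C * D1 ^+ 3.
Hypothesis rhoE : rho = s ^+ 2 * D1 * X.
Hypothesis T0 : (0 < T)%N.
Hypothesis rE : enorm q = r.
Hypothesis r0 : 0 < r.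
Hypothesis eta0 : 0 < eta.
Hypothesis XE : X = eta * r.
Hypothesis C0 : 0 < C.
Hypothesis A20 : 0 < A2.
Hypothesis A30 : 0 < A3.
Hypothesis c00 : 0 < c0.
Hypothesis c0A2 : 4 * C ^+ 2 * c0 <= A2.
Hypothesis c0A3 : 4 * c0 <= A3.
Hypothesis kap1 : 2 * D1 * kap <= 1.
Hypothesis kap2 : 2 * E1 * kap <= A2.
Hypothesis kap3 : 4 * (2 * C * D1 + D1 ^+ 2) * kap <= A3.
Hypothesis etakap : s ^+ 2 * eta <= kap.
Hypothesis pX : enorm p <= c0 * s * X.
Hypothesis A4X : 8 * A4 <= A3 * (r * X).
Hypothesis hG : forall x, enorm (x - q) <= r / 2 -> enorm (g x) <= C * X.
Hypothesis hL : forall x v, (forall t : R, 0 <= t <= 1 -> enorm (x + t *: v - q) <= r / 2) ->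
  enorm (g (x + v) - g x) <= C * eta * enorm v.
Hypothesis hD2 : forall a b, `|D2 U q a b| <= C * eta * enorm a * enorm b.
Hypothesis hD3 : forall x a b c, enorm (x - q) <= r / 2 ->
  `|D3 U x a b c| <= C * (eta / r) * enorm a * enorm b * enorm c.
Hypothesis hB : A2 * (eta * X ^+ 2) <= D2 U q (g q) (g q).
Hypothesis hC : A3 * (r * X) - A4 <= dotv (g q) q.

Let X0 : 0 < X. Proof. by rewrite XE mulr_gt0. Qed.
Let s0 : 0 < s. Proof. by rewrite sE mulr_gt0 // ltr0n. Qed.
Let s20 : 0 < s ^+ 2. Proof. by rewrite exprn_gt0. Qed.
Let D10 : 0 < D1. Proof. by rewrite D1E addr_gt0. Qed.
Let rho0 : 0 < rho. Proof. rewrite rhoE; exact: mulr_gt0 (mulr_gt0 s20 D10) X0. Qed.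
(** This is the purpose of [kap1]: the whole trajectory stays in the annulus where the growth bounds
    hold. *)
Let rho_half : rho <= r / 2.
Proof.
have -> : rho = (s ^+ 2 * eta) * D1 * r by rewrite rhoE XE; ring.
have : s ^+ 2 * eta * D1 <= kap * D1 by rewrite ler_pM2r.
have -> : r / 2 = 2^-1 * r by rewrite mulrC.
by move=> H; rewrite ler_pM2r //; have := kap1; lra.
Qed.

Local Notation qq i := (z i (q, p)).1.
Local Notation pp i := (z i (q, p)).2.

Let iT i : (i <= T)%N -> i%:R * h <= s.
Proof. by move=> iT; rewrite sE ler_pM2r // ler_nat. Qed.

(** A bootstrap: as long as the earlier positions are within [rho], hence r / 2, of [q], their
    gradients are at most C X, and [verlet_dev] bounds the next displacement by s^2 C X from the
    gradients plus s (c0 s X) from the momentum. The sum is [rho], which explains [D1 = c0 + C]. *)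
Let in_ball i : (i <= T)%N -> enorm (qq i - q) <= rho.
Proof.
elim/ltn_ind: i => i IH iT'.
case: i IH iT' => [|i] IH iT'; first by rewrite /leapfrogT /= subrr enorm0 ltW.
have [_] := @verlet_dev R d (fun i => qq i) (fun i => pp i) (fun i => g (qq i)) h (C * X) i
   (ltW h0) (fun i => leapfrog_pos i _) (fun i => leapfrog_mom i _)
   (fun j ji => hG (le_trans (IH j ji (leq_trans ji (ltnW iT'))) rho_half)).
rewrite /leapfrogT /= -/(z i.+1 (q, p)) => H.
have -> : qq i.+1 - q = (qq i.+1 - q - (i.+1%:R * h) *: p) + (i.+1%:R * h) *: p by rewrite subrK.
apply: le_trans (enormD _ _) _; rewrite enormZ ger0_norm ?mulr_ge0 ?(ltW h0) //.
apply: le_trans (lerD H (lexx _)) _.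
have k := iT iT'; set u := i.+1%:R * h in k *.
have u0 : 0 <= u by rewrite mulr_ge0 // ltW.
rewrite -exprMn -/u.
have u2 : u ^+ 2 <= s ^+ 2 by rewrite ler_pXn2r ?nnegrE // ltW.
have h1 : u ^+ 2 * (C * X) <= s ^+ 2 * (C * X) by rewrite ler_wpM2r // mulr_ge0 // ltW.
have h2 : u * enorm p <= s * (c0 * s * X) by rewrite ler_pM.
have -> : rho = s ^+ 2 * (C * X) + s * (c0 * s * X) by rewrite rhoE D1E; ring.
exact: lerD.
Qed.

Let seg x v : enorm (x - q) <= rho -> enorm (x + v - q) <= rho ->
  forall t : R, 0 <= t <= 1 -> enorm (x + t *: v - q) <= r / 2.
Proof.
move=> H1 H2 t /andP[t0 t1]; apply: le_trans rho_half.
have -> : x + t *: v - q = (1 - t) *: (x - q) + t *: (x + v - q).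
  by apply/rowP => j; rewrite !mxE; ring.
apply: le_trans (enormD _ _) _; rewrite !enormZ !ger0_norm ?subr_ge0 //.
have : (1 - t) * enorm (x - q) <= (1 - t) * rho by rewrite ler_wpM2l // subr_ge0.
have : t * enorm (x + v - q) <= t * rho by rewrite ler_wpM2l.
lra.
Qed.

Let gdiff i : (i <= T)%N -> enorm (g (qq i) - g q) <= C * eta * rho.
Proof.
move=> iT'; have ib := in_ball iT'.
have := @hL q (qq i - q); rewrite [q + _]addrC subrK => H.
apply: (le_trans (H _)); last by rewrite ler_wpM2l // mulr_ge0 // ltW.
apply: seg; first by rewrite subrr enorm0 ltW.
by rewrite [q + _]addrC subrK.
Qed.

Let v := qq T - q.
Let u := v - s *: p + (s ^+ 2 / 2) *: g q.

Let uE : v = s *: p - (s ^+ 2 / 2) *: g q + u.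
Proof. by apply/rowP => j; rewrite /u !mxE; ring. Qed.

(** With the gradient frozen at [q] the recurrences are solved exactly by a quadratic in the time i
    h. Subtracting this solution leaves the same recurrences driven by [g (qq i) - g q], which
    [gdiff] bounds, so that [verlet_dev] applies once more. *)
Let u_le : enorm u <= s ^+ 2 * (C * eta * rho).
Proof.
have [k kE] : exists k, T = k.+1 by exists T.-1; rewrite prednK.
pose a (i : nat) := qq i - q - (i%:R * h) *: p + ((i%:R * h) ^+ 2 / 2) *: g q.
pose b (i : nat) := pp i - p + (i%:R * h) *: g q.
have Ha i : a i.+1 = a i + h *: b i - (h ^+ 2 / 2) *: (g (qq i) - g q).
  rewrite /a /b leapfrog_pos -natr1.
  by apply/rowP => j; rewrite !mxE; field.
have Hb i : b i.+1 = b i - (h / 2) *: ((g (qq i) - g q) + (g (qq i.+1) - g q)).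
  rewrite /b leapfrog_mom -natr1.
  by apply/rowP => j; rewrite !mxE; field.
have [_] := @verlet_dev R d a b (fun i => g (qq i) - g q) h (C * eta * rho) k (ltW h0) Ha Hb
  (fun j ji => gdiff (leq_trans (leqW ji) (eq_leq (esym kE)))).
have a0E : a 0%N = 0.
  by rewrite /a /leapfrogT /= subrr mul0r scale0r expr0n /= mul0r scale0r !addr0 subr0.
have b0E : b 0%N = 0 by rewrite /b /leapfrogT /= subrr mul0r scale0r addr0.
by rewrite a0E b0E scaler0 !subr0 /a /u /v sE -kE -exprMn.
Qed.

Let rho2 : rho ^+ 2 = s ^+ 4 * D1 ^+ 2 * X ^+ 2.
Proof. by rewrite rhoE; ring. Qed.

(** In |q_T|^2 = r^2 + 2 q.v + |v|^2 condition (C) contributes - A3 s^2 r X. Of this gain the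
    momentum uses at most one half ([c0A3]), the remainders [u] and |v|^2 one quarter ([kap3]), and
    the constant A4 one eighth ([A4X]). One eighth is left for the square of the norm, hence one
    sixteenth for the norm. *)
Lemma good_position : enorm (qq T) <= r - A3 / 16 * (s ^+ 2 * X).
Proof.
have k3 := kap3; have cA3 := c0A3; have A4X' := A4X.
have XXr : X ^+ 2 = eta * (r * X) by rewrite expr2 {1}XE; ring.
have rX0 : 0 < r * X by rewrite mulr_gt0.
have dv : dotv q v = s * dotv q p - s ^+ 2 / 2 * dotv (g q) q + dotv q u.
  by rewrite uE !dotvE (dotvC q (g q)).
have e1 : dotv q p <= r * (c0 * s * X).
  by apply: (le_trans (dotv_le _ _)); rewrite rE ler_wpM2l // ltW.
have e2 : dotv q u <= r * (s ^+ 2 * (C * eta * rho)).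
  by apply: (le_trans (dotv_le _ _)); rewrite rE; apply: ler_wpM2l; [exact: ltW|exact: u_le].
have e3 : dotv v v <= rho ^+ 2.
  by rewrite -enorm_sqr ler_pXn2r ?nnegrE //; [exact: in_ball|exact: ltW].
have qT : enorm (qq T) ^+ 2 = r ^+ 2 + 2 * dotv q v + dotv v v.
  rewrite -rE !enorm_sqr; have -> : qq T = q + v by rewrite /v [q + _]addrC subrK.
  exact: dotv_sqrD.
have key : enorm (qq T) ^+ 2 <= r ^+ 2 - 2 * r * (A3 / 16 * (s ^+ 2 * X)).
  rewrite qT dv.
  have f1 : 2 * (s * dotv q p) <= s ^+ 2 * (r * X) * (2 * c0).
    have := ler_wpM2l (ltW s0) e1; rewrite (_ : s * (r * (c0 * s * X)) = s ^+ 2 * (r * X) * c0); last by ring.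
    lra.
  have f2 : s ^+ 2 * (A3 * (r * X) - A4) <= s ^+ 2 * dotv (g q) q by rewrite ler_pM2l.
  have f3 : 2 * dotv q u + dotv v v <= s ^+ 2 * (r * X) * ((2 * C * D1 + D1 ^+ 2) * (s ^+ 2 * eta)).
    apply: (le_trans (lerD (ler_wpM2l _ e2) e3)) => //.
    rewrite rho2 rhoE XXr le_eqVlt; apply/orP; left; apply/eqP; ring.
  have f4 : (2 * C * D1 + D1 ^+ 2) * (s ^+ 2 * eta) <= A3 / 4.
    apply: (@le_trans _ _ ((2 * C * D1 + D1 ^+ 2) * kap)); last by lra.
    by rewrite ler_wpM2l // addr_ge0 ?sqr_ge0 // !mulr_ge0 // ltW.
  have f5 : s ^+ 2 * (r * X) * ((2 * C * D1 + D1 ^+ 2) * (s ^+ 2 * eta)) <= s ^+ 2 * (r * X) * (A3 / 4).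
    by rewrite ler_wpM2l // mulr_ge0 // ltW.
  have f6 : s ^+ 2 * (r * X) * (2 * c0) <= s ^+ 2 * (r * X) * (A3 / 2).
    have p0 : 0 < s ^+ 2 * (r * X) by rewrite mulr_gt0.
    by rewrite ler_pM2l //; lra.
  have f7 : s ^+ 2 * A4 <= s ^+ 2 * (A3 * (r * X) / 8) by rewrite ler_pM2l //; lra.
  have -> : r ^+ 2 - 2 * r * (A3 / 16 * (s ^+ 2 * X)) = r ^+ 2 - s ^+ 2 * (r * X) * (A3 / 8) by field.
  lra.
set w := A3 / 16 * (s ^+ 2 * X) in key *.
have w0 : 0 < w by rewrite !mulr_gt0 ?invr_gt0.
have rw : 0 <= r - w.
  (* Nonnegativity of the left side of [key] already forces 2 w <= r, so both sides of the goal may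
     be squared. *)
  have : 0 <= r * (r - 2 * w) by have := sqr_ge0 (enorm (qq T)); nra.
  by rewrite pmulr_rge0 //; lra.
rewrite -(@ler_pXn2r _ 2) ?nnegrE //; apply: (le_trans key).
by have := sqr_ge0 w; rewrite sqrrB; lra.
Qed.

(** Consecutive positions both lie within [rho] of [q], so each step is crudely at most 2 [rho]
    long. The bound does not decrease with the number of steps; the resulting powers of [T] are
    harmless since [T] is fixed, and they reappear in [E1]. *)
Let trap i : (i < T)%N -> U (qq i.+1) - U (qq i) -
   dotv (g (qq i) + g (qq i.+1)) (qq i.+1 - qq i) / 2 <= 8 * C * eta ^+ 2 * s ^+ 6 * D1 ^+ 3 * X ^+ 2.
Proof.
move=> iT'; set w := qq i.+1 - qq i.
have b0 : enorm (qq i - q) <= rho by apply: in_ball; exact: ltnW.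
have b1 : enorm (qq i + w - q) <= rho by rewrite /w [qq i + _]addrC subrK; exact: in_ball.
have wle : enorm w <= 2 * rho.
  have -> : w = (qq i + w - q) - (qq i - q) by apply/rowP => j; rewrite !mxE; ring.
  by apply: (le_trans (enormB _ _)); rewrite mulrDl !mul1r lerD.
have M : forall t : R, 0 <= t <= 1 -> `|D3 U (qq i + t *: w) w w w| <= C * (eta / r) * (2 * rho) ^+ 3.
  move=> t t01; apply: (le_trans (hD3 _ _ _ (seg b0 b1 t01))).
  have cr : 0 <= C * (eta / r) by rewrite mulr_ge0 ?divr_ge0 ?ltW.
  have -> (K e : R) : K * e * e * e = K * e ^+ 3 by ring.
  apply: ler_wpM2l => //; rewrite ler_pXn2r ?nnegrE //.
  by rewrite mulr_ge0 // ltW.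
have := trapezoid U3 M.
rewrite {1 2}/w [qq i + _]addrC subrK => /(le_trans (ler_norm _)) h1.
apply: (le_trans h1); rewrite le_eqVlt; apply/orP; left; apply/eqP.
rewrite rhoE XE; field.
by rewrite gt_eqF.
Qed.

(** The displacement is close to - (s^2 / 2) grad U(q), so the squared gradient changes by about -
    s^2 D^2U(q){grad U, grad U}, which (B) bounds by - s^2 A2 eta X^2. The momentum and all errors
    together are kept below this gain. *)
Lemma good_energy : Ham U (z T (q, p)) <= Ham U (q, p).
Proof.
have k2 := kap2; have cA2 := c0A2.
rewrite -subr_le0.
apply: (le_trans (energy_bound trap)); rewrite /=.
set gT := g (qq T).
have e1 : dotv gT gT - dotv (g q) (g q) = 2 * dotv (gT - g q) (g q) + enorm (gT - g q) ^+ 2.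
  by rewrite enorm_sqr !dotvE (dotvC (g q) gT); ring.
have e2 : enorm (gT - g q) ^+ 2 <= (C * eta * rho) ^+ 2.
  by rewrite ler_pXn2r ?nnegrE //; [exact: gdiff|rewrite !mulr_ge0 // ltW].
have gq : enorm (g q) <= C * X by apply: hG; rewrite subrr enorm0 divr_ge0 // ltW.
have vle : enorm v <= rho by exact: in_ball.
(* (B) is available only at [q] itself. A second mean value theorem brings the Hessian back from the
   intermediate point to [q], at the cost of one third differential. *)
have e3 : dotv (gT - g q) (g q) <= D2 U q v (g q) + C * (eta / r) * rho ^+ 2 * (C * X).
  have -> : gT = g (q + v) by rewrite /v [q + _]addrC subrK.
  rewrite dotvDl dotvNl; have [c /andP[c0' c1] ->] := grad_MVT U3 q v (g q).
  have [k /andP[k0 k1]] := D2_MVT U3 q (c *: v) v (g q).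
  move=> /eqP; rewrite subr_eq => /eqP ->; rewrite addrC lerD2l D3Z1.
  apply: (le_trans (ler_norm _)); rewrite normrM (ger0_norm c0').
  have : `|D3 U (q + k *: (c *: v)) v v (g q)| <= C * (eta / r) * enorm v * enorm v * enorm (g q).
    apply: hD3; rewrite scalerA addrAC subrr add0r enormZ ger0_norm ?mulr_ge0 //.
    apply: le_trans rho_half; rewrite -[leRHS]mul1r ler_pM ?mulr_ge0 //.
    by rewrite mulr_ile1.
  set Y := `|_| => HY.
  apply: (@le_trans _ _ Y); first by rewrite ler_piMl // normr_ge0.
  apply: (le_trans HY).
  have cr : 0 <= C * (eta / r) by rewrite mulr_ge0 ?divr_ge0 ?ltW.
  have -> (K e f : R) : K * e * e * f = K * e ^+ 2 * f by ring.
  apply: ler_pM => //; first by rewrite mulr_ge0 // exprn_ge0.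
  by rewrite ler_wpM2l // ler_pXn2r ?nnegrE // ltW.
have e4 : D2 U q v (g q) <= s * (C * eta * (c0 * s * X) * (C * X)) - s ^+ 2 / 2 * (A2 * (eta * X ^+ 2)) +
    C * eta * (s ^+ 2 * (C * eta * rho)) * (C * X).
  rewrite uE D2Dl D2Dl -scaleNr !D2Zl.
  have Ce : 0 <= C * eta by rewrite mulr_ge0 // ltW.
  have t1 : D2 U q p (g q) <= C * eta * (c0 * s * X) * (C * X).
    apply: (le_trans (ler_norm _)); apply: (le_trans (hD2 _ _)).
    by apply: ler_pM => //; [exact: mulr_ge0|exact: ler_wpM2l].
  have t2 : D2 U q u (g q) <= C * eta * (s ^+ 2 * (C * eta * rho)) * (C * X).
    apply: (le_trans (ler_norm _)); apply: (le_trans (hD2 _ _)).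
    apply: ler_pM => //; first exact: mulr_ge0.
    by apply: ler_wpM2l => //; exact: u_le.
  have t3 := ler_wpM2l (ltW s0) t1.
  have t4 : s ^+ 2 / 2 * (A2 * (eta * X ^+ 2)) <= s ^+ 2 / 2 * D2 U q (g q) (g q).
    by rewrite ler_wpM2l // divr_ge0 // ltW.
  lra.
have h20 : 0 <= h ^+ 2 / 8 by rewrite divr_ge0 // exprn_ge0 // ltW.
have e5 : dotv gT gT - dotv (g q) (g q) <= s ^+ 2 * (eta * X ^+ 2) *
    (2 * C ^+ 2 * c0 - A2 + (2 * C ^+ 3 * D1 + 3 * C ^+ 2 * D1 ^+ 2) * (s ^+ 2 * eta)).
  rewrite e1; apply: (le_trans (lerD (ler_wpM2l _ (le_trans e3 (lerD e4 (lexx _)))) e2)) => //.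
  rewrite le_eqVlt; apply/orP; left; apply/eqP; rewrite rhoE XE; field.
  by rewrite gt_eqF.
apply: (le_trans (lerD (ler_wpM2l h20 e5) (lexx _))).
(* Here [E1] is assembled: the coefficients of s^2 eta in [e5], plus 64 T^3 C D1^3, which is the
   total trapezoidal error divided by the common factor h^2 / 8 * s^2 eta X^2. Then [c0A2] and
   [kap2] each use at most half of A2. *)
have -> : h ^+ 2 / 8 * (s ^+ 2 * (eta * X ^+ 2) *
      (2 * C ^+ 2 * c0 - A2 + (2 * C ^+ 3 * D1 + 3 * C ^+ 2 * D1 ^+ 2) * (s ^+ 2 * eta))) +
     T%:R * (8 * C * eta ^+ 2 * s ^+ 6 * D1 ^+ 3 * X ^+ 2) =
   h ^+ 2 / 8 * (s ^+ 2 * (eta * X ^+ 2)) * (2 * C ^+ 2 * c0 - A2 + E1 * (s ^+ 2 * eta)).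
  by rewrite E1E sE; field.
have pos : 0 <= h ^+ 2 / 8 * (s ^+ 2 * (eta * X ^+ 2)).
  by rewrite !mulr_ge0 ?exprn_ge0 ?invr_ge0 ?ltW.
rewrite mulr_ge0_le0 //.
have Cge : 0 <= C by exact: ltW.
have Dge : 0 <= D1 by exact: ltW.
have E10 : 0 <= E1.
  by rewrite E1E; repeat (first [apply: addr_ge0|apply: mulr_ge0|apply: exprn_ge0]).
have : E1 * (s ^+ 2 * eta) <= E1 * kap by rewrite ler_wpM2l.
lra.
Qed.
End leapfrog.

(** * Linear growth of the proposal in the momentum, from every starting point *)

Section global.
Context {R : realType} {d : nat}.
Variables (U : 'rV[R]_d -> R) (m C0 h : R).
Hypothesis m12 : 1 < m <= 2.
Hypothesis C00 : 0 <= C0.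
Hypothesis h0 : 0 < h.
Hypothesis hg : forall x, enorm (grad U x) <= C0 * powR (enorm x + 1) (m - 1).
Local Notation z := (leapfrogT U h).
Local Notation g := (grad U).
Implicit Types (q p x v : 'rV[R]_d).

Definition growthY (q : 'rV[R]_d) : R := powR (enorm q + 1) (m - 1) + 1.

Lemma growthY_ge1 q : 1 <= growthY q.
Proof. by rewrite lerDr powR_ge0. Qed.

(** If |v| <= |q| + 1 the argument at most doubles the base point; otherwise |v| dominates and, as m
    - 1 <= 1, the power is at most linear. A linear bound in |v| is what keeps exponential moments
    of the displacement finite. *)
Lemma grad_shift q v : enorm (g (q + v)) <= 2 * C0 * (growthY q + enorm v).
Proof.
case/andP: m12 => m1 m2; have a0 : 0 <= m - 1 by lra.
rewrite [2 * C0]mulrC -mulrA; apply: (le_trans (hg _)); apply: ler_wpM2l => //.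
have tri := enormD q v; have q0 := enorm_ge0 q; have v0 := enorm_ge0 v.
have X0 := powR_ge0 (enorm q + 1) (m - 1).
rewrite /growthY; have [vq|qv] := leP (enorm v) (enorm q + 1).
  apply: (@le_trans _ _ (powR (2 * (enorm q + 1)) (m - 1))).
    by apply: le_powR => //; [rewrite addr_ge0 // enorm_ge0|lra].
  rewrite powRM ?addr_ge0 //.
  have : powR 2 (m - 1) * powR (enorm q + 1) (m - 1) <= 2 * powR (enorm q + 1) (m - 1).
    apply: ler_wpM2r => //; rewrite -[leRHS]powRr1 //; apply: ler_powR => //; lra.
  lra.
apply: (@le_trans _ _ (powR (2 * enorm v) (m - 1))).
  by apply: le_powR => //; [rewrite addr_ge0 // enorm_ge0|lra].
apply: (@le_trans _ _ (2 * enorm v)); last by lra.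
by apply: ler1_powR; lra.
Qed.

(** A discrete Gronwall argument: each step multiplies the constant by a factor that depends on [h]
    only through [K1] and [K2]. Here [K2] involves [K1] since the momentum update uses the gradient
    at the new position. *)
Lemma global_bound T : exists2 K : R, 0 <= K &
  forall q p, enorm ((z T (q, p)).1 - q) + enorm (z T (q, p)).2 <= K * (enorm p + growthY q).
Proof.
elim: T => [|T [K K0 IH]].
  exists 1 => // q p; rewrite /leapfrogT /= subrr enorm0 add0r mul1r lerDl.
  exact: le_trans (growthY_ge1 q).
pose G := 2 * C0.
have G0 : 0 <= G by rewrite mulr_ge0.
have hge : 0 <= h by exact: ltW.
pose K1 := K + h * K + h ^+ 2 / 2 * (G * (1 + K)).
pose K2 := K + h / 2 * (G * (1 + K) + G * (1 + K1)).
have GK : 0 <= G * (1 + K) by rewrite mulr_ge0 // addr_ge0.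
have hh : 0 <= h ^+ 2 / 2 by rewrite divr_ge0 // exprn_ge0.
have K10 : 0 <= K1 by rewrite /K1 !addr_ge0 // mulr_ge0.
have GK1 : 0 <= G * (1 + K1) by rewrite mulr_ge0 // addr_ge0.
have K20 : 0 <= K2 by rewrite /K2 addr_ge0 // mulr_ge0 ?divr_ge0 // addr_ge0.
exists (K1 + K2); first by rewrite addr_ge0.
move=> q p; set M := enorm p + growthY q.
have YM : growthY q <= M by rewrite lerDr.
have M0 : 0 <= M by apply: le_trans YM; apply: le_trans (growthY_ge1 q).
have IHq := IH q p; rewrite -/M in IHq.
have v1 : enorm ((z T (q, p)).1 - q) <= K * M by apply: le_trans IHq; rewrite lerDl.
have p1 : enorm (z T (q, p)).2 <= K * M by apply: le_trans IHq; rewrite lerDr.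
have gb (x : 'rV[R]_d) (k : R) : enorm (x - q) <= k * M -> enorm (g x) <= G * (1 + k) * M.
  move=> xk; have -> : x = q + (x - q) by rewrite [q + _]addrC subrK.
  apply: (le_trans (grad_shift _ _)); rewrite -[leRHS]mulrA; apply: ler_wpM2l => //.
  by rewrite mulrDl mul1r lerD.
have g1 := gb _ _ v1.
have v2 : enorm ((z T.+1 (q, p)).1 - q) <= K1 * M.
  rewrite leapfrog_pos.
  set a := (z T (q, p)).1; set b := (z T (q, p)).2.
  have -> : a + h *: b - (h ^+ 2 / 2) *: g a - q = (a - q) + h *: b + (- (h ^+ 2 / 2)) *: g a.
    by apply/rowP => j; rewrite !mxE; ring.
  apply: (le_trans (enormD _ _)); apply: (le_trans (lerD (enormD _ _) (lexx _))).
  rewrite !enormZ normrN !ger0_norm //.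
  have t1 := ler_wpM2l hge p1; have t2 := ler_wpM2l hh g1.
  apply: (le_trans (lerD (lerD v1 t1) t2)).
  by rewrite le_eqVlt; apply/orP; left; apply/eqP; rewrite /K1; ring.
have g2 := gb _ _ v2.
have p2 : enorm (z T.+1 (q, p)).2 <= K2 * M.
  rewrite leapfrog_mom -scaleNr; apply: (le_trans (enormD _ _)).
  rewrite enormZ normrN ger0_norm ?divr_ge0 //.
  have h2 : 0 <= h / 2 by rewrite divr_ge0.
  apply: (le_trans (lerD p1 (ler_wpM2l h2 (le_trans (enormD _ _) (lerD g1 g2))))).
  by rewrite le_eqVlt; apply/orP; left; apply/eqP; rewrite /K2; ring.
by rewrite mulrDl; exact: lerD.
Qed.
End global.

(** * The contraction principle on Euclidean balls *)

HB.instance Definition _ (R : realType) (m n : nat) := Complete.on 'M[R]_(m, n).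

Section fixpoint.
Context {R : realType} {d : nat}.

Lemma continuous_enorm : continuous (@enorm R d).
Proof.
move=> x; rewrite /enorm; apply: (@continuous_comp _ _ _ (fun y : 'rV[R]_d => dotv y y) Num.sqrt); last exact: sqrt_continuous.
rewrite /dotv; apply: (@cvg_big _ _ _ _ _ _ _ (nbhs x) _ _ _ (nbhs_filter x)) => [|i _]; first exact: add_continuous.
by apply: cvgM; exact: coord_continuous.
Qed.

Lemma closed_eball (c : 'rV[R]_d) (r : R) : closed [set x : 'rV[R]_d | enorm (x - c) <= r].
Proof.
have -> : [set x : 'rV[R]_d | enorm (x - c) <= r] = (fun x => enorm (x - c)) @^-1` [set y | y <= r] by [].
apply: closed_comp => [x _|]; last exact: closed_le.
apply: (@continuous_comp _ _ _ (fun x : 'rV[R]_d => x - c) (@enorm R d)); last exact: continuous_enorm.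
apply: (@continuousD _ _ _ id (cst (- c))); first exact: cvg_id.
exact: cst_continuous.
Qed.

(** Two norms are mixed on purpose: the invariant set is a Euclidean ball, matching the trajectory
    estimates, while the contraction is measured in the max norm, for which the fixed point theorem
    is available. *)
Lemma eball_fixpoint (f : 'rV[R]_d -> 'rV[R]_d) (c : 'rV[R]_d) (r k : R) : 0 <= r -> 0 <= k < 1 ->
  (forall x, enorm (x - c) <= r -> enorm (f x - c) <= r) ->
  (forall x y, enorm (x - c) <= r -> enorm (y - c) <= r -> `|f x - f y| <= k * `|x - y|) ->
  exists2 p, enorm (p - c) <= r & f p = p.
Proof.
move=> r0 /andP[k0 k1] Hs Hl.
pose B : set 'rV[R]_d := [set x | enorm (x - c) <= r].
have fS : {homo f : x / B x >-> B x} by move=> x; exact: Hs.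
pose F : {fun B >-> B} := mkfun_fun fS.
have ctr : is_contraction F.
  exists (NngNum k0); split => //= -[x y] [/= Bx By]; exact: Hl.
have [|p Bp pE] := @banach_fixed_point _ _ B F ctr (@closed_eball c r).
  by exists c; rewrite /B /= subrr enorm0.
by exists p => //; rewrite [RHS]pE.
Qed.
End fixpoint.

Lemma enorm_ebasis (R : realType) (d : nat) (i : 'I_d) : enorm (ebasis i : 'rV[R]_d) = 1.
Proof.
rewrite /enorm /dotv (bigD1 i) //= big1 => [|j ji].
  by rewrite !mxE !eqxx /= mulr1 addr0 sqrtr1.
by rewrite !mxE (negbTE ji) andbF mul0r.
Qed.

(** The recurrences are linear, so the difference of two solutions is again a solution, driven by
    the difference of the gradients. *)
Lemma verlet_diff (R : realType) (d : nat) (a a' b b' y y' : nat -> 'rV[R]_d) (h e : R) (n : nat) : 0 <= h ->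
  (forall i, a i.+1 = a i + h *: b i - (h ^+ 2 / 2) *: y i) ->
  (forall i, b i.+1 = b i - (h / 2) *: (y i + y i.+1)) ->
  (forall i, a' i.+1 = a' i + h *: b' i - (h ^+ 2 / 2) *: y' i) ->
  (forall i, b' i.+1 = b' i - (h / 2) *: (y' i + y' i.+1)) ->
  a' 0%N = a 0%N -> (forall j, (j <= n)%N -> enorm (y' j - y j) <= e) ->
  enorm (a' n.+1 - a n.+1 - (n.+1%:R * h) *: (b' 0%N - b 0%N)) <= n.+1%:R ^+ 2 * h ^+ 2 * e.
Proof.
move=> h0 Ha Hb Ha' Hb' a0 He.
have [||_] := @verlet_dev R d (fun i => a' i - a i) (fun i => b' i - b i) (fun i => y' i - y i) h e n h0 _ _ He.
- by move=> i; rewrite Ha Ha'; apply/rowP => k; rewrite !mxE; ring.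
- by move=> i; rewrite Hb Hb'; apply/rowP => k; rewrite !mxE; ring.
by rewrite a0 subrr subr0.
Qed.

(** * Trajectories with a large momentum *)

Section minor_geometry.
Context {R : realType} {d : nat}.
Variables (U : 'rV[R]_d -> R) (m C0 A1 h : R) (T : nat) (i0 : 'I_d) (r rc N s eta : R).
Hypothesis U3 : isC3 U.
Hypothesis m12 : 1 < m <= 2.
Hypothesis C00 : 0 <= C0.
Hypothesis A10 : 0 <= A1.
Hypothesis h0 : 0 < h.
Hypothesis T0 : (0 < T)%N.
Hypothesis hg : forall x, enorm (grad U x) <= C0 * powR (enorm x + 1) (m - 1).
Hypothesis hA : forall q : 'rV[R]_d,
      (opnorm2 U q <= (A1 * powR (enorm q + 1) (m - 2))%:E)%E /\
      (opnorm3 U q <= (A1 * powR (enorm q + 1) (m - 3))%:E)%E.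
Hypothesis r1 : 1 <= r.
Hypothesis rcr : 4 * rc <= r.
Hypothesis NE : N = 4 * r / h.
Hypothesis sE : s = T%:R * h.
Hypothesis etaE : eta = powR r (m - 2).
Hypothesis small1 : 36 * C0 * T%:R ^+ 3 * (h ^+ 2 * eta) <= 1.
Hypothesis small2 : 8 * d%:R * T%:R ^+ 2 * A1 * (h ^+ 2 * eta) <= 1.
Local Notation z := (leapfrogT U h).
Local Notation g := (grad U).
Implicit Types (p x v : 'rV[R]_d).

Let p0 : 'rV[R]_d := N *: ebasis i0.
Let hN : h * N = 4 * r. Proof. by rewrite NE; field; rewrite gt_eqF. Qed.
Let N0 : 0 < N. Proof. by have := r1; rewrite NE => r1'; rewrite divr_gt0 // mulr_gt0 // (lt_le_trans ltr01). Qed.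
Let T1 : 1 <= T%:R :> R. Proof. by rewrite ler1n. Qed.
Let p0N : enorm p0 = N. Proof. by rewrite enormZ enorm_ebasis mulr1 ger0_norm // ltW. Qed.

(** The trajectory nearly coasts. Earlier positions have norm at most 8 T r, so their gradients are
    at most 9 C0 T r eta, and T^2 h^2 times this is at most r / 4 by [small1] (36 = 4 * 9); |q| <= r
    / 4 gives the rest. The choice h N = 4 r makes the first step alone reach distance at least 3 r
    / 2 from the origin, for every momentum within N / 2 of [p0]. *)
Let position (q p : 'rV[R]_d) : enorm q <= rc -> enorm (p - p0) <= N / 2 -> forall i, (i <= T)%N ->
  enorm ((z i (q, p)).1 - (i%:R * h) *: p) <= r / 2.
Proof.
have r1' := r1; have rcr' := rcr; have T1' := T1; have hN' := hN; have m12' := m12.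
move=> qrc pp0 i iT.
have q4 : enorm q <= r / 4 by lra.
have pN : enorm p <= 3 / 2 * N.
  by have := enorm_le_add p p0; rewrite p0N; lra.
elim/ltn_ind: i iT => i IH iT.
have far j : (j < i)%N -> enorm ((z j (q, p)).1) <= 8 * T%:R * r.
  move=> ji; have jT : (j <= T)%N by apply: leq_trans iT; exact: ltnW.
  have H := IH j ji jT.
  apply: (le_trans (enorm_le_add _ ((j%:R * h) *: p))).
  rewrite enormZ ger0_norm ?mulr_ge0 ?(ltW h0) //.
  have jR : j%:R <= T%:R :> R by rewrite ler_nat.
  have : j%:R * h * enorm p <= T%:R * (h * (3 / 2 * N)).
    rewrite -mulrA; apply: ler_pM => //; first by rewrite mulr_ge0 // ltW.
    by rewrite ler_pM2l.
  have -> : T%:R * (h * (3 / 2 * N)) = 6 * (T%:R * r) by rewrite [h * _]mulrCA hN; field.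
  have : r <= T%:R * r by rewrite ler_peMl; lra.
  rewrite -mulrA; lra.
pose e := 9 * C0 * T%:R * (r * eta).
have gle j : (j < i)%N -> enorm (g (z j (q, p)).1) <= e.
  move=> ji; apply: (le_trans (hg _)).
  have -> : e = C0 * (9 * T%:R * (r * eta)) by rewrite /e; ring.
  apply: ler_wpM2l => //.
  have -> : r * eta = powR r (m - 1) by rewrite etaE; symmetry; apply: mulr_powR1; lra.
  have rT : r <= T%:R * r by rewrite ler_peMl; lra.
  apply: (@le_trans _ _ (powR (9 * T%:R * r) (m - 1))).
    apply: le_powR; [lra|by rewrite addr_ge0 // enorm_ge0|].
    by have := far _ ji; rewrite -!mulrA; lra.
  rewrite powRM; [|lra|lra].
  rewrite ler_wpM2r ?powR_ge0 // -[leRHS]powRr1; last by lra.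
  by apply: ler_powR; lra.
case: i iT IH far gle => [|i] iT IH far gle.
  by rewrite mul0r scale0r subr0 /leapfrogT /=; lra.
have [_] := @verlet_dev R d (fun i => (z i (q, p)).1) (fun i => (z i (q, p)).2) (fun i => g (z i (q, p)).1) h e i
   (ltW h0) (fun i => leapfrog_pos U h i _) (fun i => leapfrog_mom U h i _) (fun j ji => gle j ji).
rewrite [z 0 _]/leapfrogT /= => H.
have -> : (z i.+1 (q, p)).1 - (i.+1%:R * h) *: p = ((z i.+1 (q, p)).1 - q - (i.+1%:R * h) *: p) + q.
  by apply/rowP => j; rewrite !mxE; ring.
apply: (le_trans (enormD _ _)).
have e0 : 0 <= e.
  rewrite /e !mulr_ge0 //; first by lra.
  by rewrite etaE powR_ge0.
have : i.+1%:R ^+ 2 * h ^+ 2 * e <= T%:R ^+ 2 * h ^+ 2 * e.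
  rewrite ler_wpM2r // ler_wpM2r ?sqr_ge0 //.
  by rewrite ler_pXn2r ?nnegrE // ler_nat.
have : T%:R ^+ 2 * h ^+ 2 * e <= r / 4.
  rewrite (_ : _ * _ = (36 * C0 * T%:R ^+ 3 * (h ^+ 2 * eta)) * (r / 4)); last by rewrite /e; field.
  rewrite -[leRHS]mul1r; apply: ler_wpM2r => //; lra.
lra.
Qed.

Let Lam := A1 * eta.

(* From the first step on, all trajectories stay in a convex set avoiding the
   ball of radius [r], where the Hessian is at most [Lam]. *)
Let grad_diff_outside (c : R) (x x' : 'rV[R]_d) : 1 <= c ->
  enorm (x - (c * h) *: p0) <= 2 * c * r + r / 2 -> enorm (x' - (c * h) *: p0) <= 2 * c * r + r / 2 ->
  enorm (g x' - g x) <= Lam * enorm (x' - x).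
Proof.
have r1' := r1; have m12' := m12; have N0' := N0; have hN' := hN.
move=> c1 X X'.
have -> : x' = x + (x' - x) by rewrite addrC subrK.
rewrite [x + (x' - x) - x]addrC addKr.
apply: (grad_lipschitz U3 A10 hA) => t /andP[t0 t1].
rewrite /Lam; apply: ler_wpM2l => //; rewrite etaE.
apply: ge_powR; [lra|lra|].
set w := x + t *: (x' - x).
have wB : enorm (w - (c * h) *: p0) <= 2 * c * r + r / 2.
  have -> : w - (c * h) *: p0 = (1 - t) *: (x - (c * h) *: p0) + t *: (x' - (c * h) *: p0).
    by apply/rowP => j; rewrite !mxE; ring.
  apply: le_trans (enormD _ _) _; rewrite !enormZ !ger0_norm ?subr_ge0 //.
  have : (1 - t) * enorm (x - (c * h) *: p0) <= (1 - t) * (2 * c * r + r / 2) by rewrite ler_wpM2l // subr_ge0.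
  have : t * enorm (x' - (c * h) *: p0) <= t * (2 * c * r + r / 2) by rewrite ler_wpM2l.
  lra.
have := enorm_le_add ((c * h) *: p0) w; rewrite enorm_dist enormZ p0N.
rewrite ger0_norm ?mulr_ge0 ?(ltW h0) //; last by lra.
rewrite -mulrA hN => H.
have : r <= c * r by rewrite ler_peMl; lra.
lra.
Qed.

(** At time 0 the two positions coincide, so the uncontrolled Hessian near [q] contributes nothing;
    from time 1 on [grad_diff_outside] applies. *)
Let grad_diff (q p p' : 'rV[R]_d) : enorm q <= rc -> enorm (p - p0) <= N / 2 -> enorm (p' - p0) <= N / 2 ->
  forall i, (i <= T)%N ->
  enorm (g (z i (q, p')).1 - g (z i (q, p)).1) <= Lam * enorm ((z i (q, p')).1 - (z i (q, p)).1).
Proof.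
have r1' := r1; have m12' := m12; have N0' := N0; have hN' := hN.
move=> qrc Bp Bp' [|i] iT; first by rewrite /leapfrogT /= !subrr enorm0 mulr0.
set c : R := i.+1%:R; have c1 : 1 <= c by rewrite ler1n.
have ball (u : 'rV[R]_d) : enorm (u - p0) <= N / 2 ->
    enorm ((z i.+1 (q, u)).1 - (c * h) *: p0) <= 2 * c * r + r / 2.
  move=> Bu; have H := position qrc Bu iT.
  have -> : (z i.+1 (q, u)).1 - (c * h) *: p0 = ((z i.+1 (q, u)).1 - (c * h) *: u) + ((c * h) *: u - (c * h) *: p0).
    by rewrite addrA subrK.
  apply: (le_trans (enormD _ _)).
  rewrite -scalerBr enormZ ger0_norm ?mulr_ge0 ?(ltW h0) //.
  have : c * h * enorm (u - p0) <= c * h * (N / 2).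
    by rewrite ler_wpM2l // mulr_ge0 // ltW.
  have -> : c * h * (N / 2) = 2 * c * r by rewrite -mulrA (mulrA h) hN; field.
  move: H; rewrite -/c; lra.
by apply: (@grad_diff_outside c); [|exact: ball|exact: ball].
Qed.

(** By induction the deviation from free motion is at most s^2 * Lam * 2 s |p' - p|, and [small2]
    says exactly that this is at most s / (4 d) |p' - p|. The factor 1 / d pays for the later
    passage to the max norm and leaves a contraction by 1/4. *)
Let pos_diff (q p p' : 'rV[R]_d) : enorm q <= rc -> enorm (p - p0) <= N / 2 -> enorm (p' - p0) <= N / 2 ->
  forall i, (i <= T)%N ->
  enorm ((z i (q, p')).1 - (z i (q, p)).1 - (i%:R * h) *: (p' - p)) <= s / (4 * d%:R) * enorm (p' - p)
  /\ enorm ((z i (q, p')).1 - (z i (q, p)).1) <= 2 * s * enorm (p' - p).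
Proof.
have r1' := r1; have m12' := m12.
have d1 : 1 <= d%:R :> R by rewrite ler1n; exact: leq_ltn_trans (leq0n i0) (ltn_ord i0).
have s0 : 0 <= s by rewrite sE mulr_ge0 // ltW.
have q4 : s / (4 * d%:R) <= s.
  by rewrite ler_pdivrMr ?mulr_gt0 //; [rewrite ler_peMr //; lra|lra].
have q40 : 0 <= s / (4 * d%:R) by rewrite divr_ge0.
move=> qrc Bp Bp' i iT.
set D := enorm (p' - p); have D0 : 0 <= D := enorm_ge0 _.
have e0 : 0 <= eta by rewrite etaE powR_ge0.
elim/ltn_ind: i iT => i IH iT.
case: i iT IH => [|i] iT IH.
  rewrite mul0r scale0r subr0 /leapfrogT /= subrr enorm0; split; first exact: mulr_ge0.
  by rewrite !mulr_ge0.
pose e := Lam * (2 * s * D).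
have yle j : (j <= i)%N -> enorm (g (z j (q, p')).1 - g (z j (q, p)).1) <= e.
  move=> ji; have jT : (j <= T)%N by apply: leq_trans iT; exact: leqW.
  apply: (le_trans (grad_diff qrc Bp Bp' jT)); apply: ler_wpM2l; first by rewrite /Lam mulr_ge0.
  by have [] := IH j ji jT.
have H : enorm ((z i.+1 (q, p')).1 - (z i.+1 (q, p)).1 - (i.+1%:R * h) *: (p' - p)) <= i.+1%:R ^+ 2 * h ^+ 2 * e :=
  @verlet_diff R d (fun i => (z i (q, p)).1) (fun i => (z i (q, p')).1) (fun i => (z i (q, p)).2) (fun i => (z i (q, p')).2)
    (fun i => g (z i (q, p)).1) (fun i => g (z i (q, p')).1) h e i (ltW h0)
    (fun i => leapfrog_pos U h i _) (fun i => leapfrog_mom U h i _) (fun i => leapfrog_pos U h i _) (fun i => leapfrog_mom U h i _)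
    erefl yle.
have u0 : 0 <= i.+1%:R * h by rewrite mulr_ge0 // ltW.
have us : i.+1%:R * h <= s by rewrite sE ler_pM2r // ler_nat.
have dev : enorm ((z i.+1 (q, p')).1 - (z i.+1 (q, p)).1 - (i.+1%:R * h) *: (p' - p)) <= s / (4 * d%:R) * D.
  apply: (le_trans H); rewrite -exprMn.
  apply: (@le_trans _ _ (s ^+ 2 * e)).
    by apply: ler_wpM2r; [rewrite /e !mulr_ge0 // /Lam mulr_ge0|rewrite ler_pXn2r ?nnegrE].
  have -> : s ^+ 2 * e = (8 * d%:R * T%:R ^+ 2 * A1 * (h ^+ 2 * eta)) * (s / (4 * d%:R) * D).
    by rewrite /e /Lam {1}sE; field; rewrite gt_eqF //; lra.
  by rewrite -[leRHS]mul1r; apply: ler_wpM2r; [exact: mulr_ge0|exact: small2].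
split => //.
have -> : (z i.+1 (q, p')).1 - (z i.+1 (q, p)).1 = ((z i.+1 (q, p')).1 - (z i.+1 (q, p)).1 - (i.+1%:R * h) *: (p' - p))
   + (i.+1%:R * h) *: (p' - p) by rewrite subrK.
apply: (le_trans (enormD _ _)); rewrite enormZ ger0_norm //.
have : s / (4 * d%:R) * D <= s * D by rewrite ler_wpM2r.
have : i.+1%:R * h * D <= s * D by rewrite ler_wpM2r.
move: dev; rewrite -/D; lra.
Qed.

(* [p] is a fixed point of the contraction p |-> p - (q_T(q,p) - y) / s. *)
Lemma position_surjective (q y : 'rV[R]_d) : enorm q <= rc -> enorm (y - s *: p0) <= s * N / 16 ->
  exists2 p, (z T (q, p)).1 = y &
    forall p', `|p' - p| <= N / (8 * d%:R) ->
      enorm (p' - p0) <= N / 2 /\ `|(z T (q, p')).1 - y| <= 2 * s * d%:R * `|p' - p|.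
Proof.
have r1' := r1; have T1' := T1; have N0' := N0; have hN' := hN.
have d1 : 1 <= d%:R :> R by rewrite ler1n; exact: leq_ltn_trans (leq0n i0) (ltn_ord i0).
have s0 : 0 < s by rewrite sE mulr_gt0 // (lt_le_trans ltr01).
have sN : s * N = 4 * (T%:R * r) by rewrite sE -mulrA hN mulrCA.
have rT : r <= T%:R * r by rewrite ler_peMl; lra.
have sne : s != 0 by rewrite gt_eqF.
move=> qrc yB.
pose f p := p - s^-1 *: ((z T (q, p)).1 - y).
(* The contraction acts on the ball of radius 3 N / 8, which leaves a margin N / 8 inside the ball
   of radius N / 2 where [pos_diff] holds; the points [p'] around the fixed point use this
   margin. *)
have sub p : enorm (p - p0) <= 3 / 8 * N -> enorm (p - p0) <= N / 2 by lra.
have f1 p : enorm (p - p0) <= 3 / 8 * N -> enorm (f p - p0) <= 3 / 8 * N.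
  move=> /sub Bp; have := position qrc Bp (leqnn T); rewrite -sE => H.
  have -> : f p - p0 = s^-1 *: ((y - s *: p0) - ((z T (q, p)).1 - s *: p)).
    by rewrite /f; apply/rowP => j; rewrite !mxE; field.
  rewrite enormZ ger0_norm ?invr_ge0 ?(ltW s0) // mulrC ler_pdivrMr //.
  apply: (le_trans (enormD _ _)); rewrite enormN.
  have -> : 3 / 8 * N * s = 3 / 2 * (T%:R * r) by rewrite -mulrA [N * s]mulrC sN; field.
  move: yB; rewrite sN; lra.
have f2 p p' : enorm (p - p0) <= 3 / 8 * N -> enorm (p' - p0) <= 3 / 8 * N -> `|f p - f p'| <= 4^-1 * `|p - p'|.
  move=> /sub Bp /sub Bp'; have [] := pos_diff qrc Bp' Bp (leqnn T); rewrite -sE => H _.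
  apply: (le_trans (mxnorm_le_enorm _)).
  have -> : f p - f p' = (- s^-1) *: ((z T (q, p)).1 - (z T (q, p')).1 - s *: (p - p')).
    by rewrite /f; apply/rowP => j; rewrite !mxE; field.
  rewrite enormZ normrN ger0_norm ?invr_ge0 ?(ltW s0) // mulrC ler_pdivrMr //.
  apply: (le_trans H).
  apply: (@le_trans _ _ (s / (4 * d%:R) * (d%:R * `|p - p'|))).
    by apply: ler_wpM2l; [rewrite divr_ge0 // ?ltW // ; lra|exact: enorm_le_mxnorm].
  by rewrite le_eqVlt; apply/orP; left; apply/eqP; field; rewrite gt_eqF //; lra.
have [||p] := eball_fixpoint _ _ f1 f2; [by lra|by lra|move=> Bp fp].
have pE : (z T (q, p)).1 = y.
  have : s^-1 *: ((z T (q, p)).1 - y) = 0.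
    by have := congr1 (fun x => p - x) fp; rewrite /f subrr opprB addrC subrK.
  by move/eqP; rewrite scaler_eq0 invr_eq0 (negbTE sne) /= subr_eq0 => /eqP.
exists p => // p' pp'.
have e8 : enorm (p' - p) <= N / 8.
  apply: (le_trans (enorm_le_mxnorm _)).
  apply: (@le_trans _ _ (d%:R * (N / (8 * d%:R)))); first by rewrite ler_wpM2l //; lra.
  by rewrite le_eqVlt; apply/orP; left; apply/eqP; field; rewrite gt_eqF //; lra.
have Bp' : enorm (p' - p0) <= N / 2.
  by have := enorm_tri p p' p0; move: Bp e8; lra.
split => //; rewrite -pE; apply: (le_trans (mxnorm_le_enorm _)).
have [_] := pos_diff qrc (sub _ Bp) Bp' (leqnn T) => H; apply: (le_trans H).
rewrite -[leRHS]mulrA; apply: ler_wpM2l; last exact: enorm_le_mxnorm.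
by rewrite mulr_ge0 // ltW.
Qed.
End minor_geometry.

(** * Iterated integrals as a Borel measure *)

(* An alias is needed since the row vectors carry no measurable structure. *)
Definition rVb (R : realType) (d : nat) := g_sigma_algebraType (@open 'rV[R]_d).
HB.instance Definition _ R d := Measurable.on (rVb R d).

Section borel.
Context {R : realType} {d : nat}.
Local Notation T := (rVb R d).

Lemma measurable_continuous (f : 'rV[R]_d -> R) : continuous f ->
  measurable_fun [set: T] (f : T -> R).
Proof.
move=> cf.
have M := @measurability _ _ T (measurableTypeR R) setT f _
  (@measurable_realfun.RGenOpens.measurableE R).
apply: M => _ [_ [x [y ->]] <-].
rewrite setTI; apply: sub_sigma_algebra => /=.
apply: open_comp; [by move=> z _; exact: cf|exact: interval_open].
Qed.

Lemma measurable_coord (i : 'I_d) : measurable_fun [set: T] (fun x : T => (x : 'rV[R]_d) 0 i).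
Proof. apply: measurable_continuous => x; exact: coord_continuous. Qed.

(* The half-open dyadic cubes of side 2^-n are the fibres of [dyad n]; they
   generate the Borel sets and form an algebra when [n] varies. *)
Definition dyad (n : nat) (x : 'rV[R]_d) : 'rV[int]_d :=
  \row_i Num.floor (2 ^+ n * x 0 i).

Lemma dyad_close n x y : dyad n x = dyad n y -> `|x - y| <= 2 ^- n.
Proof.
move=> e; apply: coord_le_mxnorm; first by rewrite invr_ge0 exprn_ge0.
move=> i; move/rowP/(_ i): e; rewrite !mxE => e.
have p : (0 : R) < 2 ^+ n by rewrite exprn_gt0.
rewrite -(ler_pM2l p) mulfV ?gt_eqF // -{1}(gtr0_norm p) -normrM mulrBr.
have /andP[a1 a2] := floor_itv (2 ^+ n * x 0 i).
have /andP[b1 b2] := floor_itv (2 ^+ n * y 0 i).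
rewrite ler_norml; rewrite -e in b1 b2; rewrite intrD in a2 b2.
apply/andP; split; lra.
Qed.

Lemma open_dyadE (A : set 'rV[R]_d) : open A ->
  A = \bigcup_n (dyad n @^-1` [set s | dyad n @^-1` [set s] `<=` A]).
Proof.
move=> oA; apply/seteqP; split=> [x Ax|x [n _] /= H]; last exact: H.
have /nbhs_ballP[e /= e0 He] : nbhs x A by exact: open_nbhs_nbhs.
have [n ne] : exists n, 2 ^- n < e.
  have [n _ /(_ n (leqnn n))] := near_infty_natSinv_expn_lt (PosNum e0).
  by rewrite div1r => h; exists n.
exists n => // y /= Hy; apply: He.
rewrite mx_norm_ball /ball_ /= (le_lt_trans _ ne)//.
by rewrite distrC; exact: dyad_close.
Qed.

Lemma measurable_dyad_comp (d1 : measure_display) (T1 : measurableType d1) (f : T1 -> 'rV[R]_d) n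
    (S : set 'rV[int]_d) :
  (forall i, measurable_fun [set: T1] (fun t => f t 0 i)) -> measurable ((dyad n \o f) @^-1` S).
Proof.
move=> mf.
rewrite (_ : _ @^-1` _ = \bigcup_(s in S) ((dyad n \o f) @^-1` [set s])); last first.
  apply/seteqP; split=> [t /= St|t [s Ss /= e]]; first by exists (dyad n (f t)).
  by rewrite /preimage /= e.
rewrite bigcup_mkcond; apply: countable_bigcupT_measurable => // s.
case: ifP => _ //.
rewrite (_ : _ @^-1` _ = \bigcap_(i in [set: 'I_d])
    ((fun t => f t 0 i) @^-1` [set y : R | Num.floor (2 ^+ n * y) = s 0 i])).
  apply: fin_bigcap_measurable => // i _.
  rewrite -[X in measurable X]setTI; apply: mf => //.
  rewrite (_ : [set y | _] = ( *%R (2 ^+ n)) @^-1` `[(s 0 i)%:~R, (s 0 i + 1)%:~R[%classic).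
    rewrite -[X in measurable X]setTI.
    by have := @mulrl_measurable R setT (2 ^+ n); apply.
  apply/seteqP; split=> y /=; rewrite in_itv /=.
    by move=> <-; exact: floor_itv.
  exact: floor_def.
apply/seteqP; split=> [t /= <- i _|t H]; first by rewrite /= mxE.
by apply/rowP => i; rewrite mxE; exact: H.
Qed.

(** An open set is a countable union of dyadic cubes, and membership in a cube is a condition on
    each coordinate. Thus the Borel sets coincide with the product sigma-algebra, and coordinatewise
    measurability is enough. *)
Lemma measurable_rVb (d1 : measure_display) (T1 : measurableType d1) (f : T1 -> 'rV[R]_d) :
  (forall i, measurable_fun [set: T1] (fun t => f t 0 i)) ->
  measurable_fun [set: T1] (f : T1 -> T).
Proof.
move=> mf.
have M := @measurability _ _ T1 T setT f (@open 'rV[R]_d) erefl.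
apply: M => _ [A oA <-].
rewrite setTI (open_dyadE oA) preimage_bigcup; apply: bigcupT_measurable => n.
exact: measurable_dyad_comp.
Qed.

(** Presents each stage of the iterated integral as a partial integral of a jointly measurable
    function, which is what Tonelli's theorem needs for the next stage. *)
Lemma measurable_upd (n : nat) :
  measurable_fun [set: T * measurableTypeR R]
    (fun z : T * measurableTypeR R => upd (z.1 : 'rV[R]_d) n z.2 : T).
Proof.
apply: measurable_rVb => i.
have [<-|/eqP ni] := eqVneq (i : nat) n.
  rewrite (_ : (fun _ => _) = snd); first exact: measurable_snd.
  by apply/funext => z; rewrite mxE eqxx.
rewrite (_ : (fun _ => _) = (fun x : T => (x : 'rV[R]_d) 0 i) \o fst).
  exact: measurableT_comp (measurable_coord i) measurable_fst.
by apply/funext => z; rewrite mxE (negbTE (introN eqP ni)).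
Qed.

Local Open Scope ereal_scope.
Local Notation leb := (@lebesgue_measure R).
Implicit Types (g : 'rV[R]_d -> \bar R) (n : nat).
Local Notation M g := (measurable_fun [set: T] (g : T -> \bar R)).
Local Notation nng g := (forall x, 0 <= g x).

Lemma iint_aux_ge0 n g : nng g -> nng (iint_aux n g).
Proof. by move=> g0; elim: n => //= n IH x; apply: integral_ge0 => t _. Qed.

Lemma measurable_line n g (x : 'rV[R]_d) : M g ->
  measurable_fun [set: measurableTypeR R] (fun t : measurableTypeR R => g (upd x n t)).
Proof.
move=> mg; have h := measurableT_comp mg (measurable_upd n).
have := measurableT_comp h (@pair1_measurable _ _ T (measurableTypeR R) (x : T)); exact.
Qed.

Arguments measurable_line {n g x}.

Lemma measurable_iint_aux n g : M g -> nng g -> M (iint_aux n g).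
Proof.
move=> mg g0; elim: n => //= n IH.
apply: (@measurable_fun_fubini_tonelli_F _ _ T (measurableTypeR R) R leb
  (fun z : T * measurableTypeR R => iint_aux n g (upd (z.1 : 'rV[R]_d) n z.2))).
- exact: measurableT_comp IH (measurable_upd n).
- by move=> z; exact: iint_aux_ge0.
Qed.

Arguments measurable_iint_aux n {g}.

Lemma eq_iint_aux n g1 g2 x : (forall y, g1 y = g2 y) -> iint_aux n g1 x = iint_aux n g2 x.
Proof. by move=> /funext ->. Qed.

Lemma iint_auxD n g1 g2 x : M g1 -> M g2 -> nng g1 -> nng g2 ->
  iint_aux n (fun y => g1 y + g2 y) x = iint_aux n g1 x + iint_aux n g2 x.
Proof.
move=> m1 m2 p1 p2; elim: n x => //= n IH x.
under eq_integral do rewrite IH.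
rewrite ge0_integralD //; try by move=> t _; exact: iint_aux_ge0.
- exact: measurable_line (measurable_iint_aux n m1 p1).
- exact: measurable_line (measurable_iint_aux n m2 p2).
Qed.

Lemma iint_auxZ n g (k : R) x : M g -> nng g -> (0 <= k)%R ->
  iint_aux n (fun y => k%:E * g y) x = k%:E * iint_aux n g x.
Proof.
move=> m1 p1 k0; elim: n x => //= n IH x.
under eq_integral do rewrite IH.
rewrite ge0_integralZl_EFin //; first by move=> t _; exact: iint_aux_ge0.
exact: measurable_line (measurable_iint_aux n m1 p1).
Qed.

Lemma le_iint_aux n g1 g2 x : M g1 -> M g2 -> nng g1 -> (forall y, g1 y <= g2 y) ->
  iint_aux n g1 x <= iint_aux n g2 x.
Proof.
move=> m1 m2 p1 h.
have p2 y : 0 <= g2 y by exact: le_trans (p1 y) (h y).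
elim: n x => //= n IH x.
apply: ge0_le_integral => //; try by move=> t _; exact: iint_aux_ge0.
- exact: measurable_line (measurable_iint_aux n m1 p1).
- exact: measurable_line (measurable_iint_aux n m2 p2).
Qed.

(** Monotone convergence passes through the iterated integrals one at a time. It gives both the
    countable additivity of [muV] and the extension from simple functions in [iintE]. *)
Lemma iint_aux_monotone n (G : nat -> 'rV[R]_d -> \bar R) x :
  (forall k, M (G k)) -> (forall k, nng (G k)) ->
  (forall y, nondecreasing_seq (G ^~ y)) ->
  iint_aux n (fun y => limn (G ^~ y)) x = limn (fun k => iint_aux n (G k) x).
Proof.
move=> mG G0 nd; elim: n x => //= n IH x.
under eq_integral do rewrite IH.
rewrite monotone_convergence //.
- by move=> k; exact: measurable_line (measurable_iint_aux n (mG k) (G0 k)).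
- by move=> k t _; exact: iint_aux_ge0.
- move=> t _ a b ab; apply: le_iint_aux => // y; exact: nd.
Qed.

Lemma iint_aux_sum (I : Type) (s : seq I) n (G : I -> 'rV[R]_d -> \bar R) x :
  (forall k, M (G k)) -> (forall k, nng (G k)) ->
  iint_aux n (fun y => \sum_(k <- s) G k y) x = \sum_(k <- s) iint_aux n (G k) x.
Proof.
move=> mG G0; elim: s => [|a s IH].
  rewrite big_nil; under eq_iint_aux do rewrite big_nil.
  have := @iint_auxZ n (cst 0) 0 x.
  under eq_iint_aux do rewrite mul0e.
  by rewrite mul0e; apply.
rewrite big_cons; under eq_iint_aux do rewrite big_cons.
rewrite iint_auxD //.
- by rewrite IH.
- exact: emeasurable_sum.
- by move=> y; exact: sume_ge0.
Qed.

(** Lebesgue measure on the Borel sets of R^d, recovered from the iterated integral of indicators.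
    Once it is a measure, Tonelli, push-forward and restriction become available for [iint]. *)
Definition muV (A : set T) : \bar R := iint (fun x : 'rV[R]_d => (\1_A x)%:E).

Let M1 (A : set T) : measurable A -> M (fun x => (\1_A x)%:E).
Proof. by move=> mA; apply/measurable_EFinP; exact: measurable_indic. Qed.
Let nng1 (A : set T) : nng (fun x => (\1_A x)%:E : \bar R).
Proof. by move=> x; rewrite lee_fin. Qed.

Let muV0 : muV set0 = 0.
Proof.
rewrite /muV /iint; have := @iint_auxZ d (cst 0) 0 0.
under eq_iint_aux do rewrite mul0e.
rewrite mul0e => H; under eq_iint_aux do rewrite indic0; apply: H => //.
Qed.

Let muV_ge0 A : 0 <= muV A.
Proof. exact: iint_aux_ge0. Qed.

Let muV_sigma_additive : semi_sigma_additive muV.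
Proof.
move=> F mF tF mUF.
pose G k (x : 'rV[R]_d) := \sum_(i <- index_iota 0 k) ((\1_(F i) : T -> R) x)%:E.
have E : (fun k => \sum_(0 <= i < k) muV (F i)) = (fun k => iint (G k)).
  apply/funext => k; rewrite /iint /G (@iint_aux_sum _ (index_iota 0 k) d (fun i (x : 'rV[R]_d) => ((\1_(F i) : T -> R) x)%:E)) //.
  by move=> i; exact: M1.
have GE x : ((\1_(\bigcup_n F n) : T -> R) x)%:E = limn (G ^~ x).
  apply/esym/cvg_lim => //.
  exact: (@measure_semi_sigma_additive _ _ _ (@dirac _ T x R) F mF tF mUF).
have mG k : M (G k) by apply: emeasurable_sum => i; exact: M1.
have G0 k : nng (G k) by move=> x; apply: sume_ge0.
have ndG x : nondecreasing_seq (G ^~ x).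
  move=> a b ab; apply: lee_sum_nneg_natr => //.
rewrite E /muV /iint (eq_iint_aux _ _ GE) iint_aux_monotone //.
apply: ereal_nondecreasing_is_cvgn.
move=> a b ab; apply: le_iint_aux => // y; exact: ndG.
Qed.

HB.instance Definition _ := isMeasure.Build _ T R muV muV0 muV_ge0 muV_sigma_additive.

Import HBNNSimple.

Let iintE_nnsfun (f : {nnsfun T >-> R}) :
  iint (fun x : 'rV[R]_d => (f (x : T))%:E) = \int[muV]_x (f x)%:E.
Proof.
have mk (k : R) : measurable (f @^-1` [set k]).
  by rewrite -[X in measurable X]setTI; apply: (measurable_funP f).
pose t k (x : 'rV[R]_d) := k%:E * (((\1_(f @^-1` [set k])) : T -> R) x)%:E.
have t0 k : nng (t k) by move=> x; rewrite /t nnfun_muleindic_ge0.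
have mt k : M (t k) by apply: measurable_funeM; exact: M1.
have fE (x : T) : (f x)%:E = \sum_(k <- finmap.enum_fset (fset_set (range f))) t k x.
  by rewrite /t -fsbig_finite //= fsumEFin //= fimfunE.
rewrite /iint (eq_iint_aux _ _ fE) iint_aux_sum //.
under eq_integral do rewrite fE.
rewrite ge0_integral_sum //; apply: eq_bigr => k _.
have [k0|k0] := leP 0%R k.
  rewrite /t iint_auxZ //; last exact: M1.
  rewrite ge0_integralZl_EFin //; last exact: M1.
  by rewrite integral_indic // setIT.
(* A negative value [k] is never taken by the nonnegative function [f], so its level set is
   empty. *)
have tz x : t k x = 0.
  rewrite /t indicE; case: (boolP (_ \in _)); last by rewrite mule0.
  rewrite inE /= => fk; exfalso; move: k0; rewrite -fk ltNge => /negP; apply.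
  exact: fun_ge0.
under [RHS]eq_integral do rewrite tz.
rewrite integral0 (eq_iint_aux _ _ tz).
have := @iint_auxZ d (cst 0) 0 0.
under eq_iint_aux do rewrite mul0e.
by rewrite mul0e; apply.
Qed.

Lemma iintE g : M g -> nng g -> iint g = \int[muV]_x g x.
Proof.
move=> mg g0.
pose h := nnsfun_approx measurableT mg.
have gE (x : T) : g x = limn (fun k => (h k x)%:E).
  by apply/esym/cvg_lim => //; apply: cvg_nnsfun_approx.
have mh k : M (fun x : 'rV[R]_d => (h k (x : T))%:E).
  by apply/measurable_EFinP; exact: measurable_funP.
have h0 k : nng (fun x : 'rV[R]_d => (h k (x : T))%:E : \bar R) by move=> x; rewrite lee_fin.
have ndh (x : T) : nondecreasing_seq (fun k => (h k x)%:E).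
  by move=> a b ab; rewrite lee_fin; exact/lefP/nd_nnsfun_approx.
rewrite /iint (eq_iint_aux _ _ gE) iint_aux_monotone //.
under eq_integral do rewrite gE.
rewrite monotone_convergence //.
by congr (limn _); apply/funext => k; exact: iintE_nnsfun.
Qed.
End borel.

(** * Invariance of Lebesgue measure on the line *)

Section lebesgue_line.
Context {R : realType}.
Local Notation leb := (@lebesgue_measure R).
Local Notation RR := (measurableTypeR R).
Local Open Scope ereal_scope.

(** Lebesgue measure is determined by its values on half-open intervals, so a map whose preimages
    preserve their lengths preserves all integrals. *)
Let leb_image (phi : RR -> RR) (mphi : measurable_fun [set: RR] phi) (f : RR -> \bar R) :
  (forall X, ocitv X -> leb X = leb (phi @^-1` X)) ->
  measurable_fun [set: RR] f -> (forall t, 0 <= f t) ->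
  \int[leb]_t f (phi t) = \int[leb]_t f t.
Proof.
move=> H mf f0.
rewrite -[LHS](@ge0_integral_pushforward _ _ RR RR R phi mphi leb setT f) //.
apply: eq_measure_integral => A mA _.
by rewrite -(@lebesgue_measure_unique R (pushforward leb phi)).
Qed.

Lemma integral_shift (c : R) (f : RR -> \bar R) :
  measurable_fun [set: RR] f -> (forall t, 0 <= f t) ->
  \int[leb]_t f (t + c)%R = \int[leb]_t f t.
Proof.
apply: (leb_image (phi := fun t : RR => (t + c)%R)).
  exact: measurable_funD.
move=> _ [[a b] _ <-] /=.
have -> : (fun t : RR => (t + c)%R) @^-1` `]a, b]%classic = `]a - c, b - c]%classic%R.
  by apply/seteqP; split=> t /=; rewrite !in_itv /= => /andP[? ?]; apply/andP; split; lra.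
rewrite !lebesgue_measure_itv /= !lte_fin ltrD2r; case: ifP => // _.
by rewrite -!EFinD; congr EFin; lra.
Qed.

Lemma integral_opp (f : RR -> \bar R) :
  measurable_fun [set: RR] f -> (forall t, 0 <= f t) ->
  \int[leb]_t f (- t)%R = \int[leb]_t f t.
Proof.
apply: (leb_image (phi := fun t : RR => (- t)%R)).
  exact: measurable_funN.
move=> _ [[a b] _ <-] /=.
have -> : (fun t : RR => (- t)%R) @^-1` `]a, b]%classic = `[- b, - a[%classic%R.
  by apply/seteqP; split=> t /=; rewrite !in_itv /= => /andP[? ?]; apply/andP; split; lra.
rewrite !lebesgue_measure_itv /= !lte_fin ltrN2; case: ifP => // _.
by rewrite -!EFinD; congr EFin; lra.
Qed.
End lebesgue_line.

(** * Translations, cubes, Tonelli and Gaussian integrals in dimension d *)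

Section space.
Context {R : realType} {d : nat}.
Local Notation T := (rVb R d).
Local Open Scope ereal_scope.
Local Notation leb := (@lebesgue_measure R).
Implicit Types (g : 'rV[R]_d -> \bar R) (n : nat).
Local Notation M g := (measurable_fun [set: T] (g : T -> \bar R)).
Local Notation nng g := (forall x, 0 <= g x).
Local Notation muV := (@muV R d).

Lemma measurable_closed (A : set 'rV[R]_d) : closed A -> measurable (A : set T).
Proof.
move=> cA; rewrite -[A]setCK; apply: measurableC.
by apply: sub_sigma_algebra; exact: closed_openC.
Qed.

Lemma measurable_opp : measurable_fun [set: T] (fun x : T => (- (x : 'rV[R]_d))%R : T).
Proof.
apply: measurable_rVb => i; under eq_fun do rewrite mxE.
by apply: measurable_funN => //; exact: measurable_coord.
Qed.

(** The induction on the number of integrations needs an arbitrary base point, and the shift then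
    moves the base point as well. *)
Lemma iint_shift g (a : 'rV[R]_d) : M g -> nng g -> iint (fun x => g (x + a)%R) = iint g.
Proof.
move=> mg g0.
suff H n x : (n <= d)%N ->
    iint_aux n (fun y => g (y + a)%R) x = iint_aux n g (x + a)%R.
  rewrite /iint H // add0r.
  (* After [n] integrations the base point matters only through its coordinates of index at least
     [n]; with [n = d] none is left, so the shifted base point is harmless. *)
  suff H2 n : forall x y : 'rV[R]_d, (forall j : 'I_d, (n <= j)%N -> x 0%R j = y 0%R j) ->
     iint_aux n g x = iint_aux n g y.
    by apply: H2 => j; rewrite leqNgt ltn_ord.
  elim: n => [|n IH] x y e /=; first by congr g; apply/rowP => j; exact: e.
  apply: eq_integral => t _; apply: IH => j nj; rewrite !mxE.
  by case: eqVneq => // jn; apply: e; rewrite ltn_neqAle eq_sym jn.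
elim: n x => // n IH x nd /=.
pose i := Ordinal nd.
rewrite -[RHS](@integral_shift R (a 0%R i)); last 2 first.
- exact: measurable_line (measurable_iint_aux n mg g0).
- by move=> t; exact: iint_aux_ge0.
apply: eq_integral => t _; rewrite IH ?(ltnW nd) //; congr iint_aux.
apply/rowP => j; rewrite !mxE; case: ifP => // /eqP jn.
by congr (_ + a _ _)%R; apply: val_inj.
Qed.

Lemma iint_opp g : M g -> nng g -> iint (fun x => g (- x)%R) = iint g.
Proof.
move=> mg g0.
suff H n x : iint_aux n (fun y => g (- y)%R) x = iint_aux n g (- x)%R by rewrite /iint H oppr0.
elim: n x => // n IH x /=.
rewrite -[RHS](@integral_opp R); last 2 first.
- exact: measurable_line (measurable_iint_aux n mg g0).
- by move=> t; exact: iint_aux_ge0.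
apply: eq_integral => t _; rewrite IH; congr iint_aux.
by apply/rowP => j; rewrite !mxE; case: ifP.
Qed.

(** The invariant: after [n] integrations the first [n] factors have become their integrals and the
    others are still evaluated at the base point. *)
Lemma iint_prod (f : 'I_d -> R -> R) (c : 'I_d -> R) :
  (forall i, measurable_fun [set: measurableTypeR R] (f i : measurableTypeR R -> R)) ->
  (forall i t, (0 <= f i t)%R) -> (forall i, \int[leb]_t (f i t)%:E = (c i)%:E) ->
  iint (fun x => (\prod_(i < d) f i (x 0%R i))%:E) = (\prod_(i < d) c i)%:E.
Proof.
move=> mf f0 fc.
have c0 i : (0 <= c i)%R.
  by rewrite -lee_fin -fc; apply: integral_ge0 => t _; rewrite lee_fin.
suff H n x : (n <= d)%N ->
    iint_aux n (fun x => (\prod_(i < d) f i (x 0%R i))%:E) x =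
    (\prod_(i < d) (if (i < n)%N then c i else f i (x 0%R i)))%:E.
  by rewrite /iint H //; congr EFin; apply: eq_bigr => i _; rewrite ltn_ord.
elim: n x => // n IH x nd /=.
pose k := Ordinal nd.
under eq_integral do rewrite IH ?(ltnW nd) //.
pose K := (\prod_(i < d | i != k) (if (i < n.+1)%N then c i else f i (x 0%R i)))%R.
transitivity (\int[leb]_t (K%:E * (f k t)%:E)).
  apply: eq_integral => t _; rewrite -EFinM; congr EFin.
  rewrite (bigD1 k) //= ltnn mxE eqxx mulrC; congr (_ * _)%R.
  apply: eq_bigr => i ik; rewrite mxE ltnS.
  have ink : (i : nat) != n by rewrite -(inj_eq val_inj) in ik.
  by rewrite (negbTE ink) ltn_neqAle ink; case: ltngtP ink.
rewrite ge0_integralZl_EFin //.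
- rewrite fc -EFinM; congr EFin.
  by rewrite [in RHS](bigD1 k) //= ltnSn mulrC.
- by move=> t _; rewrite lee_fin.
- by apply/measurable_EFinP; exact: mf.
- by apply: prodr_ge0 => i _; case: ifP.
Qed.

Definition cbox (c : 'rV[R]_d) (r : R) : set T := [set x | `|(x : 'rV[R]_d) - c| <= r]%R.

Lemma measurable_cbox c r : measurable (cbox c r).
Proof.
apply: measurable_closed.
rewrite (_ : cbox c r = closed_ball_ (fun x : 'rV[R]_d => `|x|%R) c r); last first.
  by apply/seteqP; split => x; rewrite /cbox /closed_ball_ /= distrC.
exact: closed_closed_ball_.
Qed.

Lemma muV_cbox c r : (0 <= r)%R -> muV (cbox c r) = ((2 * r) ^+ d)%:E.
Proof.
move=> r0; rewrite /muV.
rewrite (_ : (fun x : 'rV[R]_d => _) = (fun x : 'rV[R]_d =>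
   (\prod_(i < d) (\1_(`[c 0%R i - r, c 0%R i + r]%classic)%R : R -> R) (x 0%R i))%:E)); last first.
  apply/funext => x; rewrite indicE; congr EFin.
  have [/set_mem H|H] := boolP (x \in cbox c r).
    rewrite big1 // => i _; rewrite indicE mem_set //= in_itv /=.
    have := le_trans (coord_mxnorm _ i) H; rewrite !mxE ler_norml => /andP[? ?].
    by apply/andP; split; lra.
  have [i Hi] : exists i, ~ (`[c 0%R i - r, c 0%R i + r]%classic)%R (x 0%R i).
    apply: contrapT => N; move: H => /negP; apply; apply/mem_set.
    apply: coord_le_mxnorm => // i; rewrite !mxE.
    have : (`[c 0%R i - r, c 0%R i + r]%classic)%R (x 0%R i).
      by apply: contrapT => Ni; apply: N; exists i.
    by rewrite /= in_itv /= ler_norml => /andP[? ?]; apply/andP; split; lra.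
  by rewrite (bigD1 i) //= indicE memNset // mul0r.
rewrite (@iint_prod (fun i => \1_(`[c 0%R i - r, c 0%R i + r]%classic)%R : R -> R) (fun=> 2 * r)%R).
- by rewrite prodr_const card_ord.
- by move=> i; apply: measurable_indic; exact: measurable_itv.
- by move=> i t; rewrite indicE.
- move=> i; rewrite integral_indic ?setIT; last exact: measurable_itv.
    rewrite -[LHS]/(leb _) lebesgue_measure_itv /= lte_fin; case: ltP => h; rewrite -?EFinD; congr EFin; lra.
  exact: measurableT.
Qed.

Let muV_sigma_finite : sigma_finite setT muV.
Proof.
exists (fun n => cbox 0%R n%:R); last first.
  by move=> n; split; [exact: measurable_cbox|rewrite muV_cbox // ltry].
apply/seteqP; split => // x _; exists (Num.truncn `|x|%R).+1 => //.
by rewrite /cbox /= subr0 ltW // truncnS_gt.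
Qed.
HB.instance Definition _ := @Measure_isSigmaFinite.Build _ T R muV muV_sigma_finite.

Lemma measurable_iint_param (f : T * T -> \bar R) : measurable_fun [set: T * T] f ->
  nng f -> M (fun q : 'rV[R]_d => iint (fun p : 'rV[R]_d => f (q, p))).
Proof.
move=> mf f0.
have := @measurable_fun_fubini_tonelli_F _ _ T T R muV f mf f0.
rewrite /fubini_F; congr (measurable_fun _ _).
apply/funext => q; rewrite iintE //.
exact: (measurableT_comp mf (@pair1_measurable _ _ T T (q : T))).
Qed.

Lemma measurable_iint_param2 (f : T * T -> \bar R) : measurable_fun [set: T * T] f ->
  nng f -> M (fun p : 'rV[R]_d => iint (fun q : 'rV[R]_d => f (q, p))).
Proof.
move=> mf f0.
have := @measurable_fun_fubini_tonelli_G _ _ T T R muV f mf f0.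
rewrite /fubini_G; congr (measurable_fun _ _).
apply/funext => p; rewrite iintE //.
exact: (measurableT_comp mf (@pair2_measurable _ _ T T (p : T))).
Qed.

Lemma iint_swap (f : T * T -> \bar R) : measurable_fun [set: T * T] f -> nng f ->
  iint (fun q : 'rV[R]_d => iint (fun p : 'rV[R]_d => f (q, p))) =
  iint (fun p : 'rV[R]_d => iint (fun q : 'rV[R]_d => f (q, p))).
Proof.
move=> mf f0.
rewrite iintE; last 2 first.
- exact: measurable_iint_param.
- by move=> q; exact: iint_aux_ge0.
rewrite [RHS]iintE; last 2 first.
- exact: measurable_iint_param2.
- by move=> q; exact: iint_aux_ge0.
transitivity (\int[muV]_q \int[muV]_p f (q, p)).
  apply: eq_integral => q _; rewrite iintE //.
  exact: (measurableT_comp mf (@pair1_measurable _ _ T T (q : T))).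
rewrite fubini_tonelli //; apply: eq_integral => p _; rewrite iintE //.
exact: (measurableT_comp mf (@pair2_measurable _ _ T T (p : T))).
Qed.

Lemma measurable_dotv (d1 : measure_display) (T1 : measurableType d1) (f g : T1 -> 'rV[R]_d) :
  measurable_fun [set: T1] (f : T1 -> T) -> measurable_fun [set: T1] (g : T1 -> T) ->
  measurable_fun [set: T1] (fun t => dotv (f t) (g t)).
Proof.
move=> mf mg; rewrite /dotv; elim: (index_enum _) => [|i r IH].
  by under eq_fun do rewrite big_nil; exact: measurable_cst.
under eq_fun do rewrite big_cons.
apply: measurable_funD => //; apply: measurable_funM.
- exact: (measurableT_comp (measurable_coord i) mf).
- exact: (measurableT_comp (measurable_coord i) mg).
Qed.

Lemma measurable_enorm : measurable_fun [set: T] (fun x : T => enorm (x : 'rV[R]_d)).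
Proof.
rewrite /enorm.
have h := measurable_dotv (@measurable_id _ T setT) (@measurable_id _ T setT).
have s : measurable_fun setT (@Num.sqrt R : R -> R).
  by apply: continuous_measurable_fun; exact: sqrt_continuous.
exact: (measurableT_comp s h).
Qed.

Lemma gaussE (p : 'rV[R]_d) : gauss p = (\prod_(i < d) normal_pdf 0 1 (p 0%R i))%R.
Proof.
under eq_bigr do rewrite normal_pdfE // /normal_peak /normal_fun subr0 expr1n !mul1r.
rewrite big_split /= prodr_const card_ord -expR_sum /gauss; congr (_ * expR _)%R.
  by rewrite exprVn [(2 * _)%R]mulrC mulr_natr.
by rewrite /dotv mulr_suml -sumrN; apply: eq_bigr => i _; rewrite -expr2 mulNr.
Qed.

Lemma gauss_ge0 (p : 'rV[R]_d) : (0 <= gauss p)%R.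
Proof. by rewrite gaussE; apply: prodr_ge0 => i _; exact: normal_pdf_ge0. Qed.

Lemma measurable_prod_coord (f : 'I_d -> R -> R) :
  (forall i, measurable_fun [set: R] (f i)) ->
  measurable_fun [set: T] (fun x : T => (\prod_(i < d) f i ((x : 'rV[R]_d) 0%R i))%R).
Proof.
move=> mf; elim: (index_enum _) => [|i r IH].
  by under eq_fun do rewrite big_nil; exact: measurable_cst.
under eq_fun do rewrite big_cons.
apply: measurable_funM => //; exact: measurableT_comp (mf i) (measurable_coord i).
Qed.

Lemma measurable_gauss : measurable_fun [set: T] (fun p : T => gauss (p : 'rV[R]_d)).
Proof.
under eq_fun do rewrite gaussE.
exact: (@measurable_prod_coord (fun=> normal_pdf 0 1) (fun=> measurable_normal_pdf _ _)).
Qed.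

Lemma iint_gauss : iint (fun p : 'rV[R]_d => (gauss p)%:E) = 1.
Proof.
rewrite /iint; under eq_iint_aux do rewrite gaussE.
have := @iint_prod (fun=> normal_pdf 0 1) (fun=> 1%R).
rewrite big1 //; apply.
- by move=> i; exact: measurable_normal_pdf.
- by move=> i t; exact: normal_pdf_ge0.
- by move=> i; exact: integral_normal_pdf.
Qed.

(** From (C - |p| / 2)^2 >= 0 one gets C |p| - |p|^2 / 2 <= C^2 - |p|^2 / 4. The right side is, up
    to a constant, a product of normal densities of variance 2, whose integral is known; no radial
    integration is involved. *)
Lemma gauss_exp_bound (C : R) (p : 'rV[R]_d) :
  (expR (C * enorm p) * gauss p <=
   expR (C ^+ 2) * Num.sqrt 2 ^+ d * \prod_(i < d) normal_pdf 0 (Num.sqrt 2) (p 0 i))%R.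
Proof.
have s2 : (Num.sqrt 2 != 0 :> R)%R by rewrite sqrtr_eq0 -ltNge.
under eq_bigr do rewrite normal_pdfE // /normal_peak /normal_fun subr0 sqr_sqrtr //.
rewrite big_split /= prodr_const card_ord -expR_sum /gauss.
set u := (\sum_(i < d) _)%R.
have -> : u = (- (dotv p p / 4))%R.
  by rewrite /u /dotv mulr_suml -sumrN; apply: eq_bigr => i _; rewrite -expr2; lra.
have pp : (0 < @pi R)%R by exact: pi_gt0.
have -> : ((Num.sqrt (2 * pi *+ 2))^-1 = (Num.sqrt 2)^-1 * (Num.sqrt (2 * pi))^-1 :> R)%R.
  by rewrite -invfM -sqrtrM // -mulr_natl; congr (Num.sqrt _)^-1%R; ring.
rewrite exprMn exprVn !mulrA -[X in (_ <= X * _ * _)%R]mulrA divff ?expf_neq0 // mulr1.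
rewrite mulrAC [(expR (C ^+ 2) * _)%R]mulrC exprVn.
rewrite mulrAC [(_ * (_ ^- _))%R]mulrC -mulrA -[leRHS]mulrA ler_wpM2l ?invr_ge0 ?exprn_ge0 ?sqrtr_ge0 //.
rewrite -!expRD ler_expR -enorm_sqr.
have := sqr_ge0 (C - enorm p / 2)%R; nra.
Qed.

Lemma iint_gauss_exp (C : R) :
  exists2 K : R, (0 <= K)%R & iint (fun p : 'rV[R]_d => (expR (C * enorm p) * gauss p)%:E) <= K%:E.
Proof.
have s2 : (Num.sqrt 2 != 0 :> R)%R by rewrite sqrtr_eq0 -ltNge.
pose c := (expR (C ^+ 2) * Num.sqrt 2 ^+ d)%R.
have c0 : (0 <= c)%R by rewrite mulr_ge0 ?expR_ge0 ?exprn_ge0 ?sqrtr_ge0.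
exists c => //.
have mP : measurable_fun [set: T]
   (fun p : T => (\prod_(i < d) normal_pdf 0 (Num.sqrt 2) ((p : 'rV[R]_d) 0%R i))%R).
  exact: (@measurable_prod_coord (fun=> normal_pdf 0 (Num.sqrt 2)) (fun=> measurable_normal_pdf _ _)).
have P0 (p : 'rV[R]_d) : (0 <= \prod_(i < d) normal_pdf 0 (Num.sqrt 2) (p 0%R i))%R.
  by apply: prodr_ge0 => i _; exact: normal_pdf_ge0.
apply: (@le_trans _ _ (iint (fun p : 'rV[R]_d =>
   c%:E * (\prod_(i < d) normal_pdf 0 (Num.sqrt 2) (p 0%R i))%:E))).
  apply: le_iint_aux.
  - apply/measurable_EFinP; apply: measurable_funM; last exact: measurable_gauss.
    apply: measurableT_comp => //; apply: measurable_funM => //; exact: measurable_enorm.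
  - by apply: measurable_funeM; apply/measurable_EFinP.
  - by move=> p; rewrite lee_fin mulr_ge0 ?expR_ge0 ?gauss_ge0.
  - by move=> p; rewrite -EFinM lee_fin; exact: gauss_exp_bound.
rewrite /iint iint_auxZ //; last by apply/measurable_EFinP.
have := @iint_prod (fun=> normal_pdf 0 (Num.sqrt 2)) (fun=> 1%R).
rewrite big1 // /iint => ->; first by rewrite mule1.
- by move=> i; exact: measurable_normal_pdf.
- by move=> i t; exact: normal_pdf_ge0.
- by move=> i; exact: integral_normal_pdf.
Qed.
End space.

(** * The Harris theorem *)

Section harris_real.
Context {R : realType} {T : Type} (t0 : T).
Variables (m : (T -> R) -> Prop) (Q : (T -> R) -> T -> R) (V : T -> R) (lam b : R).
Hypothesis mD : forall f g, m f -> m g -> m (fun x => f x + g x).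
Hypothesis mZ : forall c f, 0 <= c -> m f -> m (fun x => c * f x).
Hypothesis mc : forall c, 0 <= c -> m (fun=> c).
Hypothesis mV : m V.
Hypothesis mQ : forall f, m f -> m (Q f).
Hypothesis QD : forall f g x, m f -> m g -> Q (fun x => f x + g x) x = Q f x + Q g x.
Hypothesis QZ : forall c f x, 0 <= c -> m f -> Q (fun x => c * f x) x = c * Q f x.
Hypothesis Qc : forall c x, 0 <= c -> Q (fun=> c) x = c.
Hypothesis Qle : forall f g x, m f -> m g -> (forall y, f y <= g y) -> Q f x <= Q g x.
Hypothesis V1 : forall x, 1 <= V x.
Hypothesis lam01 : 0 <= lam < 1.
Hypothesis b0 : 0 < b.
Hypothesis drift : forall x, Q V x <= lam * V x + b.
Let r0 := 4 * b / (1 - lam).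
Variable nu : (T -> R) -> R.
Hypothesis nuD : forall f g, m f -> m g -> nu (fun x => f x + g x) = nu f + nu g.
Hypothesis nuZ : forall c f, 0 <= c -> m f -> nu (fun x => c * f x) = c * nu f.
Hypothesis nu_ge0 : forall f, m f -> (forall x, 0 <= f x) -> 0 <= nu f.
Hypothesis nu1 : 0 < nu (fun=> 1).
(** This is nu(g - f) <= Q(g - f)(x) with the terms moved so that none is negative: the class [m] is
    a cone, closed under sums and nonnegative multiples only. *)
Hypothesis minor : forall f g x, m f -> m g -> (forall y, f y <= g y) -> V x <= r0 ->
  Q f x + nu g <= Q g x + nu f.
Variable ppi : (T -> R) -> R.
Hypothesis piD : forall f g, m f -> m g -> ppi (fun x => f x + g x) = ppi f + ppi g.
Hypothesis piZ : forall c f, 0 <= c -> m f -> ppi (fun x => c * f x) = c * ppi f.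
Hypothesis pic : forall c, 0 <= c -> ppi (fun=> c) = c.
Hypothesis pile : forall f g, m f -> m g -> (forall y, f y <= g y) -> ppi f <= ppi g.
Hypothesis piQ : forall f, m f -> ppi (Q f) = ppi f.

Let e := Num.min (nu (fun=> 1)) 1.
Let be := e / (2 * b).
(* [Q] contracts the seminorm sup (f x - f y) / (W x + W y) by the factor [gam]. *)
Let W x := 1 + be * V x.
Let t := Num.min (be * r0 * ((1 - lam) / 2) / (2 + be * r0)) (Num.min (e / 2) (1 - lam)).
Let gam := 1 - t.

Let e_gt0 : 0 < e. Proof. by rewrite lt_min nu1 ltr01. Qed.
Let be_gt0 : 0 < be. Proof. by rewrite divr_gt0 // mulr_gt0. Qed.
Let r0_gt0 : 0 < r0.
Proof. by rewrite divr_gt0 ?mulr_gt0 // subr_gt0; case/andP: lam01. Qed.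
Let t_gt0 : 0 < t.
Proof.
case/andP: lam01 => l0 l1.
have q : 0 < be * r0 by rewrite mulr_gt0.
rewrite !lt_min subr_gt0 l1 andbT; apply/andP; split; last by rewrite divr_gt0.
by rewrite divr_gt0 ?addr_gt0 // mulr_gt0 // divr_gt0 // subr_gt0.
Qed.
Let t_le1 : t <= 1.
Proof.
case/andP: lam01 => l0 l1; rewrite !ge_min; apply/orP; right; apply/orP; right.
by rewrite lerBlDr lerDl.
Qed.
Let mW : m W.
Proof. by apply: mD; [exact: mc|apply: mZ => //; exact: ltW]. Qed.
Let QW x : Q W x = 1 + be * Q V x.
Proof. by rewrite QD ?QZ ?Qc //; [exact: ltW|exact: mc|apply: mZ => //; exact: ltW]. Qed.
Let nuW : nu (fun=> 1) <= nu W.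
Proof.
rewrite nuD ?nuZ //; [|exact: ltW|exact: mc|apply: mZ => //; exact: ltW].
rewrite lerDl mulr_ge0 ?nu_ge0 // ?(ltW be_gt0) // => x.
exact: le_trans ler01 (V1 x).
Qed.

(** By the choice of [r0], 2 b is at most half of (1 - lam) S, so the drift alone contracts S. The
    constant 2 in W x + W y must contract too; this is possible because S is bounded below, and S =
    r0 is the worst case, which gives the first entry of [t]. *)
Let gam_far x y : r0 <= V x + V y -> Q W x + Q W y <= gam * (W x + W y).
Proof.
move=> far; rewrite !QW /W.
have dx := drift x; have dy := drift y.
set S := V x + V y in far *.
have -> : gam * (1 + be * V x + (1 + be * V y)) = gam * (2 + be * S) by rewrite /S; ring.
apply: (@le_trans _ _ (2 + be * (lam * S + 2 * b))).
  have : be * (Q V x + Q V y) <= be * (lam * S + 2 * b).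
    by rewrite ler_pM2l // /S; lra.
  lra.
case/andP: lam01 => l0 l1.
have Hb : 2 * b <= (1 - lam) / 2 * S.
  have <- : (1 - lam) / 2 * r0 = 2 * b.
    by rewrite /r0; field; rewrite subr_eq0 gt_eqF.
  by rewrite ler_pM2l // divr_gt0 // subr_gt0.
have t1 : t * (2 + be * r0) <= be * r0 * ((1 - lam) / 2).
  rewrite -ler_pdivlMr; last by rewrite addr_gt0 // mulr_gt0.
  by rewrite /t ge_min lexx.
have t2 : t <= (1 - lam) / 2.
  have p : 0 < be * r0 by rewrite mulr_gt0.
  have : t * (be * r0) <= ((1 - lam) / 2) * (be * r0) by nra.
  by rewrite ler_pM2r.
have t3 : 2 * t <= be * S * ((1 - lam) / 2 - t).
  have : be * r0 * ((1 - lam) / 2 - t) <= be * S * ((1 - lam) / 2 - t).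
    by apply: ler_wpM2r; [rewrite subr_ge0|rewrite ler_pM2l].
  lra.
have t4 : be * (2 * b) <= be * ((1 - lam) / 2 * S) by rewrite ler_pM2l.
rewrite /gam; lra.
Qed.

(** The weight [be] is tuned so that the drift constants add only be * 2 b = e, at most one copy of
    nu(1). Two copies are subtracted, so one remains to contract the constants, whence t <= e / 2;
    the part in V contracts by the drift, whence t <= 1 - lam. *)
Let gam_near x y : Q W x + Q W y - 2 * nu (fun=> 1) <= gam * (W x + W y).
Proof.
rewrite !QW /W.
have dx := drift x; have dy := drift y; have vx := V1 x; have vy := V1 y.
set S := V x + V y.
have -> : gam * (1 + be * V x + (1 + be * V y)) = gam * (2 + be * S) by rewrite /S; ring.
have S0 : 0 <= S by rewrite /S; lra.
have h1 : be * (Q V x + Q V y) <= be * (lam * S + 2 * b).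
  by rewrite ler_pM2l // /S; lra.
have h2 : be * (2 * b) = e by rewrite /be; field; rewrite gt_eqF.
have h3 : e <= nu (fun=> 1) by rewrite /e ge_min lexx.
have h4 : t <= e / 2 by rewrite /t !ge_min lexx !orbT.
have h5 : t <= 1 - lam by rewrite /t !ge_min lexx !orbT.
have h6 : be * S * t <= be * S * (1 - lam).
  by apply: ler_wpM2l => //; rewrite mulr_ge0 // ltW.
rewrite /gam; lra.
Qed.

Let QDc f c x : m f -> 0 <= c -> Q (fun z => f z + c) x = Q f x + c.
Proof. by move=> mf c0; rewrite (QD x mf (mc c0)) Qc. Qed.
Let QDW f s x : m f -> 0 <= s -> Q (fun z => f z + s * W z) x = Q f x + s * Q W x.
Proof. by move=> mf s0; rewrite (QD x mf (mZ s0 mW)) QZ. Qed.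
Let nuDc f c : m f -> 0 <= c -> nu (fun z => f z + c) = nu f + c * nu (fun=> 1).
Proof.
move=> mf c0; rewrite (nuD mf (mc c0)) -nuZ //; last exact: mc.
by congr (_ + nu _); apply/funext => z; rewrite mulr1.
Qed.
Let nuDW f s : m f -> 0 <= s -> nu (fun z => f z + s * W z) = nu f + s * nu W.
Proof. by move=> mf s0; rewrite (nuD mf (mZ s0 mW)) nuZ. Qed.
Let piDc f c : m f -> 0 <= c -> ppi (fun z => f z + c) = ppi f + c.
Proof. by move=> mf c0; rewrite (piD mf (mc c0)) pic. Qed.
Let piDW f s : m f -> 0 <= s -> ppi (fun z => f z + s * W z) = ppi f + s * ppi W.
Proof. by move=> mf s0; rewrite (piD mf (mZ s0 mW)) piZ. Qed.

(** If V x + V y is at least [r0] the drift suffices. Otherwise both points lie in the minorization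
    region, since V is positive; using [minor] for the upper bound at [x] and the lower bound at
    [y], the terms nu(f1) and nu(f2) cancel and 2 s nu(W) is gained. *)
Let step_osc f1 f2 c s : m f1 -> m f2 -> 0 <= s ->
  (forall x, `|f1 x - f2 x - c| <= s * W x) ->
  forall x y, (Q f1 x - Q f2 x) - (Q f1 y - Q f2 y) <= gam * s * (W x + W y).
Proof.
move=> m1 m2 s0 H x y.
(* The centering constant is split into nonnegative parts and moved across the inequality, so that
   only members of the cone are fed to [Q]. *)
pose c1 := Num.max c 0; pose c2 := Num.max (- c) 0.
have c10 : 0 <= c1 by rewrite le_max lexx orbT.
have c20 : 0 <= c2 by rewrite le_max lexx orbT.
have cE : c = c1 - c2.
  by rewrite /c1 /c2; case: (leP c 0) => h; case: (leP (- c) 0) => h'; lra.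
have mc1 := mc c10; have mc2 := mc c20.
have msW : m (fun x => s * W x) by exact: mZ.
have u z : f1 z + c2 <= (f2 z + c1) + s * W z.
  by have := H z; rewrite ler_norml cE => /andP[]; lra.
have l z : f2 z + c1 <= (f1 z + c2) + s * W z.
  by have := H z; rewrite ler_norml cE => /andP[]; lra.
have A1 : m (fun z => f1 z + c2) by exact: mD.
have A2 : m (fun z => f2 z + c1) by exact: mD.
have B1 : m (fun z => f2 z + c1 + s * W z) by exact: mD.
have B2 : m (fun z => f1 z + c2 + s * W z) by exact: mD.
have qu z : Q f1 z + c2 <= Q f2 z + c1 + s * Q W z.
  by have := Qle z A1 B1 u; rewrite QDW // !QDc //.
have ql z : Q f2 z + c1 <= Q f1 z + c2 + s * Q W z.
  by have := Qle z A2 B2 l; rewrite QDW // !QDc //.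
have [far|near] := leP r0 (V x + V y).
  have := gam_far far => /(ler_wpM2l s0) G.
  have := qu x; have := ql y; have -> : gam * s * (W x + W y) = s * (gam * (W x + W y)) by ring.
  lra.
have vx : V x <= r0 by have := V1 y; lra.
have vy : V y <= r0 by have := V1 x; lra.
have := minor A1 B1 u vx; rewrite QDW // nuDW // !QDc // !nuDc //.
have := minor A2 B2 l vy; rewrite QDW // nuDW // !QDc // !nuDc //.
have := gam_near x y => /(ler_wpM2l s0).
have : s * nu (fun=> 1) <= s * nu W by rewrite ler_wpM2l.
have -> : gam * s * (W x + W y) = s * (gam * (W x + W y)) by ring.
set n1 := nu (fun => 1). nra.
Qed.

(** An oscillation bound relative to W x + W y is equivalent to a bound by W after subtracting a
    suitable constant; the supremum below is such a constant. *)
Let step f1 f2 c s : m f1 -> m f2 -> 0 <= s ->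
  (forall x, `|f1 x - f2 x - c| <= s * W x) ->
  exists c', forall x, `|Q f1 x - Q f2 x - c'| <= gam * s * W x.
Proof.
move=> m1 m2 s0 H.
have O := step_osc m1 m2 s0 H.
pose A := [set Q f1 x - Q f2 x - gam * s * W x | x in [set: T]].
have ub y : ubound A (Q f1 y - Q f2 y + gam * s * W y).
  by move=> _ [x _ <-]; have := O x y; lra.
exists (sup A) => x; rewrite ler_norml; apply/andP; split.
  have : sup A <= Q f1 x - Q f2 x + gam * s * W x.
    by apply: ge_sup => //; exists (Q f1 t0 - Q f2 t0 - gam * s * W t0), t0.
  lra.
have : Q f1 x - Q f2 x - gam * s * W x <= sup A.
  by apply: ub_le_sup; [exists (Q f1 x - Q f2 x + gam * s * W x)|exists x].
lra.
Qed.

Let miter k f : m f -> m (iter k Q f).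
Proof. by move=> mf; elim: k => //= k IH; exact: mQ. Qed.

(** Iterating [step] gives a centering constant [c] at time [k] about which nothing else is known.
    Integrating the same two-sided bound against [ppi], which [Q] preserves, shows that ppi(f1) -
    ppi(f2) is within s ppi(W) of [c]; this is the origin of the constant [vs]. The induction starts
    from V <= be^-1 W. *)
Lemma harris_real : exists rho vs : R, [/\ 0 <= rho < 1, 0 <= vs & forall f1 f2 k x,
  m f1 -> m f2 -> (forall y, `|f1 y - f2 y| <= V y) ->
  `|iter k Q f1 x - iter k Q f2 x - (ppi f1 - ppi f2)| <= vs * rho ^+ k * V x].
Proof.
have g0 : 0 <= gam by rewrite /gam subr_ge0.
have g1 : gam < 1 by rewrite /gam ltrBlDr ltrDl.
have piW : 1 <= ppi W.
  rewrite -[leLHS](pic ler01); apply: pile => //; first exact: mc.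
  by move=> y; rewrite /W lerDl mulr_ge0 ?(ltW be_gt0)// (le_trans ler01).
exists gam, (be^-1 * (1 + be + ppi W)); split; first by rewrite g0 g1.
  by rewrite mulr_ge0 ?invr_ge0 ?(ltW be_gt0)// ?addr_ge0 // ?(ltW be_gt0)// (le_trans ler01).
move=> f1 f2 k x m1 m2 H.
have [c Hc] : exists c, forall x, `|iter k Q f1 x - iter k Q f2 x - c|
    <= gam ^+ k * be^-1 * W x.
  elim: k => [|k [c IH]].
    exists 0 => y; rewrite /= subr0 expr0 mul1r /W (le_trans (H y))//.
    by rewrite mulrDr mulr1 mulKf ?gt_eqF// lerDr invr_ge0 ltW.
  have s0 : 0 <= gam ^+ k * be^-1 by rewrite mulr_ge0 ?exprn_ge0 ?invr_ge0 ?(ltW be_gt0).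
  have [c' Hc'] := step (miter k m1) (miter k m2) s0 IH.
  by exists c' => y; rewrite exprS -!mulrA mulrA -mulrA; move: (Hc' y); rewrite !mulrA.
set s := gam ^+ k * be^-1 in Hc.
have s0 : 0 <= s by rewrite mulr_ge0 ?exprn_ge0 ?invr_ge0 ?(ltW be_gt0).
have pik f : m f -> ppi (iter k Q f) = ppi f.
  move=> mf; clear -mf piQ mQ miter; elim: k => //= k IH.
  by rewrite piQ //; exact: miter.
have pic' : `|ppi f1 - ppi f2 - c| <= s * ppi W.
  rewrite -(pik f1) // -(pik f2) //.
  pose c1 := Num.max c 0; pose c2 := Num.max (- c) 0.
  have c10 : 0 <= c1 by rewrite le_max lexx orbT.
  have c20 : 0 <= c2 by rewrite le_max lexx orbT.
  have cE : c = c1 - c2.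
    by rewrite /c1 /c2; case: (leP c 0) => h; case: (leP (- c) 0) => h'; lra.
  have mc1 := mc c10; have mc2 := mc c20.
  have msW : m (fun x => s * W x) by exact: mZ.
  have M1 := miter k m1; have M2 := miter k m2.
  have u z : iter k Q f1 z + c2 <= (iter k Q f2 z + c1) + s * W z.
    by have := Hc z; rewrite ler_norml cE => /andP[]; lra.
  have l z : iter k Q f2 z + c1 <= (iter k Q f1 z + c2) + s * W z.
    by have := Hc z; rewrite ler_norml cE => /andP[]; lra.
  have A1 : m (fun z => iter k Q f1 z + c2) by exact: mD.
  have A2 : m (fun z => iter k Q f2 z + c1) by exact: mD.
  have := pile A1 (mD A2 msW) u; have := pile A2 (mD A1 msW) l.
  rewrite !piDW // !piDc // cE ler_norml => ? ?; apply/andP; split; lra.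
have Vx := V1 x.
have -> : iter k Q f1 x - iter k Q f2 x - (ppi f1 - ppi f2) =
  (iter k Q f1 x - iter k Q f2 x - c) - (ppi f1 - ppi f2 - c) by ring.
apply: le_trans (ler_normB _ _) _.
apply: le_trans (lerD (Hc x) pic') _.
have -> : be^-1 * (1 + be + ppi W) * gam ^+ k * V x = s * ((1 + be + ppi W) * V x).
  by rewrite /s; ring.
rewrite -mulrDr ler_wpM2l // /W.
have b0' := ltW be_gt0.
have : ppi W <= ppi W * V x by rewrite ler_peMr // (le_trans ler01).
rewrite /W; lra.
Qed.
End harris_real.

(** * Images of Lebesgue measure *)

Section le_measure_algebra.
Context (dT : measure_display) (T : measurableType dT) (R : realType).
Variables (m1 m2 : {measure set T -> \bar R}) (G : set (set T)).
Local Open Scope ereal_scope.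
Hypothesis m1fin : m1 setT < +oo.
Hypothesis m2fin : m2 setT < +oo.
Hypothesis G0 : G set0.
Hypothesis GC : forall A, G A -> G (~` A).
Hypothesis GU : forall A B, G A -> G B -> G (A `|` B).
Hypothesis mG : G `<=` measurable.
Hypothesis m12 : forall A, G A -> m1 A <= m2 A.

Let tau : {measure set T -> \bar R} := measure_add m1 m2.
Let tauE A : tau A = m1 A + m2 A.
Proof. exact: measure_addE. Qed.
Let taufin A : measurable A -> tau A < +oo.
Proof.
move=> mA; apply: (@le_lt_trans _ _ (tau setT)); first by apply: le_measure; rewrite ?inE.
by rewrite tauE lte_add_pinfty.
Qed.
Let tau1 A : measurable A -> m1 A <= tau A.
Proof. by move=> mA; rewrite tauE leeDl. Qed.
Let tau2 A : measurable A -> m2 A <= tau A.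
Proof. by move=> mA; rewrite tauE leeDr. Qed.

(** An inequality between measures does not survive proper differences, so a Dynkin class argument
    stalls. Approximability by members of [G], in contrast, is stable under complements and
    countable unions. *)
Let H (A : set T) := measurable A /\ forall e : R, (0 < e)%R ->
  exists2 E, G E & tau (A `\` E) + tau (E `\` A) <= e%:E.

Let HU A B : H A -> H B -> H (A `|` B).
Proof.
move=> [mA hA] [mB hB]; split; first exact: measurableU.
move=> e e0; have e2 : (0 < e / 2)%R by rewrite divr_gt0.
have [E GE hE] := hA _ e2; have [F GF hF] := hB _ e2.
have mE := mG GE; have mF := mG GF.
exists (E `|` F); first exact: GU.
have a1 : tau ((A `|` B) `\` (E `|` F)) <= tau (A `\` E) + tau (B `\` F).
  apply: le_trans (measureU2 _ _ _); try exact: measurableD.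
  apply: le_measure; rewrite ?inE; try (by do ?[apply: measurableD|apply: measurableU]).
  by move=> x [[?|?] N]; [left|right]; split=> // ?; apply: N; [left|right].
have a2 : tau ((E `|` F) `\` (A `|` B)) <= tau (E `\` A) + tau (F `\` B).
  apply: le_trans (measureU2 _ _ _); try exact: measurableD.
  apply: le_measure; rewrite ?inE; try (by do ?[apply: measurableD|apply: measurableU]).
  by move=> x [[?|?] N]; [left|right]; split=> // ?; apply: N; [left|right].
apply: (le_trans (leeD a1 a2)); rewrite addeACA.
by rewrite [e in leRHS]splitr EFinD leeD.
Qed.

Let H0 : H set0.
Proof.
split => // e e0; exists set0 => //; rewrite setD0 measure0 adde0 lee_fin; exact: ltW.
Qed.

Let HC A : H A -> H (~` A).
Proof.
move=> [mA hA]; split; first exact: measurableC.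
move=> e e0; have [E GE hE] := hA _ e0; exists (~` E); first exact: GC.
have CC (X Y : set T) : ~` X `\` ~` Y = Y `\` X by rewrite !setDE setCK setIC.
by rewrite !CC addeC.
Qed.

(** A finite partial union is within e / 2 of the whole, by continuity from above of the finite
    measure [tau], and it is itself approximated within e / 2. *)
Let Hbig (F : (set T)^nat) : (forall i, H (F i)) -> H (\bigcup_i F i).
Proof.
move=> HF.
have mU : measurable (\bigcup_i F i) by apply: bigcupT_measurable => i; case: (HF i).
pose S n := \big[setU/set0]_(i < n) F i.
have SE n : S n = \bigcup_(i < n) F i by rewrite /S -bigcup_mkord.
have HS n : H (S n).
  by elim: n => [|n IH]; rewrite /S ?big_ord0 ?big_ord_recr //=; exact: HU.
split => // e e0; have e2 : (0 < e / 2)%R by rewrite divr_gt0.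
pose D n := \bigcup_i F i `\` S n.
have mD n : measurable (D n) by apply: measurableD => //; case: (HS n).
have [n Hn] : exists n, tau (D n) <= (e / 2)%:E.
  apply: contrapT => /forallNP N.
  have c : tau \o D @ \oo --> tau (\bigcap_n D n).
    apply: nonincreasing_cvg_mu => //; [exact: taufin|exact: bigcapT_measurable|].
    move=> a b ab; apply/subsetPset; apply: setDS.
    rewrite !SE => x [i /= ia Fx]; exists i => //=; exact: leq_trans ab.
  have z : \bigcap_n D n = set0.
    apply/seteqP; split => // x Hx.
    have [[i _ Fi] _] := Hx 0%N Logic.I; have [_] := Hx i.+1 Logic.I; apply.
    by rewrite SE; exists i => /=.
  rewrite z measure0 in c.
  have : (e / 2)%:E <= limn (tau \o D).
    apply: lime_ge; first by apply/cvg_ex; exists 0.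
    by apply: nearW => k; move: (N k) => /negP; rewrite -ltNge => /ltW.
  rewrite (cvg_lim _ c) // lee_fin; lra.
have [mS /(_ _ e2)[E GE hE]] := HS n; have mE := mG GE.
exists E => //.
have a1 : tau (\bigcup_i F i `\` E) <= tau (D n) + tau (S n `\` E).
  apply: le_trans (measureU2 _ _ _) => //; last exact: measurableD.
  apply: le_measure; rewrite ?inE; try (by do ?[apply: measurableD|apply: measurableU]).
  move=> x [Fx NE]; have [Sx|NS] := pselect (S n x); [right|left]; split => //.
have a2 : tau (E `\` \bigcup_i F i) <= tau (E `\` S n).
  apply: le_measure; rewrite ?inE; try (by do ?[apply: measurableD|apply: measurableU]).
  by apply: setDS; rewrite SE => x [i _ Fx]; exists i.
apply: (le_trans (leeD a1 a2)); rewrite -addeA [e]splitr EFinD leeD //.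
Qed.

(* Every measurable set is approximated by [G] for the measure [m1 + m2]. *)
Lemma le_measure_algebra A : <<s G >> A -> m1 A <= m2 A.
Proof.
move=> sA; have [mA hA] : H A.
  move: A sA; apply: smallest_sub.
    split=> //; first by move=> A HA; rewrite setTD; exact: HC.
  move=> A GA; split; first exact: mG.
  by move=> e e0; exists A => //; rewrite setDv measure0 adde0 lee_fin ltW.
apply/lee_addgt0Pr => e e0.
have [E GE hE] := hA _ e0; have mE := mG GE.
have b1 : m1 A <= m1 E + tau (A `\` E).
  apply: (@le_trans _ _ (m1 E + m1 (A `\` E))); last first.
    by rewrite leeD2l // tau1 //; exact: measurableD.
  apply: le_trans (measureU2 _ _ _) => //; last exact: measurableD.
  apply: le_measure; rewrite ?inE //; first by apply: measurableU => //; exact: measurableD.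
  by move=> x Ax; have [?|?] := pselect (E x); [left|right].
have b2 : m2 E <= m2 A + tau (E `\` A).
  apply: (@le_trans _ _ (m2 A + m2 (E `\` A))); last first.
    by rewrite leeD2l // tau2 //; exact: measurableD.
  apply: le_trans (measureU2 _ _ _) => //; last exact: measurableD.
  apply: le_measure; rewrite ?inE //; first by apply: measurableU => //; exact: measurableD.
  by move=> x Ax; have [?|?] := pselect (A x); [left|right].
apply: (le_trans b1); apply: (le_trans (leeD2r _ (le_trans (m12 GE) b2))).
by rewrite -addeA leeD2l // addeC.
Qed.
End le_measure_algebra.

Lemma le_integral_mrestr (dT : measure_display) (T : measurableType dT) (R : realType)
  (mu : {measure set T -> \bar R}) (B : set T) (mB : measurable B) (g : T -> \bar R) :
  measurable_fun setT g -> (forall x, 0 <= g x)%E ->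
  (\int[mrestr mu mB]_x g x <= \int[mu]_x (g x * (\1_B x)%:E))%E.
Proof.
move=> mg g0.
have mg1 : measurable_fun setT (fun x => g x * (\1_B x)%:E)%E.
  by apply: emeasurable_funM => //; apply/measurable_EFinP; exact: measurable_indic.
have g10 x : (0 <= g x * (\1_B x)%:E)%E by rewrite mule_ge0 // lee_fin.
have -> : (\int[mrestr mu mB]_x g x = \int[mrestr mu mB]_x (g x * (\1_B x)%:E))%E.
  apply: ge0_ae_eq_integral => //.
  exists (~` B); split; first exact: measurableC.
    by transitivity (mu (~` B `&` B)) => //; rewrite setICl measure0.
  move=> x /= N; apply: contra_not N => Bx _.
  by rewrite indicE mem_set // mule1.
apply: ge0_le_measure_integral => // S mS.
by rewrite /mrestr; apply: le_measure; rewrite ?inE //; first [exact: measurableI|exact: subIsetl].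
Qed.

(** * A lower bound for the image of Lebesgue measure under a locally Lipschitz surjection *)

Section lipschitz_image.
Context {R : realType} {d : nat}.
Local Notation T := (rVb R d).
Local Notation muV := (@muV R d).
Local Notation dy := (@dyad R d).

Let dyadS n x y : dy n.+1 x = dy n.+1 y -> dy n x = dy n y.
Proof.
move=> e; apply/rowP => i; move/rowP/(_ i): e; rewrite !mxE.
rewrite exprS -!mulrA.
move: (2 ^+ n * x 0 i) (2 ^+ n * y 0 i) => z w e.
have H (z' w' : R) : Num.floor (2 * z') = Num.floor (2 * w') -> Num.floor z' <= Num.floor w'.
  move=> e'; rewrite floor_ge_int.
  have /andP[a1 a2] := floor_itv z'.
  have : (2 * Num.floor z' <= Num.floor (2 * z'))%R.
    by rewrite floor_ge_int intrM ler_pM2l.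
  rewrite e' floor_ge_int intrM ler_pM2l //.
by apply/eqP; rewrite eq_le !H.
Qed.

Let dyad_mono m n x y : (n <= m)%N -> dy m x = dy m y -> dy n x = dy n y.
Proof.
move=> /subnK <-; elim: (m - n)%N => //= k IH e; apply: IH; apply: dyadS.
by rewrite addSn in e.
Qed.

Let G : set (set T) := [set A | exists n S, A = dy n @^-1` S].

Let G_refine n m S : (n <= m)%N -> exists S', dy n @^-1` S = dy m @^-1` S'.
Proof.
move=> nm; exists (dy m @` (dy n @^-1` S)).
apply/seteqP; split=> x /= H; first by exists x.
by case: H => y Sy e; rewrite /preimage /= -(dyad_mono nm e).
Qed.

Let mdyad n S : measurable (dy n @^-1` S : set T).
Proof. exact: (@measurable_dyad_comp R d _ T id n S (@measurable_coord R d)). Qed.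

Variables (F : T -> T) (B E : set T) (L e : R).
Hypothesis mF : measurable_fun setT F.
Hypothesis mB : measurable B.
Hypothesis mE : measurable E.
Hypothesis Bfin : (muV B < +oo)%E.
Hypothesis Efin : (muV E < +oo)%E.
Hypothesis L0 : 0 < L.
Hypothesis e0 : 0 < e.
(** Further preimages only add mass, so a lower bound requires one good preimage of each target. The
    targets run over a neighbourhood of [E] because the centre of a cube meeting [E] may lie outside
    it. *)
Hypothesis HF : forall y : 'rV[R]_d, (exists2 z : 'rV[R]_d, E z & `|y - z| <= e) ->
  exists2 p : 'rV[R]_d, F p = y & forall p' : 'rV[R]_d, `|p' - p| <= e ->
    B p' /\ `|(F p' : 'rV[R]_d) - y| <= L * `|p' - p|.

Let c : R := (2 * L) ^+ d.
Let c0 : 0 <= c. Proof. by rewrite exprn_ge0 // mulr_ge0 // ltW. Qed.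
Let c0' : {nonneg R} := NngNum c0.
Let m1 : {measure set T -> \bar R} := mrestr muV mE.
Let pushF : {measure set T -> \bar R} :=
  measure_function_pushforward__canonical__measure_function_Measure (mrestr muV mB) mF.
Let m2 : {measure set T -> \bar R} := mscale c0' pushF.

Let m1E A : m1 A = muV (A `&` E). Proof. by []. Qed.
Let m2E A : m2 A = (c%:E * muV (F @^-1` A `&` B))%E. Proof. by []. Qed.

Let dyad_in m (s : 'rV[int]_d) (y : 'rV[R]_d) :
  (forall i, (s 0 i)%:~R <= 2 ^+ m * y 0 i < (s 0 i)%:~R + 1) -> dy m y = s.
Proof.
move=> H; apply/rowP => i; rewrite mxE; apply: floor_def.
by rewrite intrD; exact: H.
Qed.

Let center m (s : 'rV[int]_d) : 'rV[R]_d := \row_i (2 ^- m * ((s 0 i)%:~R + 2^-1)).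

Let dyad_center m s x : dy m x = s -> `|x - center m s| <= 2 ^- m / 2.
Proof.
move=> sE; apply: coord_le_mxnorm => [|i]; first by rewrite divr_ge0 ?invr_ge0 ?exprn_ge0.
have := floor_itv (2 ^+ m * x 0 i).
move/rowP/(_ i): sE; rewrite !mxE => ->; rewrite intrD => /andP[a1 a2].
have p : (0 : R) < 2 ^+ m by rewrite exprn_gt0.
rewrite -(ler_pM2l p) -{1}(gtr0_norm p) -normrM mulrBr !mulrA mulfV ?gt_eqF // !mul1r.
by rewrite ler_norml; apply/andP; split; lra.
Qed.

(* A dyadic cube meeting [E] contains the image of a sup-norm ball of comparable
   side inside [B]: this replaces a change of variables. *)
Let cube_le m s : 2 ^- m <= e -> 2 ^- m <= 4 * L * e -> dy m @^-1` [set s] `&` E !=set0 ->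
  (muV (dy m @^-1` [set s]) <= m2 (dy m @^-1` [set s]))%E.
Proof.
move=> me mLe [z [/= sz Ez]].
have p2 : (0 : R) < 2 ^- m by rewrite invr_gt0 exprn_gt0.
have [|p Fp Hp] := HF (y := center m s).
  exists z => //; rewrite distrC (le_trans (dyad_center sz)) //.
  by rewrite (le_trans _ me) // ler_piMr ?(ltW p2) //; lra.
have alg1 (u : R) : L * (u / (4 * L)) = u / 4 by field; rewrite gt_eqF.
have alg2 (u : R) : 2 * L * (2 * (u / (4 * L))) = u by field; rewrite gt_eqF.
(* With side a = 2^-m, the ball of radius a / (4 L) is mapped within a / 4 of the centre, safely
   inside the half-open cube of half-side a / 2. Its volume is (a / (2 L))^d, whence the factor
   [c = (2 * L) ^+ d]. *)
pose rho := 2 ^- m / (4 * L).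
have rho0 : 0 <= rho by rewrite divr_ge0 ?(ltW p2) // mulr_ge0 // ltW.
have rhoe : rho <= e by rewrite ler_pdivrMr ?mulr_gt0 // mulrC.
have sub : cbox p rho `<=` F @^-1` (dy m @^-1` [set s]) `&` B.
  move=> x Hx; have [Bx Fx] := Hp x (le_trans Hx rhoe); split => //=.
  apply: dyad_in => i.
  have pm : (0 : R) < 2 ^+ m by rewrite exprn_gt0.
  have : `|(F x : 'rV[R]_d) 0 i - center m s 0 i| <= 2 ^- m / 4.
    have := coord_mxnorm ((F x : 'rV[R]_d) - center m s) i; rewrite !mxE => h.
    apply: (le_trans h); apply: (le_trans Fx).
    apply: (@le_trans _ _ (L * rho)); first by rewrite ler_pM2l.
    by rewrite (alg1 _).
  rewrite -(ler_pM2l pm) -{1}(gtr0_norm pm) -normrM mulrBr !mxE !mulrA mulfV ?gt_eqF // !mul1r.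
  by rewrite ler_norml => /andP[? ?]; apply/andP; split; lra.
have le1 : (muV (dy m @^-1` [set s]) <= ((2 ^- m) ^+ d)%:E)%E.
  have := @muV_cbox R d (center m s) (2 ^- m / 2).
  rewrite [(2 * _)%R]mulrC divfK // => <-; last by rewrite divr_ge0 // ltW.
  apply: le_measure; rewrite ?inE; [exact: mdyad|exact: measurable_cbox|].
  by move=> x /= /dyad_center.
have mP : measurable (F @^-1` (dy m @^-1` [set s])).
  by rewrite -[X in measurable X]setTI; apply: mF => //; exact: mdyad.
apply: (le_trans le1).
apply: (@le_trans _ _ (c%:E * muV (cbox p rho))%E).
  rewrite muV_cbox // -EFinM lee_fin /c -exprMn /rho.
  by rewrite (alg2 _).
rewrite m2E lee_wpmul2l ?lee_fin //.
by apply: le_measure; rewrite ?inE //; [exact: measurable_cbox|exact: measurableI].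
Qed.

(** The set is cut at a level [m] fine enough for [cube_le]. Only the cubes meeting [E] are kept,
    since the comparison holds for those alone; they cover the part inside [E] and are enumerated
    through the countability of integer vectors. *)
Let le_dyad A : G A -> (m1 A <= m2 A)%E.
Proof.
move=> [n [S ->]].
have [m [nm me mLe]] : exists m, [/\ (n <= m)%N, 2 ^- m <= e & 2 ^- m <= 4 * L * e].
  have e'0 : 0 < Num.min e (4 * L * e) by rewrite lt_min e0 !mulr_gt0.
  have [N _ HN] := near_infty_natSinv_expn_lt (PosNum e'0).
  exists (maxn n N); have := HN (maxn n N) (leq_maxr _ _).
  by rewrite /= div1r lt_min => /andP[? ?]; split; [exact: leq_maxl|exact: ltW|exact: ltW].
have [S' ->] := G_refine S nm.
pose W (s : 'rV[int]_d) : set T := if `[< S' s /\ dy m @^-1` [set s] `&` E !=set0 >]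
  then dy m @^-1` [set s] else set0.
pose W' k : set T := if pickle_inv k is Some s then W s else set0.
have mW s : measurable (W s) by rewrite /W; case: ifP => _ //; exact: mdyad.
have mW' k : measurable (W' k) by rewrite /W'; case: (pickle_inv k).
have tW' : trivIset setT W'.
  have W'P i x : W' i x -> i = pickle (dy m x).
    rewrite /W'; case ei: (pickle_inv i) => [s|] //; rewrite /W; case: ifP => // _ /= ->.
    by have := @pickle_invK 'rV[int]_d i; rewrite ei.
  by move=> i j _ _ [x [/W'P -> /W'P ->]].
have WU : \bigcup_k W' k `<=` dy m @^-1` S'.
  move=> x [k _]; rewrite /W'; case: (pickle_inv k) => // s; rewrite /W.
  by case: asboolP => // -[Ss _] /= ->.
have WE : dy m @^-1` S' `&` E `<=` \bigcup_k W' k.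
  move=> x [Sx Ex]; exists (pickle (dy m x)) => //; rewrite /W' pickleK_inv /W.
  by case: asboolP => // N; exfalso; apply: N; split => //; exists x.
have mWU : measurable (\bigcup_k W' k) by exact: bigcupT_measurable.
rewrite m1E; apply: (@le_trans _ _ (muV (\bigcup_k W' k))).
  by apply: le_measure; rewrite ?inE //; apply: measurableI => //; exact: mdyad.
apply: (@le_trans _ _ (m2 (\bigcup_k W' k))); last first.
  by apply: le_measure; rewrite ?inE //; exact: mdyad.
rewrite !measure_semi_bigcup //; apply: lee_nneseries => // k _.
rewrite /W'; case: (pickle_inv k) => [s|]; last by rewrite !measure0.
rewrite /W; case: asboolP => [[_ h]|_]; last by rewrite !measure0.
exact: cube_le.
Qed.

Lemma lipschitz_image_le (A : set T) : measurable A -> (m1 A <= m2 A)%E.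
Proof.
move=> mA; apply: (@le_measure_algebra _ T R m1 m2 G).
- by rewrite m1E setTI.
- by rewrite m2E preimage_setT setTI lte_mul_pinfty // lee_fin.
- by exists 0%N, set0; rewrite preimage_set0.
- by move=> _ [n [S ->]]; exists n, (~` S); rewrite preimage_setC.
- move=> _ _ [n [S ->]] [k [S2 ->]].
  have [S' ->] := G_refine S (leq_maxl n k).
  have [S2' ->] := G_refine S2 (leq_maxr n k).
  by exists (maxn n k), (S' `|` S2'); rewrite preimage_setU.
- by move=> _ [n [S ->]]; exact: mdyad.
- exact: le_dyad.
move: A mA; apply: smallest_sub; first exact: smallest_sigma_algebra.
move=> A oA; rewrite (open_dyadE oA); apply: sigma_algebra_bigcup => n.
by apply: sub_sigma_algebra; exists n; eexists; reflexivity.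
Qed.

Lemma lipschitz_image_integral (g : T -> \bar R) : measurable_fun setT g ->
  (forall x, 0 <= g x)%E ->
  (\int[mrestr muV mE]_x g x <= c%:E * \int[muV]_p (g (F p) * (\1_B p)%:E))%E.
Proof.
move=> mg g0.
apply: (@le_trans _ _ (\int[m2]_x g x)%E).
  by apply: ge0_le_measure_integral => // A mA; exact: lipschitz_image_le.
rewrite ge0_integral_mscale //= lee_wpmul2l ?lee_fin //.
rewrite ge0_integral_pushforward //.
rewrite preimage_setT.
apply: (le_integral_mrestr (g := g \o F) muV mB) => [|x]; last exact: g0.
exact: measurableT_comp mg mF.
Qed.
End lipschitz_image.

(** * The HMC kernel and its invariant measure *)

Section iint_facts.
Context {R : realType} {d : nat}.
Local Notation E := (rVb R d).
Local Open Scope ereal_scope.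
Implicit Types (f g : E -> \bar R).

Lemma iint_ge0 f : (forall x, 0 <= f x) -> 0 <= iint f.
Proof. move=> f0; exact: iint_aux_ge0. Qed.

Lemma iintD f g : measurable_fun [set: E] f -> measurable_fun [set: E] g ->
  (forall x, 0 <= f x) -> (forall x, 0 <= g x) -> iint (fun x => f x + g x) = iint f + iint g.
Proof. move=> mf mg f0 g0; exact: iint_auxD. Qed.

Lemma iintZ (k : R) f : measurable_fun [set: E] f -> (forall x, 0 <= f x) -> (0 <= k)%R ->
  iint (fun x => k%:E * f x) = k%:E * iint f.
Proof. move=> mf f0 k0; exact: iint_auxZ. Qed.

Lemma le_iint f g : measurable_fun [set: E] f -> measurable_fun [set: E] g ->
  (forall x, 0 <= f x) -> (forall x, f x <= g x) -> iint f <= iint g.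
Proof. move=> mf mg f0 fg; exact: le_iint_aux. Qed.

Lemma eq_iint f g : (forall x, f x = g x) -> iint f = iint g.
Proof. by move=> /funext ->. Qed.
End iint_facts.

Section phase_space.
Context {R : realType} {d : nat}.
Local Notation E := (rVb R d).
Local Notation M2 G := (measurable_fun [set: E * E] (G : E * E -> \bar R)).
Local Open Scope ereal_scope.
Implicit Types (G : E * E -> \bar R).

Definition iint2 G : \bar R := iint (fun q : E => iint (fun p : E => G (q, p))).

Lemma measurable_slice G (q : E) : M2 G -> measurable_fun [set: E] (fun p => G (q, p)).
Proof. by move=> mG; apply: measurableT_comp => //; exact: pair1_measurable. Qed.

Lemma iint2D G1 G2 : M2 G1 -> M2 G2 -> (forall z, 0 <= G1 z) -> (forall z, 0 <= G2 z) ->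
  iint2 (fun z => G1 z + G2 z) = iint2 G1 + iint2 G2.
Proof.
move=> m1 m2 p1 p2; rewrite /iint2 -iintD.
- by apply: eq_iint => q; rewrite iintD //; exact: measurable_slice.
- exact: measurable_iint_param.
- exact: measurable_iint_param.
- by move=> q; exact: iint_ge0.
- by move=> q; exact: iint_ge0.
Qed.

Lemma eq_iint2 G1 G2 : (forall z, G1 z = G2 z) -> iint2 G1 = iint2 G2.
Proof. by move=> /funext ->. Qed.
End phase_space.

Section leapfrog_measurable.
Context {R : realType} {d : nat}.
Variables (U : 'rV[R]_d -> R).
Hypothesis U3 : isC3 U.
Local Notation E := (rVb R d).

Lemma measurable_U : measurable_fun [set: E] (U : E -> R).
Proof. by apply: measurable_continuous; case: U3. Qed.

Section comp.
Context {d1 : measure_display} {S : measurableType d1}.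
Implicit Types f g : S -> E.

Lemma measurable_addV f g : measurable_fun setT f -> measurable_fun setT g ->
  measurable_fun setT (fun t => (f t : 'rV[R]_d) + g t : E).
Proof.
move=> mf mg; apply: measurable_rVb => i; under eq_fun do rewrite mxE.
by apply: measurable_funD; exact: (measurableT_comp (measurable_coord i)).
Qed.

Lemma measurable_scaleV (c : R) f : measurable_fun setT f ->
  measurable_fun setT (fun t => c *: (f t : 'rV[R]_d) : E).
Proof.
move=> mf; apply: measurable_rVb => i; under eq_fun do rewrite mxE.
by apply: measurable_funM; [exact: measurable_cst|exact: (measurableT_comp (measurable_coord i))].
Qed.

Lemma measurable_grad f : measurable_fun setT f -> measurable_fun setT (fun t => grad U (f t) : E).
Proof.
move=> mf; apply: measurable_rVb => i; under eq_fun do rewrite mxE.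
apply: (@measurableT_comp _ _ _ _ _ _ (partial i U : E -> R)) => //.
by apply: measurable_continuous; case: U3 => _ [_ [+ _]]; exact.
Qed.

Definition measurable_phase (w : S -> 'rV[R]_d * 'rV[R]_d) :=
  measurable_fun setT (fun t => (w t).1 : E) /\ measurable_fun setT (fun t => (w t).2 : E).

Lemma measurable_Psi1 h w : measurable_phase w -> measurable_phase (fun t => Psi1 U h (w t)).
Proof.
move=> [m1 m2]; split; first exact: m1.
rewrite /Psi1 /=; under eq_fun do rewrite -scaleNr.
apply: measurable_addV => //; apply: measurable_scaleV; exact: measurable_grad.
Qed.

Lemma measurable_Psi2 h w : measurable_phase w -> measurable_phase (fun t => Psi2 h (w t)).
Proof.
move=> [m1 m2]; split; last exact: m2.
by apply: measurable_addV => //; exact: measurable_scaleV.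
Qed.

Lemma measurable_leapfrogT h T w : measurable_phase w -> measurable_phase (fun t => leapfrogT U h T (w t)).
Proof.
move=> mw; rewrite /leapfrogT; elim: T => //= T IH; rewrite /leapfrog.
by apply: measurable_Psi1; apply: measurable_Psi2; exact: measurable_Psi1.
Qed.

Lemma measurable_Ham w : measurable_phase w -> measurable_fun setT (fun t => Ham U (w t)).
Proof.
move=> [m1 m2]; apply: measurable_funD; first exact: (measurableT_comp measurable_U).
by apply: measurable_funM; [exact: measurable_dotv|exact: measurable_cst].
Qed.

Lemma measurable_accept w w' : measurable_phase w -> measurable_phase w' ->
  measurable_fun setT (fun t => accept U (w t) (w' t)).
Proof.
move=> mw mw'; apply: measurable_minr; first exact: measurable_cst.
by apply: measurableT_comp => //; apply: measurable_funB; exact: measurable_Ham.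
Qed.
End comp.

Lemma phase_id : measurable_phase (fun z : E * E => (z : 'rV[R]_d * 'rV[R]_d)).
Proof. by split; [exact: measurable_fst|exact: measurable_snd]. Qed.

Lemma accept_gt0 w w' : 0 < accept U w w'.
Proof. by rewrite lt_min ltr01 expR_gt0. Qed.

Lemma accept_le1 w w' : accept U w w' <= 1.
Proof. by rewrite ge_min lexx. Qed.
End leapfrog_measurable.

(** * Volume preservation and time reversal of the leapfrog map *)

Section volume.
Context {R : realType} {d : nat}.
Variables (U : 'rV[R]_d -> R) (h : R).
Hypothesis U3 : isC3 U.
Local Notation E := (rVb R d).
Local Notation M2 G := (measurable_fun [set: E * E] (G : E * E -> \bar R)).
Local Notation nng G := (forall z, (0 <= G z)%E).
Implicit Types (G : E * E -> \bar R).

Definition flip (z : 'rV[R]_d * 'rV[R]_d) : 'rV[R]_d * 'rV[R]_d := (z.1, - z.2).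

Lemma measurable_comp_phase (d1 : measure_display) (S : measurableType d1) G (w : S -> 'rV[R]_d * 'rV[R]_d) :
  M2 G -> measurable_phase w -> measurable_fun setT (fun t => G (w t)).
Proof.
move=> mG [m1 m2].
rewrite (_ : (fun t => _) = G \o (fun t => ((w t).1 : E, (w t).2 : E))).
  exact: (measurableT_comp mG (measurable_fun_pair m1 m2)).
by apply/funext => t /=; case: (w t).
Qed.

Lemma iint2_Psi1 G : M2 G -> nng G -> iint2 (fun z => G (Psi1 U h z)) = iint2 G.
Proof.
move=> mG G0; apply: eq_iint => q; rewrite /Psi1 /=.
apply: (@iint_shift R d (fun p => G (q, p))) => //; exact: measurable_slice.
Qed.

Lemma iint2_flip G : M2 G -> nng G -> iint2 (fun z => G (flip z)) = iint2 G.
Proof.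
move=> mG G0; apply: eq_iint => q; rewrite /flip /=.
apply: (@iint_opp R d (fun p => G (q, p))) => //; exact: measurable_slice.
Qed.

(** The position update is a translation of q for fixed p, so the order of integration is exchanged
    first. *)
Lemma iint2_Psi2 G : M2 G -> nng G -> iint2 (fun z => G (Psi2 h z)) = iint2 G.
Proof.
move=> mG G0; rewrite /iint2 (@iint_swap R d G) // (@iint_swap R d (fun z : E * E => G (Psi2 h z))) //; last first.
  by apply: measurable_comp_phase => //; apply: measurable_Psi2; exact: phase_id.
apply: eq_iint => p; rewrite /Psi2 /=.
apply: (@iint_shift R d (fun q => G (q, p))) => //.
exact: (measurableT_comp mG (@pair2_measurable _ _ E E p)).
Qed.

Lemma iint2_leapfrogT T G : M2 G -> nng G -> iint2 (fun z => G (leapfrogT U h T z)) = iint2 G.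
Proof.
move=> mG G0; elim: T => // T IH; rewrite -IH.
have m1 : M2 (fun z => G (leapfrogT U h T z)).
  by apply: measurable_comp_phase => //; apply: measurable_leapfrogT => //; exact: phase_id.
have mG' w : @measurable_phase R d _ (E * E)%type w -> M2 (fun z => G (leapfrogT U h T (w z))).
  by move=> mw; apply: measurable_comp_phase => //; exact: measurable_leapfrogT.
rewrite (eq_iint2 (G2 := fun z => G (leapfrogT U h T (Psi1 U h (Psi2 h (Psi1 U h z)))))); last first.
  by move=> z; rewrite /leapfrogT iterSr.
rewrite (@iint2_Psi1 (fun z => G (leapfrogT U h T (Psi1 U h (Psi2 h z))))) //; last first.
  by apply: mG'; apply: measurable_Psi1 => //; apply: measurable_Psi2; exact: phase_id.
rewrite (@iint2_Psi2 (fun z => G (leapfrogT U h T (Psi1 U h z)))) //; last first.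
  by apply: mG'; apply: measurable_Psi1 => //; exact: phase_id.
by rewrite (@iint2_Psi1 (fun z => G (leapfrogT U h T z))).
Qed.

(** The scheme is palindromic: with the momentum reversed, the second half-kick of the forward step
    becomes the first of the backward one, evaluated at the same position, and each substep undoes
    its mirror image. *)
Lemma leapfrog_flip z : leapfrog U h (flip (leapfrog U h z)) = flip z.
Proof.
case: z => q p; rewrite /leapfrog /flip /Psi1 /Psi2 /=.
set a := p - _ *: _.
have xE (y : 'rV[R]_d) : q + h *: a + h *: (- (a - (h / 2) *: y) - (h / 2) *: y) = q.
  by apply/rowP => j; move: a => a; rewrite !mxE; ring.
rewrite xE; congr (_, _); rewrite /a.
move: (grad U q) (grad U _) => y y'.
by apply/rowP => j; rewrite !mxE; ring.
Qed.

Lemma leapfrogT_flip T z : leapfrogT U h T (flip (leapfrogT U h T z)) = flip z.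
Proof.
elim: T z => // T IH z.
by rewrite /leapfrogT iterSr iterS leapfrog_flip; exact: IH.
Qed.
End volume.

(** * The kernel as a positive operator, and its invariant density *)

Section hmc_operator.
Context {R : realType} {d : nat}.
Variables (U : 'rV[R]_d -> R) (h : R) (T : nat).
Hypothesis U3 : isC3 U.
Local Notation E := (rVb R d).
Local Notation mr f := (measurable_fun [set: E] (f : E -> R)).
Local Notation nn f := (forall x, 0 <= f x).
Implicit Types (f g : 'rV[R]_d -> R) (q p : 'rV[R]_d).

Definition endpoint q p := (leapfrogT U h T (q, p)).1.
Definition acc q p := accept U (q, p) (leapfrogT U h T (q, p)).
(** Accepted and rejected moves under a single integral over p. Linearity and monotonicity of the
    kernel then reduce to pointwise facts about this integrand. *)
Definition hmck f q p := f (endpoint q p) * (acc q p * gauss p) + f q * ((1 - acc q p) * gauss p).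
Local Notation P f := (hmcP U h T (fun y => (f y)%:E)).

Lemma measurable_endpoint2 : measurable_fun [set: E * E] (fun z : E * E => endpoint z.1 z.2 : E).
Proof.
have [m1 _] := @measurable_leapfrogT R d U U3 _ (E * E)%type h T _ phase_id.
by apply: eq_measurable_fun m1 => z _; rewrite /endpoint; case: z.
Qed.

Lemma measurable_acc2 : measurable_fun [set: E * E] (fun z : E * E => acc z.1 z.2).
Proof.
have m1 := @measurable_leapfrogT R d U U3 _ (E * E)%type h T _ phase_id.
have := measurable_accept U3 phase_id m1.
by apply: eq_measurable_fun => z _; rewrite /acc; case: z.
Qed.

Lemma acc_gt0 q p : 0 < acc q p. Proof. exact: accept_gt0. Qed.
Lemma acc_le1 q p : acc q p <= 1. Proof. exact: accept_le1. Qed.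

Lemma measurable_gauss2 : measurable_fun [set: E * E] (fun z : E * E => gauss (z.2 : 'rV[R]_d)).
Proof. exact: (measurableT_comp measurable_gauss measurable_snd). Qed.

Lemma measurable_hmck_accept f : mr f ->
  measurable_fun [set: E * E] (fun z : E * E => f (endpoint z.1 z.2) * (acc z.1 z.2 * gauss (z.2 : 'rV[R]_d))).
Proof.
move=> mf; apply: measurable_funM; first exact: (measurableT_comp mf measurable_endpoint2).
by apply: measurable_funM; [exact: measurable_acc2|exact: measurable_gauss2].
Qed.

Lemma measurable_hmck_reject f : mr f ->
  measurable_fun [set: E * E] (fun z : E * E => f z.1 * ((1 - acc z.1 z.2) * gauss (z.2 : 'rV[R]_d))).
Proof.
move=> mf; apply: measurable_funM; first exact: (measurableT_comp mf measurable_fst).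
apply: measurable_funM; last exact: measurable_gauss2.
by apply: measurable_funB; [exact: measurable_cst|exact: measurable_acc2].
Qed.

Lemma measurable_hmck f : mr f -> measurable_fun [set: E * E] (fun z : E * E => hmck f z.1 z.2).
Proof.
by move=> mf; apply: measurable_funD; [exact: measurable_hmck_accept|exact: measurable_hmck_reject].
Qed.

Lemma measurable_section (F : E * E -> R) q : measurable_fun setT F ->
  measurable_fun [set: E] (fun p : E => (F (q, p))%:E).
Proof.
by move=> mF; apply/measurable_EFinP; exact: (measurableT_comp mF (@pair1_measurable _ _ E E q)).
Qed.

Lemma accg_ge0 q p : 0 <= acc q p * gauss p.
Proof. by rewrite mulr_ge0 ?gauss_ge0 // ltW // acc_gt0. Qed.

Lemma rejg_ge0 q p : 0 <= (1 - acc q p) * gauss p.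
Proof. by rewrite mulr_ge0 ?gauss_ge0 // subr_ge0 acc_le1. Qed.

Lemma hmck_ge0 f q p : nn f -> 0 <= hmck f q p.
Proof. by move=> f0; rewrite addr_ge0 // mulr_ge0 // ?accg_ge0 ?rejg_ge0. Qed.

Lemma hmcPE f q : mr f -> nn f -> P f q = iint (fun p => (hmck f q p)%:E).
Proof.
move=> mf f0; rewrite /hmcP -[LHS]/(_ + _)%E.
have mrej := @measurable_section _ q (@measurable_hmck_reject (fun=> 1) (measurable_cst _)).
rewrite [X in (_ + X)%E](_ : _ = iint (fun p => (f q * ((1 - acc q p) * gauss p))%:E)); last first.
  rewrite -iintZ //.
  - by apply: eq_measurable_fun mrej => p _; rewrite mul1r.
  - by move=> p; rewrite lee_fin rejg_ge0.
rewrite -iintD.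
- by apply: eq_iint => p; rewrite -!EFinM -EFinD.
- by under eq_fun do rewrite -EFinM; exact: (@measurable_section _ q (measurable_hmck_accept mf)).
- exact: (@measurable_section _ q (measurable_hmck_reject mf)).
- by move=> p; rewrite -EFinM lee_fin mulr_ge0 // accg_ge0.
- by move=> p; rewrite lee_fin mulr_ge0 // rejg_ge0.
Qed.

Lemma measurable_hmcP f : mr f -> nn f -> measurable_fun [set: E] (P f : E -> \bar R).
Proof.
move=> mf f0.
apply: (eq_measurable_fun (fun q : E => iint (fun p : E => (hmck f q p)%:E))).
  by move=> q _; rewrite hmcPE.
apply: (@measurable_iint_param R d (fun z : E * E => (hmck f z.1 z.2)%:E)).
  by apply/measurable_EFinP; exact: measurable_hmck.
by move=> z; rewrite lee_fin hmck_ge0.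
Qed.

Lemma hmcP_ge0 f q : mr f -> nn f -> (0 <= P f q)%E.
Proof. by move=> mf f0; rewrite hmcPE //; apply: iint_ge0 => p; rewrite lee_fin hmck_ge0. Qed.

Lemma measurable_hmck1 f q : mr f -> measurable_fun [set: E] (fun p : E => (hmck f q p)%:E).
Proof. by move=> mf; exact: (@measurable_section _ q (measurable_hmck mf)). Qed.

Lemma hmcPD f g q : mr f -> mr g -> nn f -> nn g -> P (fun x => f x + g x) q = (P f q + P g q)%E.
Proof.
move=> mf mg f0 g0; rewrite !hmcPE //.
- rewrite -iintD; try (by move=> p; rewrite lee_fin hmck_ge0); try exact: measurable_hmck1.
  by apply: eq_iint => p; rewrite -EFinD; congr EFin; rewrite /hmck; ring.
- exact: measurable_funD.
- by move=> x; rewrite addr_ge0.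
Qed.

Lemma hmcPZ c f q : 0 <= c -> mr f -> nn f -> P (fun x => c * f x) q = (c%:E * P f q)%E.
Proof.
move=> c0 mf f0; rewrite !hmcPE //.
- rewrite -iintZ //; try (by move=> p; rewrite lee_fin hmck_ge0); try exact: measurable_hmck1.
  by apply: eq_iint => p; rewrite -EFinM; congr EFin; rewrite /hmck; ring.
- by apply: measurable_funM => //; exact: measurable_cst.
- by move=> x; rewrite mulr_ge0.
Qed.

Lemma hmcP_le f g q : mr f -> mr g -> nn f -> (forall x, f x <= g x) -> (P f q <= P g q)%E.
Proof.
move=> mf mg f0 fg; have g0 x : 0 <= g x by exact: le_trans (fg x).
rewrite !hmcPE //; apply: le_iint => [||p|p]; try exact: measurable_hmck1.
  by rewrite lee_fin hmck_ge0.
by rewrite lee_fin lerD // ler_wpM2r // ?accg_ge0 ?rejg_ge0.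
Qed.

Lemma hmcP_cst (c : R) q : 0 <= c -> P (fun=> c) q = c%:E.
Proof.
move=> c0; rewrite hmcPE //.
rewrite (eq_iint (g := fun p => c%:E * (gauss p)%:E)%E); last first.
  by move=> p; rewrite -EFinM; congr EFin; rewrite /hmck; ring.
rewrite iintZ ?iint_gauss ?mule1 //; first by apply/measurable_EFinP; exact: measurable_gauss.
by move=> p; rewrite lee_fin gauss_ge0.
Qed.

Variable (c : R).
Hypothesis c0 : 0 <= c.
Let w q := c * expR (- U q).
Let om (z : E * E) := gauss (z.2 : 'rV[R]_d) * w z.1.
Let w0 q : 0 <= w q. Proof. by rewrite mulr_ge0 // expR_ge0. Qed.
Let mw : mr w.
Proof.
apply: measurable_funM; first exact: measurable_cst.
by apply: measurableT_comp => //; apply: measurable_funN; exact: measurable_U.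
Qed.

Let om_flip z : om (flip z) = om z.
Proof. by rewrite /om /flip /gauss /= dotvNl dotvNr opprK. Qed.

(** Both sides equal a constant times min(exp(- H z), exp(- H z')), which is symmetric in [z] and
    [z']. *)
Let om_accept (z z' : E * E) : om z * accept U z z' = om z' * accept U z' z.
Proof.
have omE (y : E * E) : om y = c * (Num.sqrt (2 * pi)) ^- d * expR (- Ham U y).
  rewrite /om /w /gauss /Ham opprD expRD; ring.
rewrite !omE /accept.
have [H|H] := leP (Ham U z) (Ham U z').
  rewrite (min_idPr _) ?(min_idPl _); last first.
  - by rewrite -expR0 ler_expR subr_le0.
  - by rewrite -expR0 ler_expR subr_ge0.
  rewrite mulr1 -!mulrA; congr (_ * (_ * _)); rewrite -expRD; congr expR; ring.
rewrite (min_idPl _) ?(min_idPr _); last first.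
- by rewrite -expR0 ler_expR subr_ge0 ltW.
- by rewrite -expR0 ler_expR subr_le0 ltW.
rewrite mulr1 -!mulrA; congr (_ * (_ * _)); rewrite -expRD; congr expR; ring.
Qed.

Let accept_flip (z z' : E * E) : accept U (flip z) (flip z') = accept U z z'.
Proof. by rewrite /accept /Ham /flip /= !dotvNl !dotvNr !opprK. Qed.

Let L (z : E * E) : E * E := leapfrogT U h T z.

Let mom : measurable_fun [set: E * E] om.
Proof.
apply: measurable_funM; first exact: measurable_gauss2.
exact: (measurableT_comp mw measurable_fst).
Qed.
Let om0 z : 0 <= om z. Proof. by rewrite mulr_ge0 ?gauss_ge0 ?w0. Qed.

(* Detailed balance: flip o leapfrog^T is a volume-preserving involution which
   exchanges the two sides of [om_accept]. *)
Lemma hmcP_invariant f : mr f -> nn f ->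
  iint (fun q => P f q * (w q)%:E)%E = iint (fun q => (f q * w q)%:E).
Proof.
move=> mf f0.
have mL := @measurable_leapfrogT R d U U3 _ (E * E)%type h T _ phase_id.
have macc := measurable_accept U3 phase_id mL.
pose G1 (z : E * E) := f (L z).1 * (om z * accept U z (L z)).
pose G2 (z : E * E) := f z.1 * (om z * accept U z (L z)).
pose G3 (z : E * E) := f z.1 * (om z * (1 - accept U z (L z))).
have mz1 : measurable_fun [set: E * E] (fun z => f z.1) by exact: (measurableT_comp mf measurable_fst).
have m1 : measurable_fun [set: E * E] G1.
  apply: measurable_funM; first exact: (measurableT_comp mf mL.1).
  by apply: measurable_funM; [exact: mom|exact: macc].
have m2 : measurable_fun [set: E * E] G2.
  by apply: measurable_funM => //; apply: measurable_funM; [exact: mom|exact: macc].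
have m3 : measurable_fun [set: E * E] G3.
  apply: measurable_funM => //; apply: measurable_funM; first exact: mom.
  by apply: measurable_funB; [exact: measurable_cst|exact: macc].
have a0 z z' : 0 <= om z * accept U z z' by rewrite mulr_ge0 // ltW // accept_gt0.
have a1 z z' : 0 <= om z * (1 - accept U z z') by rewrite mulr_ge0 // subr_ge0 accept_le1.
have p1 z : (0 <= (G1 z)%:E)%E by rewrite lee_fin mulr_ge0.
have p2 z : (0 <= (G2 z)%:E)%E by rewrite lee_fin mulr_ge0.
have p3 z : (0 <= (G3 z)%:E)%E by rewrite lee_fin mulr_ge0.
have E1 : iint (fun q => P f q * (w q)%:E)%E = (iint2 (fun z => (G1 z)%:E) + iint2 (fun z => (G3 z)%:E))%E.
  rewrite -iint2D //; try exact/measurable_EFinP.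
  apply: eq_iint => q; rewrite hmcPE // muleC -iintZ //; last 2 first.
  - exact: measurable_hmck1.
  - by move=> p; rewrite lee_fin hmck_ge0.
  by apply: eq_iint => p; rewrite -EFinM -EFinD; congr EFin; rewrite /hmck /G1 /G3 /om /acc /endpoint /L /=; ring.
have E2 : iint2 (fun z => (G1 z)%:E) = iint2 (fun z => (G2 z)%:E).
  rewrite -(@iint2_flip R d (fun z => (G2 z)%:E)) //; last exact/measurable_EFinP.
  rewrite -(@iint2_leapfrogT R d U h U3 T (fun z => (G2 (flip z))%:E)) //; last first.
    apply: (@measurable_comp_phase R d _ (E * E)%type (fun z => (G2 z)%:E) (fun z => flip z)); first exact/measurable_EFinP.
    split; [exact: measurable_fst|exact: (measurableT_comp measurable_opp measurable_snd)].
  apply: eq_iint2 => z; congr EFin; rewrite /G1 /G2 -/(L z).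
  have -> : L (flip (L z)) = flip z by exact: leapfrogT_flip.
  by rewrite om_flip accept_flip om_accept.
rewrite E1 E2 -iint2D //; try exact/measurable_EFinP.
apply: eq_iint => q.
rewrite (eq_iint (g := fun p => (f q * w q)%:E * (gauss p)%:E)%E); last first.
  by move=> p; rewrite -EFinM -EFinD; congr EFin; rewrite /G2 /G3 /om /=; ring.
rewrite iintZ ?iint_gauss ?mule1 //; last by rewrite mulr_ge0.
  by apply/measurable_EFinP; exact: measurable_gauss.
by move=> p; rewrite lee_fin gauss_ge0.
Qed.
End hmc_operator.

(** * From the abstract contraction to the kernel *)

Section ergodicity.
Context {R : realType} {d : nat}.
Variables (U : 'rV[R]_d -> R) (h : R) (T : nat) (V : 'rV[R]_d -> R) (lam b : R).
Hypothesis U3 : isC3 U.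
Local Notation E := (rVb R d).
Local Notation mr f := (measurable_fun [set: E] (f : E -> R)).
Local Notation nn f := (forall x, 0 <= f x).
Implicit Types (f g : 'rV[R]_d -> R) (q p : 'rV[R]_d).
Local Notation P f := (hmcP U h T (fun y => (f y)%:E)).

Let w q := (Zconst U)^-1 * expR (- U q).
Hypothesis Z0 : 0 <= Zconst U.
Hypothesis w1 : iint (fun q => (w q)%:E) = 1%E.
Hypothesis mV : mr V.
Hypothesis V1 : forall q, 1 <= V q.
Hypothesis lam01 : 0 <= lam < 1.
Hypothesis b0 : 0 < b.
Hypothesis drift : forall q, (P V q <= (lam * V q + b)%:E)%E.
Variable nu : {measure set E -> \bar R}.
Hypothesis nuV : (\int[nu]_x (V x)%:E < +oo)%E.
Hypothesis nu_pos : (0 < nu setT)%E.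
Hypothesis minor : forall f q, mr f -> nn f -> V q <= 4 * b / (1 - lam) -> (\int[nu]_x (f x)%:E <= P f q)%E.

Let V0 : nn V. Proof. by move=> x; rewrite (le_trans ler01). Qed.
Let w0 q : 0 <= w q. Proof. by rewrite mulr_ge0 ?expR_ge0 ?invr_ge0. Qed.
Let mw : mr w.
Proof.
apply: measurable_funM; first exact: measurable_cst.
by apply: measurableT_comp => //; apply: measurable_funN; exact: measurable_U.
Qed.
Let Pi f := iint (fun q => (f q * w q)%:E).

Let mfw f : mr f -> measurable_fun [set: E] (fun q : E => (f q * w q)%:E).
Proof. by move=> mf; apply/measurable_EFinP; exact: measurable_funM. Qed.
Let nfw f q : nn f -> (0 <= (f q * w q)%:E)%E.
Proof. by move=> f0; rewrite lee_fin mulr_ge0. Qed.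

Let Pi_ge0 f : nn f -> (0 <= Pi f)%E.
Proof. by move=> f0; apply: iint_ge0 => q; exact: nfw. Qed.
Let PiD f g : mr f -> mr g -> nn f -> nn g -> Pi (fun x => f x + g x) = (Pi f + Pi g)%E.
Proof.
move=> mf mg f0 g0; rewrite /Pi -iintD; try (by move=> q; exact: nfw); try exact: mfw.
by apply: eq_iint => q; rewrite -EFinD mulrDl.
Qed.
Let PiZ (c : R) f : 0 <= c -> mr f -> nn f -> Pi (fun x => c * f x) = (c%:E * Pi f)%E.
Proof.
move=> c0 mf f0; rewrite /Pi -iintZ //; try (by move=> q; exact: nfw); try exact: mfw.
by apply: eq_iint => q; rewrite -EFinM [c * (_ * _)]mulrA.
Qed.
Let Pi_le f g : mr f -> mr g -> nn f -> (forall x, f x <= g x) -> (Pi f <= Pi g)%E.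
Proof.
move=> mf mg f0 fg; apply: le_iint; try exact: mfw; first by move=> q; exact: nfw.
by move=> q; rewrite lee_fin ler_wpM2r.
Qed.
Let Pic (c : R) : 0 <= c -> Pi (fun=> c) = c%:E.
Proof.
by move=> c0; rewrite -[RHS]mule1 -w1 -iintZ //; exact/measurable_EFinP.
Qed.

Let Q f q := fine (P f q).
Let QE f q : (P f q < +oo)%E -> mr f -> nn f -> P f q = (Q f q)%:E.
Proof. by move=> fin mf f0; rewrite fineK // ge0_fin_numE // hmcP_ge0. Qed.

Let Q_ge0 f : mr f -> nn f -> nn (Q f).
Proof. by move=> mf f0 x; apply: fine_ge0; exact: hmcP_ge0. Qed.
Let mQ0 f : mr f -> nn f -> mr (Q f).
Proof.
move=> mf f0; exact: (measurableT_comp (@fine_measurable R setT measurableT) (measurable_hmcP h T U3 mf f0)).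
Qed.
Let PiQ0 f : mr f -> nn f -> (forall q, (P f q < +oo)%E) -> Pi (Q f) = Pi f.
Proof.
move=> mf f0 fin; have Z1 : 0 <= (Zconst U)^-1 by rewrite invr_ge0.
rewrite {2}/Pi -(hmcP_invariant h T U3 Z1 mf f0).
by apply: eq_iint => q; rewrite EFinM -QE.
Qed.

(* With V_n = min(V, n), integrate
   min(lam V + b, n) + (1 - lam) V 1_{V <= n} <= V_n + b and use pi(P V_n) = pi(V_n). *)
Let PiV : (Pi V < +oo)%E.
Proof.
case/andP: lam01 => l0 l1.
pose Vn (n : nat) q := Num.min (V q) n%:R.
pose Wn (n : nat) q := if V q <= n%:R then V q else 0.
have mVn n : mr (Vn n) by apply: measurable_minr => //.
have mWn n : mr (Wn n).
  apply: measurable_fun_ifT => //.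
  by apply: measurable_fun_ler => //.
have Vn0 n : nn (Vn n) by move=> x; rewrite le_min V0 ler0n.
have Wn0 n : nn (Wn n) by move=> x; rewrite /Wn; case: ifP.
have PVn n q : (P (Vn n) q <= (Num.min (lam * V q + b) n%:R)%:E)%E.
  rewrite EFin_min le_min; apply/andP; split.
    apply: le_trans (drift q); apply: hmcP_le => // x; by rewrite ge_min lexx.
  rewrite -(hmcP_cst h T U3 q (ler0n R n)); apply: hmcP_le => //.
  by move=> x; rewrite ge_min lexx orbT.
have fin n q : (P (Vn n) q < +oo)%E by rewrite (le_lt_trans (PVn n q)) // ltry.
have key n : ((1 - lam)%:E * Pi (Wn n) <= b%:E)%E.
  have H : (Pi (fun q => Q (Vn n) q + (1 - lam) * Wn n q)%R <= Pi (fun q => Vn n q + b)%R)%E.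
    apply: Pi_le.
    - apply: measurable_funD; first exact: mQ0.
      by apply: measurable_funM => //.
    - by apply: measurable_funD => //.
    - by move=> q; rewrite addr_ge0 ?Q_ge0 // mulr_ge0 // subr_ge0 ltW.
    move=> q; have := PVn n q; rewrite QE // lee_fin le_min => /andP[].
    have := V1 q; have b0' := b0.
    rewrite /Wn /Vn; case: (leP (V q) n%:R) => Vq; last by lra.
    have := ler_wpM2l l0 Vq; lra.
  have mQn := mQ0 (mVn n) (Vn0 n); have nQn := Q_ge0 (mVn n) (Vn0 n).
  have mW1 : mr (fun q => (1 - lam) * Wn n q) by exact: measurable_funM.
  have nW1 q : 0 <= (1 - lam) * Wn n q by rewrite mulr_ge0 // subr_ge0 ltW.
  have nb (x : E) : 0 <= b by exact: ltW.
  move: H; rewrite (PiD mQn mW1 nQn nW1) (PiD (mVn n) (measurable_cst b) (Vn0 n) nb).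
  rewrite PiZ ?subr_ge0 ?(ltW l1) // PiQ0 //.
  rewrite (Pic (ltW b0)) leeD2lE // ge0_fin_numE; last exact: Pi_ge0.
  apply: le_lt_trans (ltry n%:R); rewrite -(Pic (ler0n _ n)); apply: Pi_le => //.
  by move=> q; rewrite ge_min lexx orbT.
have lp : 0 < 1 - lam by rewrite subr_gt0.
have bnd n : (Pi (Wn n) <= ((1 - lam)^-1 * b)%:E)%E.
  by rewrite EFinM -lee_pdivrMl ?invr_gt0 // invrK.
apply: (@le_lt_trans _ _ ((1 - lam)^-1 * b)%:E); last exact: ltry.
have nd q : nondecreasing_seq (fun n => (Wn n q * w q)%:E).
  move=> i j ij; rewrite lee_fin ler_wpM2r // /Wn.
  case: (leP (V q) i%:R) => Vi; last by case: ifP.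
  by rewrite ifT // (le_trans Vi) // ler_nat.
have lE q : (V q * w q)%:E = limn (fun n => (Wn n q * w q)%:E).
  apply/esym/cvg_lim => //; apply: cvg_near_cst.
  exists (Num.truncn (V q)).+1 => // n /= Vn'.
  by rewrite /Wn ifT // ltW // (lt_le_trans (truncnS_gt _)) // ler_nat.
rewrite /Pi (eq_iint lE) /iint iint_aux_monotone //; last 2 first.
- by move=> n; exact: mfw.
- by move=> n q; exact: nfw.
apply: lime_le; last by apply: nearW => n; exact: bnd.
apply: ereal_nondecreasing_is_cvgn => i j ij; apply: le_iint; try exact: mfw.
- by move=> q; exact: nfw.
by move=> q; exact: nd.
Qed.

(** The cone on which all integrals in play are finite: [drift] controls P V, [PiV] the integral
    against pi, and [nuV] the integral against nu. On it [fine] loses nothing, so the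
    extended-valued operators become the real functionals of [harris_real]. *)
Let m f := [/\ mr f, nn f & exists2 c : R, 0 <= c & forall x, f x <= c * V x].

Let mcls_P f q : m f -> (P f q < +oo)%E.
Proof.
move=> [mf f0 [c c0 fc]]; apply: (@le_lt_trans _ _ (c%:E * P V q)%E).
  rewrite -hmcPZ //; apply: hmcP_le => //.
  by apply: measurable_funM => //.
apply: le_lt_trans (ltry (c * (lam * V q + b))).
by rewrite EFinM lee_wpmul2l // lee_fin.
Qed.
Let mcls_Pi f : m f -> (Pi f < +oo)%E.
Proof.
move=> [mf f0 [c c0 fc]]; apply: (@le_lt_trans _ _ (c%:E * Pi V)%E).
  rewrite -PiZ //; apply: Pi_le => //.
  by apply: measurable_funM => //.
by rewrite lte_mul_pinfty.
Qed.
Let N f := (\int[nu]_x (f x)%:E)%E.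
Let mE f : mr f -> measurable_fun [set: E] (fun x : E => (f x)%:E).
Proof. by move=> mf; exact/measurable_EFinP. Qed.
Let mcls_N f : m f -> (N f < +oo)%E.
Proof.
move=> [mf f0 [c c0 fc]]; apply: (@le_lt_trans _ _ (c%:E * N V)%E).
  rewrite /N -ge0_integralZl_EFin //; last 2 first.
  - by move=> x _; rewrite lee_fin.
  - exact: mE.
  apply: ge0_le_integral => //.
  - by move=> x _; rewrite lee_fin.
  - exact: mE.
  - by apply: measurable_funeM; exact: mE.
  - by move=> x _; rewrite -EFinM lee_fin.
by rewrite lte_mul_pinfty // integral_ge0 // => x _; rewrite lee_fin.
Qed.
Let N_ge0 f : nn f -> (0 <= N f)%E.
Proof. by move=> f0; apply: integral_ge0 => x _; rewrite lee_fin. Qed.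
Let NE f : m f -> N f = (fine (N f))%:E.
Proof. by move=> mf; rewrite fineK // ge0_fin_numE ?mcls_N //; apply: N_ge0; case: mf. Qed.
Let PiE f : m f -> Pi f = (fine (Pi f))%:E.
Proof. by move=> mf; rewrite fineK // ge0_fin_numE ?mcls_Pi //; apply: Pi_ge0; case: mf. Qed.
Let PE f q : m f -> P f q = (Q f q)%:E.
Proof. by move=> mf; rewrite QE //; [exact: mcls_P|case: mf|case: mf]. Qed.

Let mD f g : m f -> m g -> m (fun x => f x + g x).
Proof.
move=> [mf f0 [c c0 fc]] [mg g0 [c' c0' gc]]; split.
- exact: measurable_funD.
- by move=> x; rewrite addr_ge0.
by exists (c + c') => [|x]; rewrite ?addr_ge0 // mulrDl lerD.
Qed.
Let mZ (c : R) f : 0 <= c -> m f -> m (fun x => c * f x).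
Proof.
move=> c0 [mf f0 [c' c0' fc]]; split.
- by apply: measurable_funM => //.
- by move=> x; rewrite mulr_ge0.
by exists (c * c') => [|x]; rewrite ?mulr_ge0 // -mulrA ler_wpM2l.
Qed.
Let mc (c : R) : 0 <= c -> m (fun=> c).
Proof.
move=> c0; split=> //.
by exists c => // x; rewrite ler_peMr.
Qed.
Let mVV : m V.
Proof. by split=> //; exists 1 => // x; rewrite mul1r. Qed.

Let ND f g : m f -> m g -> N (fun x => f x + g x) = (N f + N g)%E.
Proof.
move=> [mf f0 _] [mg g0 _]; rewrite /N -ge0_integralD //; try (by move=> x _; rewrite lee_fin); exact: mE.
Qed.
Let QD f g q : m f -> m g -> Q (fun x => f x + g x) q = Q f q + Q g q.
Proof.
move=> mf mg; apply: EFin_inj; rewrite EFinD -!PE //; last exact: mD.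
by case: mf mg => [? ? _] [? ? _]; exact: hmcPD.
Qed.
Let QVle q : Q V q <= lam * V q + b.
Proof. by rewrite -lee_fin -PE. Qed.
Let mQ f : m f -> m (Q f).
Proof.
move=> mf; have [mf' f0 [c c0 fc]] := mf; split; [exact: mQ0|exact: Q_ge0|].
case/andP: lam01 => l0 l1.
exists (c * (lam + b)); first by rewrite mulr_ge0 // addr_ge0 // ltW.
move=> x; rewrite -lee_fin -PE //; apply: (@le_trans _ _ (c%:E * P V x)%E).
  rewrite -hmcPZ //; apply: hmcP_le => //.
  by apply: measurable_funM => //.
rewrite PE // -EFinM lee_fin -mulrA ler_wpM2l // (le_trans (QVle x)) // mulrDl lerD2l.
by rewrite ler_peMr // ltW.
Qed.

(** A signed test function bounded by V enters through its positive and negative parts, as in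
    [hmc_int] and [pi_int]. Both lie in the cone, and their difference is bounded by V, which is all
    the abstract estimate asks of the pair. *)
Lemma harris_hmc : geometrically_ergodic U h T.
Proof.
have [] := @harris_real R E 0 m Q V lam b mD mZ mc mVV mQ _ _ _ _ V1 lam01 b0 QVle
   (fun f => fine (N f)) _ _ _ _ _ (fun f => fine (Pi f)) _ _ _ _ _.
- by move=> f g x mf mg; exact: QD.
- move=> c f x c0 mf; apply: EFin_inj; rewrite EFinM -!PE //; last exact: mZ.
  by case: mf => ? ? _; exact: hmcPZ.
- by move=> c x c0; apply: EFin_inj; rewrite -PE ?hmcP_cst //; exact: mc.
- move=> f g x mf mg fg; rewrite -lee_fin -!PE //.
  by case: mf mg => [? ? _] [? ? _]; exact: hmcP_le.
- by move=> f g mf mg; rewrite ND // fineD // ge0_fin_numE ?mcls_N // N_ge0; case: mf mg => [? ? _] [? ? _].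
- move=> c f c0 mf; rewrite /N (eq_integral (fun x => c%:E * (f x)%:E)%E) //.
  rewrite ge0_integralZl_EFin //; first by rewrite fineM // ge0_fin_numE ?mcls_N // N_ge0; case: mf.
  + by case: mf => ? ? _ x _; rewrite lee_fin.
  + by apply: mE; case: mf.
- by move=> f mf f0; apply: fine_ge0; exact: N_ge0.
- have := mcls_N (mc ler01); rewrite /N integral_cst // mul1e => nfin.
  by rewrite fine_gt0 // nu_pos.
- move=> f g q mf mg fg Vq.
  (* Since f <= g the difference stays in the cone, and the one-function form of [minor] applies to
     it. *)
  have mk : m (fun x => g x - f x).
    case: mf mg => [mf f0 [c c0 fc]] [mg g0 [c' c0' gc]]; split.
    + exact: measurable_funB.
    + by move=> x; rewrite subr_ge0.
    by exists c' => // x; rewrite (le_trans _ (gc x)) // gerBl.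
  have gE : g = (fun x => f x + (g x - f x)) by apply/funext => x; rewrite addrC subrK.
  have -> : Q g q = Q f q + Q (fun x => g x - f x) q by rewrite -(QD q mf mk) -gE.
  have -> : fine (N g) = fine (N f) + fine (N (fun x => g x - f x)).
    by rewrite {1}gE (ND mf mk) fineD // ge0_fin_numE ?mcls_N // N_ge0; case: mf mk => [? ? _] [? ? _].
  have : fine (N (fun x => g x - f x)) <= Q (fun x => g x - f x) q.
    by rewrite -lee_fin -NE // -PE //; case: mk => ? ? _; exact: minor.
  lra.
- by move=> f g mf mg; case: (mf) (mg) => [? ? _] [? ? _]; rewrite PiD // fineD // ge0_fin_numE ?mcls_Pi // Pi_ge0.
- by move=> c f c0 mf; case: (mf) => ? ? _; rewrite PiZ // fineM // ge0_fin_numE ?mcls_Pi // Pi_ge0.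
- by move=> c c0; rewrite Pic.
- move=> f g mf mg fg; rewrite -lee_fin -!PiE //.
  by case: mf mg => [? ? _] [? ? _]; exact: Pi_le.
- by move=> f mf; rewrite PiQ0 //; [case: mf|case: mf|move=> q; exact: mcls_P].
move=> rho [vs [rho01 vs0 H]]; exists V; split.
  by move=> B mB; rewrite -[X in borel_rV X]setTI; exact: mV.
split=> //; exists rho, vs; split=> //; split=> // q k.
apply: ge_ereal_sup => _ [f [mf [fV ->]]].
have mf' : mr f by move=> _ B mB; rewrite setTI; exact: mf.
pose f1 x := Num.max (f x) 0; pose f2 x := Num.max (- f x) 0.
have m1 : m f1.
  split=> [|x|]; [|by rewrite le_max lexx orbT|].
    by apply: measurable_maxr => //.
  by exists 1 => // x; rewrite mul1r ge_max V0 (le_trans (ler_norm _)).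
have m2 : m f2.
  split=> [|x|]; [|by rewrite le_max lexx orbT|].
    by apply: measurable_maxr; [exact: measurable_funN|exact: measurable_cst].
  by exists 1 => // x; rewrite mul1r ge_max V0 (le_trans (ler_norm _)) // normrN.
have mi f' n : m f' -> m (iter n Q f') by move=> mf''; elim: n => //= n; exact: mQ.
have itE f' n : m f' -> hmcPk U h T n (fun x => (f' x)%:E) = (fun x => (iter n Q f' x)%:E).
  move=> mf''; elim: n => //= n IH; rewrite /hmcPk /= -/(hmcPk U h T n _) IH.
  by apply/funext => x; rewrite PE //; exact: mi.
have piE f' : m f' -> iint (fun q => (f' q)%:E * (expR (- U q) / Zconst U)%:E)%E = (fine (Pi f'))%:E.
  by move=> mf''; rewrite -PiE //; apply: eq_iint => x; rewrite -EFinM /w [_^-1 * _]mulrC.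
rewrite /hmc_int /pi_int (itE f1 k m1) (itE f2 k m2) (piE f1 m1) (piE f2 m2).
rewrite -!EFinB abse_EFin lee_fin; apply: H => // x.
have -> : f1 x - f2 x = f x by rewrite /f1 /f2; case: (leP (f x) 0) => ?; case: (leP (- f x) 0) => ?; lra.
exact: fV.
Qed.
End ergodicity.

(** * Drift and minorization *)

Section powR_large.
Context {R : realType}.

Lemma powR_unbounded (a B : R) : 0 < a -> exists2 r0 : R, 1 <= r0 & forall r : R, r0 <= r -> B <= powR r a.
Proof.
move=> a0; exists (powR (Num.max B 1) a^-1).
  by apply: powR_ge1; [rewrite invr_ge0 ltW|rewrite le_max lexx orbT].
move=> r rB; apply: (@le_trans _ _ (Num.max B 1)); first by rewrite le_max lexx.
have B0 : 0 <= Num.max B 1 by rewrite le_max ler01 orbT.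
move: (Num.max B 1) rB B0 => mx rB B0.
have -> : mx = powR (powR mx a^-1) a by rewrite -powRrM mulVf ?lt0r_neq0 // powRr1.
by apply: le_powR => //; [exact: ltW|exact: powR_ge0].
Qed.

Lemma expRN_le (c x : R) : 0 < c -> c <= 1 + x -> expR (- x) <= c^-1.
Proof. by move=> c0 H; rewrite expRN lef_pV2 ?posrE ?expR_gt0 //; apply: le_trans H (expR_ge1Dx _). Qed.
End powR_large.

(** * The drift inequality *)

Section drift.
Context {R : realType} {d : nat}.
Variables (U : 'rV[R]_d -> R) (h : R) (T : nat) (m K dl c1 R0 : R).
Hypothesis U3 : isC3 U.
Hypothesis m12 : 1 < m <= 2.
Hypothesis K0 : 0 <= K.
Hypothesis dl0 : 0 < dl.
Hypothesis c10 : 0 < c1.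
Hypothesis R01 : 1 <= R0.
Local Notation z := (leapfrogT U h).
Local Notation E := (rVb R d).
Local Notation X q := (powR (enorm q) (m - 1)).
Implicit Types (q p : 'rV[R]_d).
Hypothesis global : forall q p,
  enorm ((z T (q, p)).1 - q) + enorm (z T (q, p)).2 <= K * (enorm p + growthY m q).
Hypothesis good : forall q p, R0 <= enorm q -> enorm p <= dl * X q ->
  Ham U (z T (q, p)) <= Ham U (q, p) /\ enorm (z T (q, p)).1 <= enorm q - c1 * X q.

Definition lyapunov q : R := expR (enorm q).

Lemma measurable_lyapunov : measurable_fun [set: E] (lyapunov : E -> R).
Proof. by apply: measurableT_comp => //; exact: measurable_enorm. Qed.

Lemma lyapunov_ge1 q : 1 <= lyapunov q.
Proof. by rewrite -expR0 ler_expR. Qed.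

Let endpoint_le q p : enorm (endpoint U h T q p) <= enorm q + K * (enorm p + growthY m q).
Proof.
apply: le_trans (enorm_le_add _ q) _; rewrite lerD2l; apply: le_trans (global q p).
by rewrite lerDl.
Qed.

Let hmck_le q p : hmck U h T lyapunov q p <= expR (enorm q + K * (enorm p + growthY m q)) * gauss p.
Proof.
set M := expR _; rewrite /hmck.
have M1 : lyapunov (endpoint U h T q p) <= M by rewrite ler_expR.
have M2 : lyapunov q <= M.
  rewrite ler_expR lerDl mulr_ge0 // addr_ge0 // (le_trans ler01) // growthY_ge1 //.
have -> : M * gauss p = M * (acc U h T q p * gauss p) + M * ((1 - acc U h T q p) * gauss p) by ring.
by apply: lerD; apply: ler_wpM2r => //; [exact: accg_ge0|exact: rejg_ge0].
Qed.

Let hmck_good q p : R0 <= enorm q -> enorm p <= dl * X q ->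
  hmck U h T lyapunov q p <= lyapunov q * expR (- (c1 * X q)) * gauss p.
Proof.
move=> qR pX; have [HH Hq] := good qR pX.
have -> : hmck U h T lyapunov q p = lyapunov (endpoint U h T q p) * gauss p.
  have a1 : acc U h T q p = 1.
    by apply/min_idPl; rewrite -expR0 ler_expR subr_ge0.
  by rewrite /hmck a1; ring.
by rewrite ler_wpM2r ?gauss_ge0 // -expRD ler_expR.
Qed.

(** Where |p| >= dl X the growth term is at most 3 X <= 3 |p| / dl, hence the first summand. The
    extra 1 is traded for the factor exp(- dl X) in [hmck_far]; any exponential rate is integrable
    against the Gaussian. *)
Let K' := K * (1 + 3 / dl) + 1.

Let hmck_far q p : R0 <= enorm q -> dl * X q <= enorm p ->
  hmck U h T lyapunov q p <= lyapunov q * expR (- (dl * X q)) * (expR (K' * enorm p) * gauss p).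
Proof.
case/andP: m12 => m1 m2; have R1 := R01; have dl0' := dl0.
move=> qR pX; apply: (le_trans (hmck_le q p)).
rewrite mulrA ler_wpM2r ?gauss_ge0 // -!expRD ler_expR -addrA lerD2l.
have q1 : 1 <= enorm q by lra.
have X1 : 1 <= X q by apply: powR_ge1 => //; lra.
have Y3 : growthY m q <= 3 * X q.
  rewrite /growthY.
  have : powR (enorm q + 1) (m - 1) <= powR (2 * enorm q) (m - 1).
    by apply: le_powR; lra.
  rewrite powRM ?enorm_ge0 //.
  have : powR 2 (m - 1) * X q <= 2 * X q.
    apply: ler_wpM2r; first by lra.
    by rewrite -[leRHS]powRr1 //; apply: ler_powR => //; lra.
  lra.
have Xp : X q <= enorm p / dl by rewrite ler_pdivlMr // mulrC.
have : K * (enorm p + growthY m q) <= K * (enorm p + 3 * (enorm p / dl)).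
  by rewrite ler_wpM2l // lerD2l; apply: le_trans Y3 _; rewrite ler_wpM2l.
have -> : K * (enorm p + 3 * (enorm p / dl)) = (K' - 1) * enorm p.
  by rewrite /K'; field; rewrite gt_eqF.
lra.
Qed.

(** For large |q| the small momenta contribute at most exp(- c1 X) V and the large ones M exp(- dl
    X) V, a quarter of V each. For bounded |q| everything is absorbed in [b]. *)
Lemma drift_lyapunov : exists2 b : R, 0 < b &
  forall q, (hmcP U h T (fun y => (lyapunov y)%:E) q <= (2^-1 * lyapunov q + b)%:E)%E.
Proof.
case/andP: m12 => m1 m2; have R1 := R01.
have mL := measurable_lyapunov; have L0 q : 0 <= lyapunov q by rewrite expR_ge0.
have [M M0 HM] := @iint_gauss_exp R d K'; have [M' M'0 HM'] := @iint_gauss_exp R d K.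
(* The two summands make c1 X >= 3 and dl X >= 4 M; with exp(- x) <= 1 / (1 + x) each contribution
   is at most 1/4. *)
have [|r1 r11 Hr1] := @powR_unbounded R (m - 1) (3 / c1 + 4 * M / dl); first by lra.
pose R2 := Num.max R0 r1.
have R20 : 0 <= R2 by rewrite le_max (le_trans ler01 R1).
pose Y2 := powR (R2 + 1) (m - 1) + 1.
pose b := expR (R2 + K * Y2) * M' + 1.
have mge (c : R) : measurable_fun [set: E] (fun p : E => (expR (c * enorm (p : 'rV[R]_d)) * gauss (p : 'rV[R]_d))%:E).
  apply/measurable_EFinP; apply: measurable_funM; last exact: measurable_gauss.
  by apply: measurableT_comp => //; apply: measurable_funM => //; exact: measurable_enorm.
have mg : measurable_fun [set: E] (fun p : E => (gauss (p : 'rV[R]_d))%:E).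
  by apply/measurable_EFinP; exact: measurable_gauss.
have gge (c : R) (p : E) : (0 <= (expR (c * enorm (p : 'rV[R]_d)) * gauss (p : 'rV[R]_d))%:E)%E.
  by rewrite lee_fin mulr_ge0 ?expR_ge0 ?gauss_ge0.
exists b; first by rewrite ltr_wpDl // mulr_ge0 // expR_ge0.
move=> q; rewrite hmcPE //.
have hk0 p : (0 <= (hmck U h T lyapunov q p)%:E)%E by rewrite lee_fin hmck_ge0.
have mh := @measurable_hmck1 R d U h T U3 lyapunov q mL.
have [qR|qR] := leP R2 (enorm q); last first.
  apply: (@le_trans _ _ (iint (fun p => (expR (R2 + K * Y2))%:E * (expR (K * enorm p) * gauss p)%:E)%E)).
    apply: le_iint => //; first exact: measurable_funeM.
    move=> p; rewrite -EFinM lee_fin; apply: (le_trans (hmck_le q p)).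
    rewrite [leRHS]mulrA ler_wpM2r ?gauss_ge0 // -expRD ler_expR mulrDr [K * _ + _]addrC addrA lerD2r.
    apply: lerD; first exact: ltW.
    apply: ler_wpM2l => //; rewrite lerD2r; apply: le_powR; [lra|by rewrite addr_ge0|lra].
  rewrite iintZ ?expR_ge0 //.
  apply: (@le_trans _ _ ((expR (R2 + K * Y2))%:E * M'%:E)%E).
    by apply: lee_wpmul2l => //; rewrite lee_fin expR_ge0.
  by rewrite -EFinM lee_fin; have := L0 q; rewrite /b; lra.
have qR0 : R0 <= enorm q by apply: le_trans qR; rewrite le_max lexx.
have qr1 : r1 <= enorm q by apply: le_trans qR; rewrite le_max lexx orbT.
set x := X q; set Vq := lyapunov q.
have Hx : 3 / c1 + 4 * M / dl <= x by exact: Hr1.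
have cge : 0 <= c1 by exact: ltW.
have dge : 0 <= dl by exact: ltW.
have e1 : expR (- (c1 * x)) <= 4^-1.
  apply: expRN_le => //.
  have : c1 * (3 / c1 + 4 * M / dl) <= c1 * x by rewrite ler_pM2l.
  have : 0 <= c1 * (4 * M / dl) by rewrite !mulr_ge0 // invr_ge0.
  have : c1 * (3 / c1) = 3 by field; rewrite gt_eqF.
  by rewrite mulrDr; lra.
have e2 : M * expR (- (dl * x)) <= 4^-1.
  have : expR (- (dl * x)) <= (1 + 4 * M)^-1.
    apply: expRN_le; first by rewrite ltr_wpDr // mulr_ge0.
    have : dl * (3 / c1 + 4 * M / dl) <= dl * x by rewrite ler_pM2l.
    have : 0 <= dl * (3 / c1) by rewrite !mulr_ge0 // invr_ge0.
    have : dl * (4 * M / dl) = 4 * M by field; rewrite gt_eqF.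
    by rewrite mulrDr; lra.
  move=> H; apply: (le_trans (ler_wpM2l M0 H)).
  rewrite ler_pdivrMr ?ltr_wpDr ?mulr_ge0 //; lra.
have V0 : 0 <= Vq by exact: L0.
have c0' : 0 <= Vq * expR (- (c1 * x)) by rewrite mulr_ge0 ?expR_ge0.
have c0'' : 0 <= Vq * expR (- (dl * x)) by rewrite mulr_ge0 ?expR_ge0.
apply: (@le_trans _ _ (iint (fun p => (Vq * expR (- (c1 * x)))%:E * (gauss p)%:E +
    (Vq * expR (- (dl * x)))%:E * (expR (K' * enorm p) * gauss p)%:E)%E)).
  apply: le_iint => //.
    by apply: emeasurable_funD; exact: measurable_funeM.
  move=> p; rewrite -!EFinM -EFinD lee_fin.
  have [pX|/ltW pX] := leP (enorm p) (dl * x).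
    apply: (le_trans (hmck_good qR0 pX)); rewrite -/Vq -/x lerDl.
    by rewrite mulr_ge0 // mulr_ge0 ?expR_ge0 ?gauss_ge0.
  apply: (le_trans (hmck_far qR0 pX)); rewrite -/Vq -/x lerDr.
  by rewrite mulr_ge0 // gauss_ge0.
rewrite iintD; last 4 first.
- exact: measurable_funeM.
- exact: measurable_funeM.
- by move=> p; rewrite -EFinM lee_fin mulr_ge0 // gauss_ge0.
- by move=> p; rewrite mule_ge0 // lee_fin.
rewrite !iintZ //; last by move=> p; rewrite lee_fin gauss_ge0.
rewrite iint_gauss mule1.
apply: (@le_trans _ _ ((Vq * expR (- (c1 * x)))%:E + (Vq * expR (- (dl * x)))%:E * M%:E)%E).
  by rewrite leeD2l // lee_wpmul2l.
rewrite -EFinM -EFinD lee_fin.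
have : Vq * expR (- (c1 * x)) <= Vq * 4^-1 by rewrite ler_wpM2l.
have : Vq * (M * expR (- (dl * x))) <= Vq * 4^-1 by rewrite ler_wpM2l.
have : 0 <= b by rewrite /b addr_ge0 // mulr_ge0 // expR_ge0.
lra.
Qed.
End drift.

(** * The hypotheses of the drift and of the minorization, from (A), (B) and (C) *)

Section regions.
Context {R : realType} {d : nat}.
Variables (U : 'rV[R]_d -> R) (m A1 A2 A3 A4 Rad : R) (T : nat).
Hypothesis U3 : isC3 U.
Hypothesis m12 : 1 < m <= 2.
Hypothesis A10 : 0 <= A1.
Hypothesis T0 : (0 < T)%N.
Hypothesis hA : forall q : 'rV[R]_d,
      (opnorm2 U q <= (A1 * powR (enorm q + 1) (m - 2))%:E)%E /\
      (opnorm3 U q <= (A1 * powR (enorm q + 1) (m - 3))%:E)%E.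
Hypothesis A20 : 0 < A2.
Hypothesis hB : forall q : 'rV[R]_d,
      Rad <= enorm q -> A2 * powR (enorm q) (3 * m - 4) <= D2 U q (grad U q) (grad U q).
Hypothesis A30 : 0 < A3.
Hypothesis hC : forall q : 'rV[R]_d, A3 * powR (enorm q) m - A4 <= dotv (grad U q) q.
Local Notation z := (leapfrogT U).
Local Notation g := (grad U).
Local Notation E := (rVb R d).
Local Notation X q := (powR (enorm q) (m - 1)).
Implicit Types (q p : 'rV[R]_d).

(** The common form of the two cases: automatic for every h when m < 2, and equivalent to h^2 <= kap
    when m = 2. *)
Definition eventually_small (h kap : R) :=
  exists R1 : R, forall r : R, R1 <= r -> h ^+ 2 * powR r (m - 2) <= kap.

(** The order of the quantifiers matters: [kap] is fixed before [h], whereas the radius, the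
    momentum window c0 s and the gain A3 / 16 s^2 may depend on [h]. The division by T^2 converts
    h^2 eta into s^2 eta. *)
Lemma good_region : exists2 kap : R, 0 < kap & forall h : R, 0 < h -> eventually_small h kap ->
  exists R0 dl c1, [/\ 1 <= R0, 0 < dl, 0 < c1 & forall q p, R0 <= enorm q -> enorm p <= dl * X q ->
   Ham U (z h T (q, p)) <= Ham U (q, p) /\ enorm (z h T (q, p)).1 <= enorm q - c1 * X q].
Proof.
case/andP: (m12) => m1 m2; have A20' := A20; have A30' := A30.
have [C C1 HC] := annulus_bounds U3 m12 A10 hA.
have C0 : 0 < C by lra.
have Tp : 0 < T%:R :> R by rewrite ltr0n.
(* The two entries keep the share of the momentum below half of what (B) gains in the energy and
   half of what (C) gains in the position. *)
pose c0 := Num.min (A2 / (4 * C ^+ 2)) (A3 / 4).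
pose D1 := c0 + C.
pose E1 := 2 * C ^+ 3 * D1 + 3 * C ^+ 2 * D1 ^+ 2 + 64 * T%:R ^+ 3 * C * D1 ^+ 3.
have c00 : 0 < c0 by rewrite lt_min !divr_gt0 // mulr_gt0 // exprn_gt0.
have D10 : 0 < D1 by rewrite addr_gt0.
have E10 : 0 < E1.
  by rewrite /E1; repeat (first [apply: addr_gt0|apply: mulr_gt0|apply: exprn_gt0]).
have G0 : 0 < 4 * (2 * C * D1 + D1 ^+ 2) by rewrite mulr_gt0 // addr_gt0 // ?mulr_gt0 // exprn_gt0.
pose k0 := Num.min (1 / (2 * D1)) (Num.min (A2 / (2 * E1)) (A3 / (4 * (2 * C * D1 + D1 ^+ 2)))).
have k00 : 0 < k0 by rewrite !lt_min !divr_gt0 // mulr_gt0.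
have c0A2 : 4 * C ^+ 2 * c0 <= A2.
  by rewrite mulrC -ler_pdivlMr ?mulr_gt0 ?exprn_gt0 // ge_min lexx.
have c0A3 : 4 * c0 <= A3.
  by rewrite mulrC -ler_pdivlMr // ge_min lexx orbT.
have kap1 : 2 * D1 * k0 <= 1.
  by rewrite mulrC -ler_pdivlMr ?mulr_gt0 // ge_min lexx.
have kap2 : 2 * E1 * k0 <= A2.
  by rewrite mulrC -ler_pdivlMr ?mulr_gt0 // !ge_min lexx orbT.
have kap3 : 4 * (2 * C * D1 + D1 ^+ 2) * k0 <= A3.
  by rewrite mulrC -ler_pdivlMr // !ge_min lexx !orbT.
exists (k0 / T%:R ^+ 2); first by rewrite divr_gt0 // exprn_gt0.
move=> h h0 [R1 HR1].
pose s := T%:R * h.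
have s0 : 0 < s by rewrite mulr_gt0.
exists (Num.max (Num.max 1 R1) (Num.max Rad (8 * A4 / A3))), (c0 * s), (A3 / 16 * s ^+ 2); split.
- by rewrite !le_max lexx.
- exact: mulr_gt0.
- by rewrite mulr_gt0 ?exprn_gt0 // divr_gt0.
move=> q p; rewrite !ge_max => /andP[/andP[r1 rR1] /andP[rRad rA4]] pX.
set r := enorm q in r1 rR1 rRad rA4 pX *.
have r0 : 0 < r by lra.
pose eta := powR r (m - 2).
have eta0 : 0 < eta by exact: powR_gt0.
have XE : powR r (m - 1) = eta * r by rewrite mulrC; apply: mulr_powR1 => //; ring.
have X1 : 1 <= powR r (m - 1) by apply: powR_ge1; lra.
have etak : s ^+ 2 * eta <= k0.
  have := HR1 _ rR1; rewrite -/eta ler_pdivlMr ?exprn_gt0 // => H.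
  by rewrite (_ : s ^+ 2 * eta = h ^+ 2 * eta * T%:R ^+ 2) // /s; ring.
have ann (x : 'rV[R]_d) : enorm (x - q) <= r / 2 -> r / 2 <= enorm x /\ enorm x <= 3 / 2 * r.
  move=> H; have := enorm_le_add x q; have := enorm_le_add q x.
  by rewrite (enorm_dist q x) -/r; split; lra.
have qq : enorm (q - q) <= r / 2 by rewrite subrr enorm0 divr_ge0 // ltW.
have hG (x : 'rV[R]_d) : enorm (x - q) <= r / 2 -> enorm (g x) <= C * powR r (m - 1).
  by move=> /ann[x1 x2]; case: (HC r x r1 x1 x2).
have hL (x v : 'rV[R]_d) : (forall t : R, 0 <= t <= 1 -> enorm (x + t *: v - q) <= r / 2) ->
    enorm (g (x + v) - g x) <= C * eta * enorm v.
  move=> H; apply: (grad_lipschitz U3 A10 hA) => t /H/ann[x1 x2].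
  by case: (HC r _ r1 x1 x2).
have [q1 q2] := ann _ qq.
have hD2 : forall a b, `|D2 U q a b| <= C * eta * enorm a * enorm b by case: (HC r q r1 q1 q2).
have hD3 (x a b c : 'rV[R]_d) : enorm (x - q) <= r / 2 ->
    `|D3 U x a b c| <= C * (eta / r) * enorm a * enorm b * enorm c.
  by move=> /ann[x1 x2]; case: (HC r x r1 x1 x2).
have hB' : A2 * (eta * powR r (m - 1) ^+ 2) <= D2 U q (g q) (g q).
  have := hB rRad; rewrite -/r.
  rewrite (_ : 3 * m - 4 = (m - 2) + (m - 1) + (m - 1)); last by ring.
  have rD (a b : R) : powR r (a + b) = powR r a * powR r b by rewrite powRD // (gt_eqF r0) implybT.
  by rewrite (rD (m - 2 + (m - 1))) (rD (m - 2)) -/eta -[eta * _ * _]mulrA -expr2.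
have hC' : A3 * (r * powR r (m - 1)) - A4 <= dotv (g q) q.
  by have := hC q; rewrite -/r (mulr_powR1 r0 (_ : m = m - 1 + 1)) //; ring.
have A4X : 8 * A4 <= A3 * (r * powR r (m - 1)).
  move: rA4; rewrite ler_pdivrMr // => H; apply: (le_trans H).
  by rewrite mulrC ler_pM2l // ler_peMr // ltW.
split.
  apply: (good_energy U3 h0 (erefl s) (erefl D1) (erefl E1) (erefl _) T0 r0 eta0 XE C0 c00 c0A2 kap1 kap2 etak pX hG hL hD2 hD3 hB').
have := good_position h0 (erefl s) (erefl D1) (erefl _) T0 (erefl r) r0 eta0 XE C0 A30 c00 c0A3 kap1 kap3 etak pX A4X hG hL hC'.
by rewrite mulrA.
Qed.

Lemma U_bounded (rho : R) : exists2 B : R, 0 <= B & forall x, enorm x <= rho -> `|U x| <= B.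
Proof.
case/andP: (m12) => m1 m2.
have [C0 C00 hg] := grad_growth U3 m12 A10 hA.
have [rho0|rho0] := leP 0 rho; last first.
  by exists 0 => // x; have := enorm_ge0 x; lra.
pose G := C0 * powR (rho + 1) (m - 1).
exists (`|U 0| + G * rho).
  by rewrite addr_ge0 // !mulr_ge0 ?powR_ge0.
move=> x xr; have [c /andP[c0 c1]] := U_MVT U3 0 x; rewrite !add0r => E1.
have -> : U x = U 0 + dotv (g (c *: x)) x by rewrite -E1 addrC subrK.
apply: (le_trans (ler_normD _ _)); rewrite lerD2l.
have cx : enorm (c *: x) <= rho.
  by rewrite enormZ ger0_norm // (le_trans _ xr) // ler_piMl.
have gx : enorm (g (c *: x)) <= G.
  apply: (le_trans (hg _)); rewrite ler_wpM2l //; apply: le_powR; rewrite ?lerD2r //; first by lra.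
  by rewrite addr_ge0.
have := dotv_le (g (c *: x)) x; have := dotv_ge (g (c *: x)) x => H1 H2.
have : enorm (g (c *: x)) * enorm x <= G * rho by rewrite ler_pM.
by rewrite ler_norml => H3; apply/andP; split; lra.
Qed.

(** For bounded (q, p) the endpoint is bounded by [global_bound], hence so is the energy change;
    neither the acceptance probability nor the Gaussian density can then approach 0. *)
Lemma acc_gauss_lower (h rho rho' : R) : 0 < h ->
  exists2 eps : R, 0 < eps & forall q p, enorm q <= rho -> enorm p <= rho' -> eps <= acc U h T q p * gauss p.
Proof.
move=> h0; case/andP: (m12) => m1 m2.
have [C0 C00 hg] := grad_growth U3 m12 A10 hA.
have [K K0 HK] := global_bound m12 C00 h0 hg T.
have [rho0|rho0] := leP 0 rho; last by exists 1 => // q p; have := enorm_ge0 q; lra.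
have [rho'0|rho'0] := leP 0 rho'; last by exists 1 => // q p _; have := enorm_ge0 p; lra.
pose D := K * (rho' + (powR (rho + 1) (m - 1) + 1)).
have [B B0 HB] := U_bounded (rho + D).
pose c := (Num.sqrt (2 * (@pi R))) ^- d.
have cp : 0 < c by rewrite invr_gt0 exprn_gt0 // sqrtr_gt0 mulr_gt0 // pi_gt0.
exists (expR (- (2 * B + D ^+ 2 / 2)) * (c * expR (- (rho' ^+ 2 / 2)))).
  by rewrite !mulr_gt0 // expR_gt0.
move=> q p qr pr.
have H : enorm ((z h T (q, p)).1 - q) + enorm (z h T (q, p)).2 <= D.
  apply: (le_trans (HK q p)); rewrite ler_wpM2l // lerD // lerD2r.
  by apply: le_powR; [lra|rewrite addr_ge0|rewrite lerD2r].
have D0 : 0 <= D by apply: le_trans H; rewrite addr_ge0.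
have z1 : enorm (z h T (q, p)).1 <= rho + D.
  by have := enorm_le_add (z h T (q, p)).1 q; have := enorm_ge0 (z h T (q, p)).2; lra.
have z2 : enorm (z h T (q, p)).2 <= D by have := enorm_ge0 ((z h T (q, p)).1 - q); lra.
apply: ler_pM.
- exact: expR_ge0.
- by rewrite mulr_ge0 ?expR_ge0 // ltW.
- rewrite /acc /accept le_min; apply/andP; split.
    by rewrite -[leRHS]expR0 ler_expR; have := sqr_ge0 D; lra.
  rewrite ler_expR /Ham /=.
  have := HB _ z1; have qD : enorm q <= rho + D by lra.
  have := HB _ qD; rewrite !ler_norml => /andP[u1 u2] /andP[v1 v2].
  have : dotv (z h T (q, p)).2 (z h T (q, p)).2 <= D ^+ 2.
    by rewrite -enorm_sqr ler_pXn2r ?nnegrE.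
  have := dotv_ge0 p; lra.
rewrite /gauss -/c ler_pM2l // ler_expR lerN2 ler_pM2r //.
by rewrite -enorm_sqr ler_pXn2r ?nnegrE.
Qed.

Lemma Zconst_gt0 : (iint (fun q => (expR (- U q))%:E) < +oo)%E ->
  0 < Zconst U /\ iint (fun q => ((Zconst U)^-1 * expR (- U q))%:E) = 1%E.
Proof.
move=> fin.
have mU : measurable_fun [set: E] (fun q : E => (expR (- U q))%:E).
  apply/measurable_EFinP; apply: measurableT_comp => //; apply: measurable_funN; exact: measurable_U.
have nU q : (0 <= (expR (- U q))%:E)%E by rewrite lee_fin expR_ge0.
(* The unit cube of the max norm lies in the Euclidean ball of radius d; [U] is bounded there, so
   the mass is positive. *)
have [B B0 HB] := U_bounded d%:R.
have pos : (0 < iint (fun q => (expR (- U q))%:E))%E.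
  apply: (@lt_le_trans _ _ ((expR (- B))%:E * muV (cbox 0 1))%E).
    by rewrite muV_cbox // -EFinM lte_fin mulr_gt0 ?expR_gt0 // exprn_gt0.
  rewrite /muV -iintZ ?expR_ge0 //.
  - apply: le_iint => //.
    + apply: measurable_funeM; apply/measurable_EFinP.
      by apply: measurable_indic; exact: measurable_cbox.
    + move=> q; rewrite -EFinM lee_fin indicE; have [/set_mem H|_] := boolP (q \in _); last first.
        by rewrite mulr0 expR_ge0.
      rewrite mulr1 ler_expR lerN2; apply: (le_trans (ler_norm _)); apply: HB.
      apply: (le_trans (enorm_le_mxnorm _)); rewrite -[leRHS]mulr1 ler_wpM2l //.
      by move: H; rewrite /cbox /= subr0.
  - by apply/measurable_EFinP; apply: measurable_indic; exact: measurable_cbox.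
have ZE : iint (fun q => (expR (- U q))%:E) = (Zconst U)%:E.
  by rewrite fineK // ge0_fin_numE // iint_ge0.
have Z0 : 0 < Zconst U by rewrite -lte_fin -ZE.
split=> //.
rewrite (eq_iint (g := fun q => ((Zconst U)^-1)%:E * (expR (- U q))%:E)%E) // iintZ //.
  by rewrite ZE -EFinM mulVf // gt_eqF.
by rewrite invr_ge0 ltW.
Qed.

(** The measure nu is a multiple of Lebesgue measure on a cube around s p0, the endpoint of free
    motion from the origin. Cube and multiple depend on [rc] but not on [q], since all the
    trajectory estimates are uniform over the ball. *)
Lemma minorization : exists2 kap : R, 0 < kap & forall h : R, 0 < h -> eventually_small h kap ->
  forall rc : R, exists nu : {measure set E -> \bar R},
    [/\ (\int[nu]_x (lyapunov x)%:E < +oo)%E, (0 < nu setT)%E &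
     forall (f : 'rV[R]_d -> R) q, measurable_fun [set: E] (f : E -> R) -> (forall x, 0 <= f x) ->
      enorm q <= rc -> (\int[nu]_x (f x)%:E <= hmcP U h T (fun y => (f y)%:E) q)%E].
Proof.
(* In dimension 0 there is no direction in which to throw the trajectory; the space is a single
   point and the Dirac mass works. *)
have [d0|dpos] := posnP d.
  exists 1 => // h h0 _ rc; exists (\d_(0 : E)); split.
  - rewrite integral_dirac //; first by rewrite diracT mul1e ltry.
    by apply/measurable_EFinP; exact: measurable_lyapunov.
  - by have := @diracT _ E R (0 : E); rewrite /= => ->.
  move=> f q mf f0 _.
  have all0 (x : 'rV[R]_d) : x = 0.
    by apply/rowP => j; exfalso; case: j => j; rewrite d0.
  rewrite integral_dirac //; last by apply/measurable_EFinP.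
  rewrite diracT mul1e hmcPE // (eq_iint (g := fun p => (f 0)%:E * (gauss p)%:E)%E); last first.
    move=> p; rewrite -EFinM; congr EFin.
    by rewrite /hmck (all0 (endpoint U h T q p)) (all0 q); ring.
  rewrite iintZ // ?iint_gauss ?mule1 //; first by apply/measurable_EFinP; exact: measurable_gauss.
  by move=> p; rewrite lee_fin gauss_ge0.
pose i0 := Ordinal dpos.
case/andP: (m12) => m1 m2.
have [C0 C00 hg] := grad_growth U3 m12 A10 hA.
have T1 : 1 <= T%:R :> R by rewrite ler1n.
have d1 : 1 <= d%:R :> R by rewrite ler1n.
pose k1 := 36 * C0 * T%:R ^+ 3; pose k2 := 8 * d%:R * T%:R ^+ 2 * A1.
have k10 : 0 <= k1 by rewrite !mulr_ge0 ?exprn_ge0.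
have k20 : 0 <= k2 by rewrite !mulr_ge0 ?exprn_ge0.
have k0 : 0 < k1 + k2 + 1 by rewrite ltr_wpDl // addr_ge0.
exists (k1 + k2 + 1)^-1; first by rewrite invr_gt0.
move=> h h0 [R1 HR1] rc.
pose r := Num.max (Num.max 1 R1) (4 * rc).
have r1 : 1 <= r by rewrite !le_max lexx.
have rR1 : R1 <= r by rewrite !le_max lexx orbT.
have rcr : 4 * rc <= r by rewrite le_max lexx orbT.
have hk := HR1 _ rR1; set eta := powR r (m - 2) in hk.
have he0 : 0 <= h ^+ 2 * eta by rewrite mulr_ge0 ?sqr_ge0 ?powR_ge0.
have he1 : (k1 + k2 + 1) * (h ^+ 2 * eta) <= 1 by rewrite mulrC -ler_pdivlMr // div1r.
have small1 : k1 * (h ^+ 2 * eta) <= 1.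
  by have := mulr_ge0 k20 he0; lra.
have small2 : k2 * (h ^+ 2 * eta) <= 1.
  by have := mulr_ge0 k10 he0; lra.
pose N : R := 4 * r / h; pose s : R := T%:R * h.
have N0 : 0 < N by rewrite divr_gt0 // mulr_gt0 //; lra.
have s0 : 0 < s by rewrite mulr_gt0 //; lra.
pose p0 : E := N *: ebasis i0; pose y0 : E := s *: (p0 : 'rV[R]_d).
have surj q y := @position_surjective R d U m C0 A1 h T i0 r rc N s eta U3 m12 C00 A10 h0 T0 hg hA r1 rcr
   (erefl _) (erefl _) (erefl _) small1 small2 q y.
(* The first entry makes every point within e of the cube, hence within 2 e of its centre, an
   admissible target of [position_surjective]; the second is the radius around the preimage on which
   its Lipschitz bound holds. *)
pose e := Num.min (s * N / (32 * d%:R)) (N / (8 * d%:R)).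
have dp : 0 < d%:R :> R by lra.
have e0 : 0 < e by rewrite lt_min; apply/andP; split; apply: divr_gt0 => //; repeat apply: mulr_gt0 => //.
pose B : set E := [set p : E | enorm ((p : 'rV[R]_d) - p0) <= N / 2].
pose E0 : set E := cbox y0 e.
pose L := 2 * s * d%:R.
have L0 : 0 < L := mulr_gt0 (mulr_gt0 (ltr0Sn R 1) s0) dp.
have mE0 : measurable E0 by exact: measurable_cbox.
have mB : measurable B by apply: measurable_closed; exact: closed_eball.
have Bfin : (muV B < +oo)%E.
  apply: (@le_lt_trans _ _ (muV (cbox p0 (N / 2)))).
    apply: le_measure; rewrite ?inE //; first exact: measurable_cbox.
    by move=> p Hp; rewrite /cbox /=; apply: le_trans Hp; exact: mxnorm_le_enorm.
  by rewrite muV_cbox ?ltry // divr_ge0 // ltW.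
have E0E : muV E0 = ((2 * e) ^+ d)%:E by rewrite muV_cbox // ltW.
have E0fin : (muV E0 < +oo)%E by rewrite E0E ltry.
pose c := (2 * L) ^+ d.
have c0 : 0 < c by rewrite exprn_gt0 // mulr_gt0.
have [eps eps0 Heps] := acc_gauss_lower rc (N + N / 2) h0.
have w0 : 0 <= eps / c by rewrite divr_ge0 // ltW.
(* [eps] bounds acceptance times Gaussian density from below, and [c] is the loss in the comparison
   of cubes. *)
pose nu : {measure set E -> \bar R} := mscale (NngNum w0) (mrestr muV mE0).
have nuE (f : E -> \bar R) : measurable_fun setT f -> (forall x, 0 <= f x)%E ->
    (\int[nu]_x f x = (eps / c)%:E * \int[mrestr muV mE0]_x f x)%E.
  by move=> mf f0; rewrite /nu ge0_integral_mscale.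
exists nu; split.
- rewrite nuE; last 2 first.
  + by apply/measurable_EFinP; exact: measurable_lyapunov.
  + by move=> x; rewrite lee_fin expR_ge0.
  rewrite lte_mul_pinfty // ?lee_fin //.
  apply: (@le_lt_trans _ _ (\int[muV]_x ((expR (enorm (y0 : 'rV[R]_d) + d%:R * e))%:E * (\1_E0 x)%:E))%E).
    apply: (@le_trans _ _ (\int[muV]_x ((lyapunov x)%:E * (\1_E0 x)%:E))%E).
      apply: le_integral_mrestr => //; first by apply/measurable_EFinP; exact: measurable_lyapunov.
      by move=> x; rewrite lee_fin expR_ge0.
    apply: ge0_le_integral => //.
    - by move=> x _; rewrite mule_ge0 // lee_fin expR_ge0.
    - apply: emeasurable_funM; first by apply/measurable_EFinP; exact: measurable_lyapunov.
      by apply/measurable_EFinP; exact: measurable_indic.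
    - by apply: measurable_funeM; apply/measurable_EFinP; exact: measurable_indic.
    move=> x _; rewrite -!EFinM lee_fin indicE; have [/set_mem Ex|_] := boolP (x \in E0); last by rewrite !mulr0.
    rewrite !mulr1 ler_expR; apply: (le_trans (enorm_le_add x y0)); rewrite lerD2l.
    by apply: (le_trans (enorm_le_mxnorm _)); rewrite ler_wpM2l.
  rewrite ge0_integralZl_EFin //; last by apply/measurable_EFinP; exact: measurable_indic.
  by rewrite integral_indic // setIT lte_mul_pinfty // lee_fin expR_ge0.
- have -> : nu setT = ((eps / c)%:E * muV E0)%E.
    by rewrite -[LHS]/((eps / c)%:E * muV ([set: E] `&` E0))%E setTI.
  by rewrite mule_gt0 // ?lte_fin ?divr_gt0 // E0E lte_fin exprn_gt0 // mulr_gt0.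
move=> f q mf f0 qrc.
have mF : measurable_fun [set: E] (fun p : E => endpoint U h T q p : E).
  exact: (measurableT_comp (measurable_endpoint2 h T U3) (@pair1_measurable _ _ E E q)).
have HF (y : 'rV[R]_d) : (exists2 x : 'rV[R]_d, E0 x & `|y - x| <= e) ->
    exists2 p : 'rV[R]_d, endpoint U h T q p = y &
     forall p' : 'rV[R]_d, `|p' - p| <= e -> B p' /\ `|endpoint U h T q p' - y| <= L * `|p' - p|.
  move=> [x Ex yx].
  have yB : enorm (y - y0) <= s * N / 16.
    apply: (le_trans (enorm_le_mxnorm _)).
    have yy : `|y - y0| <= 2 * e.
      have -> : y - y0 = (y - x) + (x - y0) by rewrite addrA subrK.
      apply: (le_trans (ler_normD _ _)).
      by move: Ex; rewrite /E0 /cbox /=; move: yx; lra.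
    apply: (@le_trans _ _ (d%:R * (2 * (s * N / (32 * d%:R))))).
      rewrite ler_wpM2l //; apply: (le_trans yy); rewrite ler_wpM2l //; by rewrite ge_min lexx.
    by rewrite le_eqVlt; apply/orP; left; apply/eqP; field; rewrite gt_eqF //; lra.
  have [p pE Hp] := surj q y qrc yB.
  exists p => // p' pp'; apply: Hp; apply: (le_trans pp'); by rewrite ge_min lexx orbT.
have mEf : measurable_fun setT (fun x : E => (f x)%:E) by exact/measurable_EFinP.
have f0E (x : E) : (0 <= (f x)%:E)%E by rewrite lee_fin.
have key := @lipschitz_image_integral R d _ B E0 L e mF mB mE0 Bfin E0fin L0 e0 HF _ mEf f0E.
rewrite nuE //.
apply: (@le_trans _ _ ((eps / c)%:E * (c%:E * \int[muV]_p ((f (endpoint U h T q p))%:E * (\1_B p)%:E)))%E).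
  by rewrite lee_wpmul2l // lee_fin.
rewrite muleA -EFinM divfK ?gt_eqF //.
have mFB : measurable_fun setT (fun p : E => ((f (endpoint U h T q p))%:E * (\1_B p)%:E)%E).
  apply: emeasurable_funM; last by apply/measurable_EFinP; exact: measurable_indic.
  by apply/measurable_EFinP; exact: (measurableT_comp mf mF).
rewrite hmcPE // -iintE //; last by move=> p; rewrite mule_ge0 // lee_fin.
rewrite -iintZ //; last 2 first.
- by move=> p; rewrite mule_ge0 // lee_fin.
- exact: ltW.
apply: le_iint => //.
- exact: measurable_funeM.
- exact: measurable_hmck1.
- by move=> p; rewrite !mule_ge0 // lee_fin // ltW.
move=> p; rewrite -!EFinM lee_fin indicE; have [/set_mem Bp|_] := boolP (p \in B); last first.
  by rewrite !mulr0 hmck_ge0.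
rewrite mulr1 mulrC; apply: (@le_trans _ _ (f (endpoint U h T q p) * (acc U h T q p * gauss p))).
  rewrite ler_wpM2l //; apply: Heps => //.
  apply: (le_trans (enorm_le_add p p0)); rewrite lerD //.
  by rewrite enormZ enorm_ebasis mulr1 ger0_norm // ltW.
by rewrite /hmck lerDl mulr_ge0 // rejg_ge0.
Qed.
End regions.

Section main.
Context {R : realType} {d : nat}.
Variables (U : 'rV[R]_d -> R) (m A1 A2 A3 A4 Rad : R) (T : nat).
Hypothesis U3 : isC3 U.
Hypothesis m12 : 1 < m <= 2.
Hypothesis Ufin : (iint (fun q => (expR (- U q))%:E) < +oo)%E.
Hypothesis A10 : 0 <= A1.
Hypothesis T0 : (0 < T)%N.
Hypothesis hA : forall q : 'rV[R]_d,
      (opnorm2 U q <= (A1 * powR (enorm q + 1) (m - 2))%:E)%E /\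
      (opnorm3 U q <= (A1 * powR (enorm q + 1) (m - 3))%:E)%E.
Hypothesis A20 : 0 < A2.
Hypothesis hB : forall q : 'rV[R]_d,
      Rad <= enorm q -> A2 * powR (enorm q) (3 * m - 4) <= D2 U q (grad U q) (grad U q).
Hypothesis A30 : 0 < A3.
Hypothesis hC : forall q : 'rV[R]_d, A3 * powR (enorm q) m - A4 <= dotv (grad U q) q.

Lemma geometrically_ergodic_small : exists2 kap : R, 0 < kap &
  forall h : R, 0 < h -> eventually_small m h kap -> geometrically_ergodic U h T.
Proof.
have [k1 k10 good] := good_region U3 m12 A10 T0 hA A20 hB A30 hC.
have [k2 k20 minor] := minorization U3 m12 A10 T0 hA.
exists (Num.min k1 k2); first by rewrite lt_min k10.
move=> h h0 [R1 HR1].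
have small1 : eventually_small m h k1 by exists R1 => r /HR1; rewrite le_min => /andP[].
have small2 : eventually_small m h k2 by exists R1 => r /HR1; rewrite le_min => /andP[].
have [R0 [dl [c1 [R01 dl0 c10 Hgood]]]] := good h h0 small1.
have [C0 C00 hg] := grad_growth U3 m12 A10 hA.
have [K K0 HK] := global_bound m12 C00 h0 hg T.
have [b b0 drift] := drift_lyapunov U3 m12 K0 dl0 c10 R01 HK Hgood.
have [nu [nuV nu_pos Hnu]] := minor h h0 small2 (4 * b / (1 - 2^-1)).
have [Z0 Z1] := Zconst_gt0 U3 m12 A10 hA Ufin.
have l01 : 0 <= (2^-1 : R) < 1 by apply/andP; split; lra.
apply: (harris_hmc U3 (ltW Z0) Z1 (@measurable_lyapunov R d) (@lyapunov_ge1 R d) l01 b0 drift nuV nu_pos).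
move=> f q mf f0 Vq; apply: Hnu => //; apply: le_trans Vq.
(* Since exp(x) >= 1 + x, the sublevel set of V at height r lies in the ball of radius r, so the
   same number serves as [rc]. *)
by rewrite /lyapunov; have := expR_ge1Dx (enorm q); lra.
Qed.
End main.

Theorem theorem9 (R : realType) (d : nat) (m : R) (U : 'rV[R]_d -> R) :
  1 < m <= 2 ->
  isC3 U ->
  (iint (fun q => (expR (- U q))%:E) < +oo)%E ->
  (* (A) *)
  (exists A1 : R, 0 <= A1 /\ forall q : 'rV[R]_d,
      (opnorm2 U q <= (A1 * powR (enorm q + 1) (m - 2))%:E)%E /\
      (opnorm3 U q <= (A1 * powR (enorm q + 1) (m - 3))%:E)%E) ->
  (* (B) *)
  (exists (A2 Rad : R), 0 < A2 /\ 0 <= Rad /\ forall q : 'rV[R]_d,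
      Rad <= enorm q -> A2 * powR (enorm q) (3 * m - 4) <= D2 U q (grad U q) (grad U q)) ->
  (* (C) *)
  (exists (A3 A4 : R), 0 < A3 /\ forall q : 'rV[R]_d,
      A3 * powR (enorm q) m - A4 <= dotv (grad U q) q) ->
  (m < 2 -> forall (T : nat) (h : R), (0 < T)%N -> 0 < h -> geometrically_ergodic U h T) /\
  (m = 2 -> forall T : nat, (0 < T)%N ->
      exists hH : R, 0 < hH /\ forall h : R, 0 < h <= hH -> geometrically_ergodic U h T).
Proof.
move=> m12 U3 Ufin [A1 [A10 hA]] [A2 [Rad [A20 [_ hB]]]] [A3 [A4 [A30 hC]]].
split=> [m2 T h T0 h0|m2 T T0].
  have [kap kap0 H] := geometrically_ergodic_small U3 m12 Ufin A10 T0 hA A20 hB A30 hC.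
  apply: H => //.
  (* For m < 2 the power r^(2 - m) is unbounded and eventually exceeds h^2 / kap, whatever [h]
     is. *)
  have m20 : 0 < 2 - m by lra.
  have [r0 r01 Hr] := powR_unbounded (h ^+ 2 / kap) m20.
  exists r0 => r rr.
  have rp : 0 < powR r (2 - m) by apply: powR_gt0; lra.
  rewrite -[m - 2]opprK powRN opprB ler_pdivrMr //.
  by have := Hr r rr; rewrite ler_pdivrMr // mulrC.
have [kap kap0 H] := geometrically_ergodic_small U3 m12 Ufin A10 T0 hA A20 hB A30 hC.
(* For m = 2 the exponent vanishes and the condition reads h^2 <= kap. *)
exists (Num.sqrt kap); split; first by rewrite sqrtr_gt0.
move=> h /andP[h0 hk]; apply: H => //; exists 1 => r _.
rewrite m2 subrr powRr0 mulr1 -[leRHS]sqr_sqrtr; last exact: ltW.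
by rewrite ler_pXn2r ?nnegrE ?sqrtr_ge0 // ltW.
Qed.
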